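(* Let $n \geq 1$. Let $k_1,\ldots,k_n > 1$ be real numbers, not necessarily integers. Suppose that $\mu$ is a Borel measure on $\mathbb{R}^n_{+}$ with density $\exp(-\varphi)$, where $\varphi: \mathbb{R}^n_{+} \rightarrow \mathbb{R}$ is a smooth function such that $$\mathbb{R}^n_+ \ni (x_1,\ldots,x_n) \mapsto \varphi\left(x_1^{k_1},\ldots,x_n^{k_n}\right)$$ is a convex function on $\mathbb{R}^n_+$. Assume that $f: \mathbb{R}^n_+ \rightarrow \mathbb{R}$ is a $\mu$-integrable, locally Lipschitz function with $\int f \, d\mu = 0$. Then $$\int_{\mathbb{R}^n_{+}} f^2 \, d\mu \leq \int_{\mathbb{R}^n_{+}} \sum_{i=1}^n \frac{k_i^2}{k_i-1} x_i^{2} \left| \partial^i f(x) \right|^2 d\mu(x).$$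
   Context: $\mathbb{R}^n_+$ denotes the set of all $x\in\mathbb{R}^n$ with positive coordinates; density is with respect to Lebesgue measure; smooth means $C^\infty$; $\partial^if=\partial f/\partial x_i$ (defined almost everywhere). The right-hand side may be $+\infty$. *)

(* Defs.v *)
From HB Require Import structures.
From mathcomp Require Import all_boot all_order all_algebra.
From mathcomp Require Import all_classical all_reals all_analysis.
From mathcomp Require Import measurable_realfun.

Set Implicit Arguments.
Unset Strict Implicit.
Unset Printing Implicit Defensive.

Import Order.TTheory GRing.Theory Num.Theory.
Import numFieldNormedType.Exports.

Local Open Scope classical_set_scope.
Local Open Scope ring_scope.

(* The Borel sigma-algebra, generated by the open sets, on real matrices; the
   library has no measurable structure on 'rV[R]_n. *)
Section borel_matrix.
Variables (R : realType) (m n : nat).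

HB.instance Definition _ :=
  @isMeasurable.Build (sigma_display (@open 'M[R]_(m, n))) 'M[R]_(m, n)
    <<s @open 'M[R]_(m, n) >> (@sigma_algebra0 _ setT _)
    (@sigma_algebraC _ _) (@sigma_algebra_bigcup _ setT _).

End borel_matrix.

Section measurable_row_vectors.
Variable R : realType.
Implicit Types n : nat.

Lemma open_measurable_rV n (U : set 'rV[R]_n) : open U -> measurable U.
Proof. by move=> oU; exact: sub_sigma_algebra. Qed.

Lemma measurable_coord_rV n (i : 'I_n) :
  measurable_fun setT (fun v : 'rV[R]_n => v ord0 i : measurableTypeR R).
Proof.
apply: (measurability (@RGenOpens.G R)).
  exact: RGenOpens.measurableE.
move=> _ [_ [a [b ->] <-]]; rewrite setTI; apply: open_measurable_rV.
have cc : continuous (fun v : 'rV[R]_n => v ord0 i) by exact: coord_continuous.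
by move/continuousP : cc; apply; exact: interval_open.
Qed.

Lemma open_rV_bigcup n (U : set 'rV[R]_n) : open U ->
  U = \bigcup_(p : 'rV[rat]_n * nat)
        [set v : 'rV[R]_n | ball (map_mx ratr p.1 : 'rV[R]_n) p.2.+1%:R^-1
             `<=` U /\
           forall i, ball (ratr (p.1 ord0 i) : R) p.2.+1%:R^-1 (v ord0 i)].
Proof.
move=> oU; apply/seteqP; split => [x Ux|x [[q k] _ /= [+ qx]]]; last first.
  apply; split; first by rewrite invr_gt0.
  by move=> i j; rewrite (ord1 i) mxE; exact: qx.
have /nbhs_ballP[e /= e0 xeU] : nbhs x U by apply: open_nbhs_nbhs.
have [k _ /(_ k (leqnn _))/= ke] : \forall k \near \oo, (k.+1%:R^-1 : R) < e / 2.
  by apply: near_infty_natSinv_lt (PosNum (divr_gt0 e0 _)).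
have k0 : 0 < k.+1%:R^-1 :> R by rewrite invr_gt0.
have /choice[q qx] : forall i : 'I_n, exists q : rat,
    ball (ratr q : R) k.+1%:R^-1 (x ord0 i).
  move=> i; have [|q] := @rat_in_itvoo R (x ord0 i - k.+1%:R^-1)
      (x ord0 i + k.+1%:R^-1).
    by rewrite ltrBlDr -addrA ltrDl addr_gt0.
  rewrite in_itv/= => /andP[q1 q2]; exists q.
  by rewrite /ball/= ltr_distl q1 q2.
exists (\row_i q i, k) => //=; split; last by move=> i; rewrite mxE; exact: qx.
move=> y [_ qy]; apply: xeU; split => // i j.
rewrite (ord1 i) (splitr e).
have xq : ball (x ord0 j) (e / 2) (ratr (q j)).
  by apply: ball_sym; apply: (le_ball (ltW ke)); exact: qx.
apply: (ball_triangle xq).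
by apply: (le_ball (ltW ke)); have := qy ord0 j; rewrite !mxE.
Qed.

Lemma measurable_fun_rV d (T : measurableType d) n (f : T -> 'rV[R]_n) :
  (forall i, measurable_fun setT (fun t => f t ord0 i : measurableTypeR R)) ->
  measurable_fun setT f.
Proof.
move=> mf; apply: (measurability (@open 'rV[R]_n)) => //.
move=> _ [U oU <-]; rewrite setTI (open_rV_bigcup oU) preimage_bigcup.
apply: countable_bigcupT_measurable => //= -[q k].
set P := (X in X `<=` U).
have [PU|PU] := pselect (P `<=` U); last first.
  rewrite (_ : _ @^-1` _ = set0); first exact: measurable0.
  by apply/seteqP; split => // t [].
rewrite (_ : _ @^-1` _ = \bigcap_(i in [set: 'I_n])
  [set t | ball (ratr (q ord0 i) : R) k.+1%:R^-1 (f t ord0 i)]).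
  apply: fin_bigcap_measurable => // i _.
  rewrite -[X in measurable X]setTI; apply: (mf i) => //.
  exact: measurable_ball.
by apply/seteqP; split => t /= => [[_ h] i _|h]; [exact: h|split => // i; exact: h].
Qed.

End measurable_row_vectors.

Section lebesgue_measure_rV.
Variable R : realType.

Definition row_cons n (p : measurableTypeR R * 'rV[R]_n) : 'rV[R]_n.+1 :=
  \row_i (if unlift ord0 i is Some j then p.2 ord0 j else p.1).

Definition row_uncons n (v : 'rV[R]_n.+1) : measurableTypeR R * 'rV[R]_n :=
  (v ord0 ord0, \row_j v ord0 (lift ord0 j)).

Lemma row_consK n : cancel (@row_cons n) (@row_uncons n).
Proof.
case=> x v; rewrite /row_uncons /row_cons mxE unlift_none; congr (_, _).
by apply/rowP => j; rewrite !mxE liftK.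
Qed.

Lemma measurable_row_cons n : measurable_fun setT (@row_cons n).
Proof.
apply: measurable_fun_rV => i; have [j|] := unliftP ord0 i => ->.
  apply: (@eq_measurable_fun _ _ _ _ _
    ((fun v : 'rV[R]_n => v ord0 j : measurableTypeR R) \o snd)).
    by move=> p _; rewrite /= mxE liftK.
  exact: measurableT_comp (measurable_coord_rV j) measurable_snd.
apply: (@eq_measurable_fun _ _ _ _ _ fst); last exact: measurable_fst.
by move=> p _; rewrite /= mxE unlift_none.
Qed.

Lemma measurable_row_uncons n : measurable_fun setT (@row_uncons n).
Proof.
apply: measurable_fun_pair; first exact: measurable_coord_rV.
apply: measurable_fun_rV => i.
apply: (@eq_measurable_fun _ _ _ _ _
  (fun v : 'rV[R]_n.+1 => v ord0 (lift ord0 i) : measurableTypeR R)).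
  by move=> v _; rewrite mxE.
exact: measurable_coord_rV.
Qed.

Section step.
Variables (n : nat) (mu : {sigma_finite_measure set 'rV[R]_n -> \bar R}).

Definition lebesgue_rV_step : set 'rV[R]_n.+1 -> \bar R :=
  pushforward (lebesgue_measure \x mu)%E (@row_cons n).

Let step0 : lebesgue_rV_step set0 = 0%E.
Proof. by rewrite /lebesgue_rV_step /pushforward preimage_set0 measure0. Qed.

Let step_ge0 A : (0 <= lebesgue_rV_step A)%E.
Proof. by rewrite /lebesgue_rV_step /pushforward; exact: measure_ge0. Qed.

Let step_sigma_additive : semi_sigma_additive lebesgue_rV_step.
Proof.
have mf := @measurable_row_cons n.
move=> F mF tF mUF; rewrite /lebesgue_rV_step /pushforward preimage_bigcup.
apply: measure_semi_sigma_additive.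
- by move=> k; rewrite -[X in measurable X]setTI; exact: mf.
- apply/trivIsetP => /= i j _ _ ij; rewrite -preimage_setI.
  by move/trivIsetP : tF => /(_ _ _ _ _ ij) ->//; rewrite preimage_set0.
- by rewrite -preimage_bigcup -[X in measurable X]setTI; exact: mf.
Qed.

HB.instance Definition _ := isMeasure.Build _ _ _ lebesgue_rV_step
  step0 step_ge0 step_sigma_additive.

Let step_sigma_finite : sigma_finite setT lebesgue_rV_step.
Proof.
have /sigma_finiteP[F [TF ndF Foo]] := sigma_finiteT (@lebesgue_measure R).
have /sigma_finiteP[G [TG ndG Goo]] := sigma_finiteT mu.
exists (fun k => @row_uncons n @^-1` (F k `*` G k)).
  apply/seteqP; split => // v _.
  have [i _ Fi] : (\bigcup_i F i) (row_uncons v).1 by rewrite -TF.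
  have [j _ Gj] : (\bigcup_j G j) (row_uncons v).2 by rewrite -TG.
  exists (maxn i j) => //; split.
  - by move: Fi; exact/subsetPset/ndF/leq_maxl.
  - by move: Gj; exact/subsetPset/ndG/leq_maxr.
move=> k; have [mF Fk] := Foo k; have [mG Gk] := Goo k; split.
  rewrite -[X in measurable X]setTI; apply: measurable_row_uncons => //.
  exact: measurableX.
rewrite /lebesgue_rV_step /pushforward -comp_preimage.
rewrite (_ : _ \o _ = id); last by apply/funext => p; exact: row_consK.
by rewrite preimage_id product_measure1E// lte_mul_pinfty// ge0_fin_numE.
Qed.

HB.instance Definition _ := @Measure_isSigmaFinite.Build _ _ _ lebesgue_rV_step
  step_sigma_finite.

End step.

(* Lebesgue measure on 'rV[R]_n, on Borel sets: the n-fold product of the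
   one-dimensional one, transported along row_cons : R * R^n -> R^n.+1. Lemma
   lebesgue_rV_box below gives its values on product sets. *)
Fixpoint lebesgue_rV n : {sigma_finite_measure set 'rV[R]_n -> \bar R} :=
  match n with
  | 0 => \d_(0 : 'rV[R]_0)
  | n'.+1 => lebesgue_rV_step (lebesgue_rV n')
  end.

Lemma lebesgue_rV_box n (A : 'I_n -> set (measurableTypeR R)) :
  (forall i, measurable (A i)) ->
  lebesgue_rV n [set v | forall i, A i (v ord0 i)] =
  (\prod_(i < n) lebesgue_measure (A i))%E.
Proof.
elim: n A => [|n IH] A mA.
  by rewrite big_ord0 /= diracE mem_set// => -[].
have mB : measurable [set v : 'rV[R]_n | forall i, A (lift ord0 i) (v ord0 i)].
  rewrite [X in measurable X](_ : _ = \bigcap_(i in [set: 'I_n])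
    ((fun v : 'rV[R]_n => v ord0 i : measurableTypeR R) @^-1` A (lift ord0 i))).
    apply: fin_bigcap_measurable => // i _.
    by rewrite -[X in measurable X]setTI; exact: measurable_coord_rV.
  by apply/seteqP; split => v /= h i; [move=> _|]; exact: h.
rewrite big_ord_recl -IH//= /lebesgue_rV_step /pushforward.
rewrite -product_measure1E//.
congr (_ _); apply/seteqP; split => -[x v] /=.
  move=> h; split=> [|i]; first by have := h ord0; rewrite mxE unlift_none.
  by have := h (lift ord0 i); rewrite mxE liftK.
by move=> [Ax Av] i; rewrite mxE; case: unliftP => [j|] ->; [exact: Av|].
Qed.

End lebesgue_measure_rV.

Section orthant.
Variables (R : realType) (n : nat).

Definition pos_orthant : set 'rV[R]_n := [set x | forall i, 0 < x ord0 i].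

(* Where the partial derivative does not exist, 'D_v takes the default value of
   [lim]. *)
Definition partial (i : 'I_n) (g : 'rV[R]_n -> R) : 'rV[R]_n -> R :=
  'D_(delta_mx ord0 i) g.

(* C^oo on the set D, which is meant to be open: all iterated partial
   derivatives exist and are continuous at every point of D. *)
Definition smooth_on (D : set 'rV[R]_n) (g : 'rV[R]_n -> R) : Prop :=
  forall (s : seq 'I_n) (x : 'rV[R]_n), D x ->
    {for x, continuous (foldr partial g s)} /\
    forall i, derivable (foldr partial g s) x (delta_mx ord0 i).

(* The norm on 'rV[R]_n is the sup norm; being equivalent to the Euclidean one,
   it yields the same locally Lipschitz functions. *)
Definition locally_lipschitz_on (D : set 'rV[R]_n) (g : 'rV[R]_n -> R) : Prop :=
  forall x, D x ->
    exists2 U, nbhs x U & [lipschitz g y | y in U `&` D].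

Definition has_density_on (D : set 'rV[R]_n)
    (mu : {measure set 'rV[R]_n -> \bar R}) (rho : 'rV[R]_n -> R) : Prop :=
  forall A, measurable A -> A `<=` D ->
    mu A = (\int[lebesgue_rV R n]_(x in A) (rho x)%:E)%E.

Definition coord_pow (k : 'I_n -> R) (x : 'rV[R]_n) : 'rV[R]_n :=
  \row_i (x ord0 i `^ k i).

End orthant.
Arguments pos_orthant {R n}.

(* Main.v *)
(* For functions u, v, w of z_i = x_i^{k_i} the Prekopa-Leindler inequality in the
   x variables reads: if
     u(x^k) v(y^k) prod (x_i y_i)^{k_i - 1} <=
       (w(m^k) prod m_i^{k_i - 1})^2   with m = (x + y)/2,
   then (int u)(int v) <= (int w)^2. The Jacobian supplies the strict convexity
   that phi(x^k) may lack, through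
     ln x_i + ln y_i - 2 ln m_i <= - ((x_i - y_i) / (x_i + y_i))^2.
   Take rho = exp(-phi) on a box, u = exp(eps H) rho, v = exp(-eps H) rho and
   w = exp(eps^2 (1 + eta) G / 2) rho with
     G = sum_i k_i^2 / (k_i - 1) z_i^2 |d_i H|^2.
   The hypothesis holds for small eps when H has a quadratic Taylor remainder,
   and the eps^2 terms of the conclusion give the inequality on the box. Steklov
   averages of a Lipschitz f have such a remainder, and their energy is at most
   that of f up to a factor close to 1 on a slightly larger box. Finally let the
   boxes exhaust the orthant. *)
Require Import Defs.
From HB Require Import structures.
From mathcomp Require Import all_boot all_order all_algebra.
From mathcomp Require Import all_classical all_reals all_analysis.
From mathcomp Require Import measurable_realfun.
From mathcomp Require Import ring lra.

Set Implicit Arguments.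
Unset Strict Implicit.
Unset Printing Implicit Defensive.

Import Order.TTheory GRing.Theory Num.Theory.
Import numFieldNormedType.Exports.

Local Open Scope classical_set_scope.
Local Open Scope ring_scope.

(** * Densities and power substitutions on the line *)

(** In the product of the left integrals the terms [+ e S1] and [- e S1] cancel, so comparing the
    [e^2] terms gives a variance form [M S2 - S1^2 <= M A] on a box: [M] is the mass, [S1] and [S2]
    are the first two moments of H and [A] is its energy. The mean of f vanishes only over the whole
    orthant, so [S1] is kept until the boxes grow. The constant comes from one quadratic in
    [d = (x - y) / 2]: the maximum of [2 e k m^(k-1) d g - (k - 1) d^2 / m^2] is
    [e^2 k^2 / (k - 1) m^(2k) g^2]. Its negative term carries no factor [e], so for small [e] a
    fraction of it absorbs every error of size [e d^2]; hence the demand for a quadratic Taylor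
    remainder and nothing finer. On a box the constants of these errors are uniform, since the
    coordinates stay away from 0. The partial derivatives of a Lipschitz function exist only almost
    everywhere. They are treated one coordinate line at a time, and the slopes of the averages are
    compared with them through difference quotients. *)

Section density.
Local Open Scope ereal_scope.
Context d (T : measurableType d) (R : realType).
Import HBNNSimple.

(** True for indicators by hypothesis, hence for simple functions, and in general by monotone
    convergence. It is relative to [D] because [nu] is only known to have density [rho] on subsets
    of [D]. *)
Lemma ge0_integral_density (lam nu : {measure set T -> \bar R}) (D : set T)
    (rho : T -> R) (F : T -> \bar R) :
  measurable D -> measurable_fun D rho -> (forall x, D x -> (0 <= rho x)%R) ->
  (forall A, measurable A -> A `<=` D ->
    nu A = \int[lam]_(x in A) (rho x)%:E) ->
  measurable_fun D F -> (forall x, D x -> 0 <= F x) ->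
  \int[nu]_(x in D) F x = \int[lam]_(x in D) (F x * (rho x)%:E).
Proof.
move=> mD mrho rho0 nuE mF F0.
have mErho : measurable_fun D (EFin \o rho) by exact/measurable_EFinP.
pose h := nnsfun_approx mD mF.
have -> : \int[nu]_(x in D) F x =
    limn (fun n => \int[nu]_(x in D) (h n x)%:E).
  rewrite -monotone_convergence//.
  - by apply: eq_integral => x /set_mem Dx; apply/esym/cvg_lim => //; exact: cvg_nnsfun_approx.
  - by move=> n; exact/measurable_EFinP/measurable_funTS.
  - by move=> *; rewrite lee_fin.
  - by move=> x _ m n mn; rewrite lee_fin; exact/lefP/nd_nnsfun_approx.
have -> : \int[lam]_(x in D) (F x * (rho x)%:E) =
    limn (fun n => \int[lam]_(x in D) ((h n x)%:E * (rho x)%:E)).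
  rewrite -monotone_convergence//.
  - apply: eq_integral => x /set_mem Dx; apply/esym/cvg_lim => //.
    by apply: cvgeZr => //; exact: cvg_nnsfun_approx.
  - move=> n; apply: emeasurable_funM => //.
    exact/measurable_EFinP/measurable_funTS.
  - by move=> n x Dx; rewrite mule_ge0 ?lee_fin ?rho0.
  - move=> x Dx m n mn; rewrite lee_wpmul2r ?lee_fin ?rho0//.
    exact/lefP/nd_nnsfun_approx.
congr (limn _); apply/funext => n.
transitivity (\int[nu]_(x in D)
   (\sum_(y \in range (h n)) (y * \1_(h n @^-1` [set y]) x)%:E)).
  by apply: eq_integral => t tD; rewrite /= fimfunE -fsumEFin.
have mind r : measurable_fun D (fun x => (r * \1_(h n @^-1` [set r]) x)%:E).
  by apply: (measurable_comp measurableT) => //; exact: measurable_funM.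
rewrite ge0_integral_fsum//; last by move=> m y Ey; exact: nnfun_muleindic_ge0.
apply/esym; transitivity (\int[lam]_(x in D) (\sum_(y \in range (h n))
    (y * \1_(h n @^-1` [set y]) x)%:E * (rho x)%:E)).
  apply: eq_integral => x xD.
  rewrite -ge0_mule_fsuml => [|y]; last exact: nnfun_muleindic_ge0.
  by rewrite fsumEFin // -(fimfunE _ x).
rewrite ge0_integral_fsum//; last 2 first.
  - by move=> y; exact: emeasurable_funM.
  - by move=> m y Dy; rewrite mule_ge0 ?lee_fin ?rho0// -lee_fin nnfun_muleindic_ge0.
apply: eq_fsbigr => r rhn.
under [RHS]eq_integral do rewrite EFinM.
rewrite integralZl_indic_nnsfun//.
under eq_integral do rewrite EFinM -muleA.
have r0 : (0 <= r)%R by move: rhn; rewrite inE => -[t _ <-].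
rewrite ge0_integralZl//; first last.
- by move=> t Dt; rewrite mule_ge0 ?lee_fin ?rho0.
- apply: emeasurable_funM; last exact: mErho.
  exact/measurable_EFinP/measurable_funTS.
rewrite integral_indic// nuE; [|exact: measurableI|exact: subIsetr].
congr (_ * _); rewrite setIC [RHS]integral_mkcondr.
apply: eq_integral => x _; rewrite muleC patchE indicE.
by case: ifPn => _; rewrite ?mule1 ?mule0.
Qed.

End density.

Section density_measure.
Local Open Scope ereal_scope.
Context d (T : measurableType d) (R : realType).
Variables (lam : {measure set T -> \bar R}) (rho : T -> R).

Definition density_measure (A : set T) := \int[lam]_(x in A) (rho x)%:E.

Hypothesis mrho : measurable_fun setT rho.
Hypothesis rho0 : forall x, (0 <= rho x)%R.

Let nu0 : density_measure set0 = 0.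
Proof. by rewrite /density_measure integral_set0. Qed.

Let nu_ge0 A : 0 <= density_measure A.
Proof. by apply: integral_ge0 => x _; rewrite lee_fin. Qed.

Let nu_sigma_additive : semi_sigma_additive density_measure.
Proof.
move=> F mF tF mUF; rewrite /density_measure ge0_integral_bigcup//.
- apply: cvg_toP => //; apply: ereal_nondecreasing_is_cvgn => m n mn.
  apply: lee_sum_nneg_natr => // i _ _.
  by apply: integral_ge0 => x _; rewrite lee_fin.
- exact/measurable_EFinP/measurable_funTS.
- by move=> x _; rewrite lee_fin.
Qed.

HB.instance Definition _ := isMeasure.Build _ _ _ density_measure
  nu0 nu_ge0 nu_sigma_additive.

(** Existential packaging: the measure structure depends on the proofs [mrho] and [rho0], while its
    users only compute with the values. *)
Lemma density_measureP : exists nu : {measure set T -> \bar R},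
  forall A, nu A = \int[lam]_(x in A) (rho x)%:E.
Proof. by exists density_measure. Qed.

End density_measure.

Lemma pushforwardP d1 d2 (X : measurableType d1) (Y : measurableType d2)
    (R : realType) (lam : {measure set X -> \bar R}) (f : X -> Y) :
  measurable_fun setT f ->
  exists nu : {measure set Y -> \bar R}, forall A, nu A = lam (f @^-1` A).
Proof.
by move=> mf; pose nu : {measure set Y -> \bar R} := pushforward lam f; exists (nu mf).
Qed.

(** * Changes of variables on the line *)

Section one_dim.
Local Open Scope ereal_scope.
Variable R : realType.
Notation mu := (@lebesgue_measure R).

Lemma measurable_affine (c d : R) :
  measurable_fun [set: measurableTypeR R]
    (fun x : measurableTypeR R => (c * x + d)%R : measurableTypeR R).
Proof. by apply: measurable_funD => //; exact: measurable_funM. Qed.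

(** Uniqueness of Lebesgue measure: [c] times the image measure under the affine map gives each
    half-open interval its length. *)
Lemma lebesgue_measure_affine (c d : R) (A : set (measurableTypeR R)) :
  (0 < c)%R -> measurable A ->
  mu ((fun x : measurableTypeR R => (c * x + d)%R : measurableTypeR R) @^-1` A) =
  (c^-1)%:E * mu A.
Proof.
move=> c0 mA.
have mf := measurable_affine c d.
pose nn : {nonneg R} := NngNum (ltW c0).
pose m1 : {measure set (measurableTypeR R) -> \bar R} :=
  mscale nn (pushforward mu
    (fun x : measurableTypeR R => (c * x + d)%R : measurableTypeR R)).
rewrite (@lebesgue_measure_unique _ (m1 mf) _ _ mA)//=.
  rewrite /mscale/= muleA -EFinM mulVf ?gt_eqF// mul1e//.
move=> _ [[a b]] _ <-; rewrite /m1/= /mscale/= /pushforward.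
rewrite (_ : _ @^-1` _ = `](a - d) / c, (b - d) / c]%classic)%R; last first.
  apply/seteqP; split => x /=; rewrite !in_itv/= ltr_pdivrMr// ler_pdivlMr//.
    by rewrite ltrBlDr lerBrDr mulrC.
  by rewrite ltrBlDr lerBrDr mulrC.
rewrite !lebesgue_measure_itv/= !lte_fin ltr_pM2r ?invr_gt0// ltrD2r.
case: ifP => _; last by rewrite mule0.
by rewrite -!EFinB -EFinM; congr EFin; field; rewrite gt_eqF.
Qed.

Lemma ge0_integral_affine (c d : R) (F : R -> \bar R) : (0 < c)%R ->
  measurable_fun setT F -> (forall x, 0 <= F x) ->
  \int[mu]_x F (c * x + d)%R = (c^-1)%:E * \int[mu]_x F x.
Proof.
move=> c0 mF F0.
have mf := measurable_affine c d.
have ci0 : (0 <= c^-1)%R by rewrite invr_ge0 ltW.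
rewrite -[RHS](@ge0_integral_mscale _ _ _ mu _ measurableT (NngNum ci0))//.
rewrite -[LHS]/(\int[mu]_(x in (fun x => c * x + d)%R @^-1` setT) (F \o (fun x => c * x + d)%R) x).
rewrite -(@ge0_integral_pushforward _ _ _ _ _ _ mf mu setT F)//.
apply: eq_measure_integral => A mA _.
exact: lebesgue_measure_affine.
Qed.

Lemma ltr_powR_mono (k x y : R) : (0 < k)%R -> (0 <= x)%R -> (0 <= y)%R ->
  (x `^ k < y `^ k)%R = (x < y)%R.
Proof.
move=> k0 x0 y0; apply/idP/idP; last by apply: gt0_ltr_powR; rewrite ?nnegrE.
rewrite !ltNge; apply: contra => yx.
by rewrite ge0_ler_powR ?nnegrE// ltW.
Qed.

Lemma powRVK (k x : R) : (0 < k)%R -> (0 <= x)%R -> ((x `^ k^-1) `^ k = x)%R.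
Proof. by move=> k0 x0; rewrite -powRrM mulVf ?gt_eqF// powRr1. Qed.

Lemma ltr_root (k p x : R) : (0 < k)%R -> (0 <= p)%R -> (0 <= x)%R ->
  (p < x `^ k^-1)%R = (p `^ k < x)%R.
Proof.
by move=> k0 p0 x0; rewrite -(ltr_powR_mono k0) ?powR_ge0// powRVK.
Qed.

Lemma ler_root (k q x : R) : (0 < k)%R -> (0 <= q)%R -> (0 <= x)%R ->
  (x `^ k^-1 <= q)%R = (x <= q `^ k)%R.
Proof. by move=> k0 q0 x0; rewrite !leNgt ltr_root. Qed.

Lemma integral_powR_derive (k p q : R) : (0 < p)%R -> (p <= q)%R ->
  \int[mu]_(x in `]p, q]) (k * x `^ (k - 1))%:E = (q `^ k - p `^ k)%:E.
Proof.
move=> p0; rewrite le_eqVlt => /predU1P[<-|pq].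
  by rewrite set_itvoc0 integral_set0 subrr.
have cp r x : (0 < x)%R -> {for x, continuous (fun x : R => x `^ r)%R}.
  move=> x0; apply/differentiable_continuous/derivable1_diffP.
  by have [] := is_derive1_powR r x0.
have cf x : (0 < x)%R -> {for x, continuous (fun x : R => k * x `^ (k - 1))%R}.
  by move=> x0; apply: cvgM; [exact: cvg_cst|exact: (cp (k - 1)%R x x0)].
rewrite integral_itv_obnd_cbnd; last first.
  apply/measurable_EFinP/measurable_funM => //.
  by apply: measurable_funTS; exact: measurable_powR.
rewrite (@continuous_FTC2 _ _ (fun x => x `^ k)%R)//.
- apply: continuous_in_subspaceT => x; rewrite inE/= in_itv/= => /andP[px _].
  by apply: cf; rewrite (lt_le_trans p0).
- split.
  + move=> x; rewrite in_itv/= => /andP[px _].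
    by have [] := is_derive1_powR k (lt_trans p0 px).
  + exact/cvg_at_right_filter/cp.
  + exact/cvg_at_left_filter/cp/(lt_trans p0).
- move=> x; rewrite in_itv/= => /andP[px _].
  by rewrite powR_derive1// in_itv/= andbT (lt_trans p0).
Qed.

(** The image under the [k]-th root of Lebesgue measure on []p^k, q^k]] has density [k x^(k-1)] on
    []p, q]]. The two measures are compared on half-open intervals, where the claim is
    [integral_powR_derive]; the density formula does the rest. *)
Lemma ge0_integral_powR (k p q : R) (F : R -> \bar R) :
  (0 < k)%R -> (0 < p)%R -> (p < q)%R ->
  measurable_fun setT F -> (forall x, 0 <= F x) ->
  \int[mu]_(x in `](p `^ k)%R, (q `^ k)%R]) F x =
  \int[mu]_(x in `]p, q]) (F (x `^ k)%R * (k * x `^ (k - 1))%:E).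
Proof.
move=> k0 p0 pq mF F0.
have q0 := lt_trans p0 pq.
have mr : measurable_fun [set: R] (fun x : R => x `^ k^-1)%R by exact: measurable_powR.
have mk : measurable_fun [set: R] (fun x : R => x `^ k)%R by exact: measurable_powR.
pose I := `](p `^ k)%R, (q `^ k)%R]%classic : set (measurableTypeR R).
have mI : measurable I by exact: measurable_itv.
pose J := `]p, q]%classic : set (measurableTypeR R).
have mJ : measurable J by exact: measurable_itv.
(* The indicator of [J] gives a density on the whole line, so that the resulting measure can be
   tested on all half-open intervals. *)
pose rho (x : measurableTypeR R) : R := (\1_J x * (k * x `^ (k - 1)))%R.
have mrho : measurable_fun setT rho.
  apply: measurable_funM => //; apply: measurable_funM => //.
have rho0 x : (0 <= rho x)%R by rewrite !mulr_ge0 ?powR_ge0// ltW.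
have [nu nuE] := density_measureP mu mrho rho0.
have [m1 m1E0] := @pushforwardP _ _ (measurableTypeR R) (measurableTypeR R) R
  (mrestr mu mI) (fun x => x `^ k^-1)%R mr.
have m1E A : m1 A = mu ((fun x => x `^ k^-1)%R @^-1` A `&` I) by rewrite m1E0.
have IJ x : (0 < x)%R -> J (x `^ k^-1)%R <-> I x.
  by move=> x0; rewrite /I /J /= !in_itv/= ltr_root ?ler_root//; exact: ltW.
have I0 x : I x -> (0 < x)%R.
  by rewrite /I /= in_itv/= => /andP[px _]; rewrite (lt_trans _ px)// powR_gt0.
have nuJ A : measurable A -> nu A = \int[mu]_(x in A `&` J) (k * x `^ (k - 1))%:E.
  move=> mA; rewrite nuE integral_mkcondr; apply: eq_integral => x _.
  by rewrite /rho patchE indicE; case: ifPn => _ /=; rewrite ?mul1r ?mul0r.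
have Ieq (a b : R) : (`]a, b] `&` J = `](Num.max a p), (Num.min b q)]%classic)%R.
  apply/seteqP; split => x /=; rewrite /J/= !in_itv/= gt_max le_min.
    by move=> [/andP[-> ->] /andP[-> ->]].
  by move=> /andP[/andP[-> ->] /andP[-> ->]].
have m1nu A : measurable A -> m1 A = nu A.
  pose g n := `](- n%:R)%R, n%:R]%classic : set (measurableTypeR R).
  apply: (@measure_unique _ R (measurableTypeR R) (@ocitv R) g _ _ _ _ m1 nu) => //=.
  - move=> X Y [[a b] _ <-] [[c d] _ <-]/=.
    exists (Num.max a c, Num.min b d)%R => //=.
    apply/seteqP; split => x /=; rewrite !in_itv/= gt_max le_min.
      by move=> /andP[/andP[-> ->] /andP[-> ->]].
    by move=> [/andP[-> ->] /andP[-> ->]].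
  - by move=> n; exists (- n%:R, n%:R)%R.
  - apply/seteqP; split => // x _; have /archi_boundP := normr_ge0 x; set N := Num.bound _ => xN.
    exists N => //; rewrite /g /= in_itv/=.
    by move: xN; rewrite ltr_norml => /andP[-> /ltW].
  - move=> _ [[a b] _ <-]/=.
    rewrite nuJ; last exact: measurable_itv.
    rewrite Ieq; have [ec|ce] := leP (Num.min b q) (Num.max a p)%R.
      have E0 : `]Num.max a p, Num.min b q]%classic%R = set0.
        by rewrite set_itv_ge// bnd_simp -leNgt.
      rewrite E0 integral_set0 m1E/= -(measure0 mu); congr (mu _).
      apply/seteqP; split => // x [/= ab Ix].
      have : (`]a, b] `&` J) (x `^ k^-1)%R by split => //; apply/(IJ _ (I0 _ Ix)).
      by rewrite Ieq E0.
    have c0 : (0 < Num.max a p)%R by rewrite lt_max p0 orbT.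
    have e0 := lt_trans c0 ce.
    rewrite integral_powR_derive//; last exact: ltW.
    rewrite m1E/=.
    rewrite (_ : _ `&` I = `](Num.max a p `^ k), (Num.min b q `^ k)]%classic)%R; last first.
      have Ieq' x : (0 < x)%R -> (`]a, b] `&` J) (x `^ k^-1)%R =
          `](Num.max a p `^ k), (Num.min b q `^ k)]%classic%R x.
        by move=> x0; rewrite Ieq /= !in_itv/= ltr_root ?ler_root//; exact: ltW.
      apply/seteqP; split => x.
        move=> [ab Ix]; have x0 := I0 _ Ix.
        by rewrite -Ieq'//; split => //; apply/(IJ _ x0).
      move=> xce.
      have x0 : (0 < x)%R.
        by move: xce; rewrite /= in_itv/= => /andP[cx _]; rewrite (lt_trans _ cx)// powR_gt0.
      by move: xce; rewrite -Ieq'// => -[? /(IJ _ x0)].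
    rewrite lebesgue_measure_itv/= lte_fin ltr_powR_mono ?ce -?EFinB//; exact: ltW.
  - move=> n; rewrite m1E/=.
    apply: (@le_lt_trans _ _ (mu I)).
      apply: le_measure; rewrite ?inE//.
      apply: measurableI => //; rewrite -[X in measurable X]setTI.
      exact: (mr measurableT _ (measurable_itv _)).
    by rewrite lebesgue_measure_itv/=; case: ifP => _; rewrite -?EFinB ltry.
have m1J A : measurable A -> A `<=` J ->
    m1 A = \int[mu]_(x in A) (k * x `^ (k - 1))%:E.
  by move=> mA AJ; rewrite m1nu// nuJ// setIidl.
rewrite -(@ge0_integral_density _ _ _ mu m1 J (fun x => k * x `^ (k - 1))%R
  (fun x => F (x `^ k)%R))//; first last.
- by apply: measurable_funTS; exact: measurableT_comp.
- by move=> x _; rewrite mulr_ge0 ?powR_ge0// ltW.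
- by apply: measurable_funTS; apply: measurable_funM.
(* Off [I] this map takes the value 0, which lies outside [J] because [0 < p]; preimages of subsets
   of [J] are therefore inside [I] without restricting the measure. *)
pose root (x : measurableTypeR R) : measurableTypeR R := (\1_I x * x `^ k^-1)%R.
have mroot : measurable_fun setT root by exact: measurable_funM.
have rootJ A : A `<=` J -> root @^-1` A = (fun x => x `^ k^-1)%R @^-1` A `&` I.
  move=> AJ; apply/seteqP; split => x /=; rewrite /root indicE.
    have [/set_mem Ix|_] := boolP (x \in I); first by rewrite mul1r.
    by rewrite mul0r => /AJ; rewrite /J/= in_itv/= ltNge (ltW p0).
  by move=> [? Ix]; rewrite mem_set// mul1r.
transitivity (\int[pushforward mu root]_(x in J) F (x `^ k)%R); last first.
  by apply: eq_measure_integral => A mA AJ; rewrite m1E -rootJ.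
rewrite ge0_integral_pushforward//; last first.
  by apply: measurable_funTS; exact: measurableT_comp.
rewrite rootJ// (_ : _ `&` I = I); last first.
  by apply: setIidr => x Ix /=; apply/IJ => //; exact: I0.
apply: eq_integral => x Ix /=; rewrite /root indicE Ix mul1r powRVK//.
by apply/ltW/I0/set_mem.
Qed.

End one_dim.

(** * The one-dimensional Prekopa-Leindler inequality *)

Section layer_cake.
Local Open Scope ereal_scope.
Variable R : realType.
Notation mu := (@lebesgue_measure R).

Lemma measurable_subgraph (u : R -> R) : measurable_fun setT u ->
  measurable [set z : measurableTypeR R * measurableTypeR R | (z.2 < u z.1)%R].
Proof.
move=> mfu; rewrite -[X in measurable X]setTI.
have : measurable_fun setT (fun z : measurableTypeR R * measurableTypeR R => (z.2 < u z.1)%R).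
  apply: measurable_fun_ltr; first exact: measurable_snd.
  by apply: measurableT_comp => //; exact: measurable_fst.
by move/(_ measurableT [set true] I); congr (measurable _); apply/seteqP; split => z.
Qed.

(** Tonelli for the indicator of [0 <= t < u x]; the bound [u <= 1] confines the levels to [[0,
    1[]. *)
Lemma layer_cake (u : R -> R) : measurable_fun setT u ->
  (forall x, (0 <= u x <= 1)%R) ->
  \int[mu]_x (u x)%:E = \int[mu]_(t in `[0%R, 1%R[) mu [set x | (t < u x)%R].
Proof.
move=> mfu u01.
pose f (z : measurableTypeR R * measurableTypeR R) : R :=
  (\1_`[0%R, 1%R[ z.2 * \1_[set z : measurableTypeR R * measurableTypeR R | (z.2 < u z.1)%R] z)%R.
have mS := measurable_subgraph mfu.
have mf : measurable_fun setT (EFin \o f).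
  apply/measurable_EFinP; apply: measurable_funM; last exact: measurable_indic.
  apply: (@measurableT_comp _ _ _ _ _ _ (\1_`[0%R, 1%R[ : R -> R)) => //.
have f0 z : 0 <= (EFin \o f) z by rewrite lee_fin mulr_ge0.
have := @fubini_tonelli _ _ _ _ R mu mu _ mf f0.
rewrite (_ : (fun x => \int[mu]_y _) = fun x => (u x)%:E); last first.
  apply/funext => x.
  rewrite (_ : (fun y => _) = fun y => (\1_`[0%R, u x[ y)%:E); last first.
    apply/funext => y; rewrite /f /= !indicE; congr EFin.
    rewrite -natrM mulnb; congr (_%:R); congr nat_of_bool.
    apply/andP/idP => [[/set_mem y01 /set_mem/= yu]|/set_mem].
      rewrite mem_set//=; move: y01; rewrite /= !in_itv/= => /andP[-> _] //.
    rewrite /= in_itv/= => /andP[y0 yu]; split; rewrite mem_set//=.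
    rewrite in_itv/= y0/=; have /andP[_] := u01 x; exact: lt_le_trans.
  rewrite integral_indic//= ?setIT lebesgue_measure_itv/= lte_fin.
  have /andP[u0 _] := u01 x; case: ltP => ux; first by rewrite sube0.
  by congr EFin; apply/eqP; rewrite eq_le u0 ux.
move=> ->; rewrite [RHS]integral_mkcond; apply: eq_integral => t _.
rewrite patchE; case: ifPn => t01.
  rewrite (_ : (fun x => _) = fun x => (\1_[set x | (t < u x)%R] x)%:E); last first.
    apply/funext => x; rewrite /f /= !indicE t01 mul1r.
    by have [tu|tu] := pselect (t < u x)%R; [rewrite !mem_set|rewrite !memNset].
  rewrite integral_indic ?setIT//.
  rewrite -[X in measurable X]setTI; exact: measurable_fun_ltr.
rewrite integral0_eq// => x _; rewrite /f /= indicE (negbTE t01) mul0r//.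
Qed.

(** Translate [A] by a point [b] of [B] close to its infimum, and [B] by a point [a] of [A] close to
    its supremum. Both translates lie in [S] and meet inside an interval of length at most [r]. A
    measurable [S] containing all sums stands in for the sum set, which need not be measurable. *)
Lemma brunn_minkowski1 (A B S : set (measurableTypeR R)) (N : R) :
  measurable A -> measurable B -> measurable S ->
  A !=set0 -> B !=set0 ->
  (forall x, A x -> (`|x| <= N)%R) -> (forall x, B x -> (`|x| <= N)%R) ->
  (forall x y, A x -> B y -> S (x + y)%R) ->
  mu A + mu B <= mu S.
Proof.
move=> mA mB mS A0 B0 AN BN ABS; apply/lee_addgt0Pr => r r0.
have r20 : (0 < r / 2)%R by rewrite divr_gt0.
have supA : has_sup A by split => //; exists N => x /AN; exact/le_trans/ler_norm.
have infB : has_inf B.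
  by split => //; exists (- N)%R => x /BN; rewrite ler_norml => /andP[].
have [a Aa sa] := sup_adherent r20 supA.
have [b Bb ib] := inf_adherent r20 infB.
pose A' := (fun x : measurableTypeR R => (1 * x + (- b))%R : measurableTypeR R) @^-1` A.
pose B' := (fun x : measurableTypeR R => (1 * x + (- a))%R : measurableTypeR R) @^-1` B.
have mA' : measurable A' by rewrite -[X in measurable X]setTI; exact: measurable_affine.
have mB' : measurable B' by rewrite -[X in measurable X]setTI; exact: measurable_affine.
have <- : mu A' = mu A by rewrite lebesgue_measure_affine// invr1 mul1e.
have <- : mu B' = mu B by rewrite lebesgue_measure_affine// invr1 mul1e.
have A'S : A' `<=` S.
  by move=> x; rewrite /A'/= mul1r => /ABS/(_ Bb); rewrite subrK.
have B'S : B' `<=` S.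
  by move=> x; rewrite /B'/= mul1r => /(ABS _ _ Aa); rewrite addrC subrK.
(* A common point of the translates lies between [a + inf B] and [sup A + b], whose distance is
   below [r]. *)
pose J := `[(a + inf B)%R, (sup A + b)%R]%classic : set (measurableTypeR R).
have mJ : measurable J by exact: measurable_itv.
have AJ : A' `<=` (A' `\` B') `|` J.
  move=> x A'x; have [B'x|nB'x] := pselect (B' x); last by left.
  right; rewrite /J /= in_itv/=; move: A'x B'x; rewrite /A' /B' /= !mul1r => Ax Bx.
  have := sup_upper_bound supA Ax; have := inf_lbound infB.2 Bx; lra.
have muJ : mu J <= r%:E.
  rewrite /J lebesgue_measure_itv/=; case: ifP => _; last by rewrite lee_fin ltW.
  by rewrite -EFinB lee_fin; move: sa ib; lra.
apply: (@le_trans _ _ (mu ((A' `\` B') `|` J) + mu B')).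
  by apply: leeD => //; apply: le_measure; rewrite ?inE//; apply: measurableU => //; exact: measurableD.
apply: (@le_trans _ _ (mu (A' `\` B') + r%:E + mu B')).
  apply: leeD => //; apply: (@le_trans _ _ (mu (A' `\` B') + mu J)).
    by apply: measureU2 => //; exact: measurableD.
  exact: leeD.
rewrite addeAC; apply: leeD => //.
rewrite -measureU//; [|exact: measurableD|by rewrite setDE -setIA setICl setI0].
apply: le_measure; rewrite ?inE//; first by apply: measurableU => //; exact: measurableD.
by move=> x [[/A'S]|/B'S].
Qed.

(** [A] is the supremum of [u]. After division by it every superlevel set at a level below 1 is
    nonempty, as Brunn-Minkowski demands. *)
Lemma sup_normalize (u : R -> R) (C : R) : (forall x, (0 <= u x <= C)%R) ->
  (exists x, u x != 0%R) ->
  exists2 A, (0 < A)%R & (forall x, (u x <= A)%R) /\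
    (forall t, (t < 1)%R -> exists x, (A * t < u x)%R).
Proof.
move=> u0 [x ux].
have supu : has_sup (range u).
  by split; [exists (u x), x|exists C => _ [y _ <-]; have /andP[] := u0 y].
have ub y : (u y <= sup (range u))%R by apply: sup_upper_bound => //; exists y.
have A0 : (0 < sup (range u))%R.
  by apply: (lt_le_trans _ (ub x)); rewrite lt_def ux; have /andP[] := u0 x.
exists (sup (range u)) => //; split => // t t1.
have e0 : (0 < sup (range u) * (1 - t))%R by rewrite mulr_gt0// subr_gt0.
have [_ [y _ <-]] := sup_adherent e0 supu.
by rewrite mulrBr mulr1 opprB addrC subrK; exists y.
Qed.

(** For [t] in [[0, 1[] every sum of a point of [{u > t}] and a point of [{v > t}] lies in
    [{w > t}]. Brunn-Minkowski at each level and integration over [t] give a bound on the sum of the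
    integrals. With [w] taken at [x + y], sets are added without halving. *)
Lemma prekopa_leindler1_normalized (u v w : R -> R) (N : R) :
  measurable_fun setT u -> measurable_fun setT v -> measurable_fun setT w ->
  (forall x, (0 <= u x <= 1)%R) -> (forall x, (0 <= v x <= 1)%R) ->
  (forall x, (0 <= w x)%R) ->
  (forall t, (t < 1)%R -> exists x, (t < u x)%R) ->
  (forall t, (t < 1)%R -> exists x, (t < v x)%R) ->
  (forall x, u x != 0%R -> (`|x| <= N)%R) ->
  (forall x, v x != 0%R -> (`|x| <= N)%R) ->
  (forall x y, (u x * v y <= w (x + y) ^+ 2)%R) ->
  \int[mu]_x (u x)%:E + \int[mu]_x (v x)%:E <= \int[mu]_x (w x)%:E.
Proof.
move=> mfu mfv mfw u0 v0 w0 us vs uN vN uvw.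
(* Only levels below 1 are compared, and the truncation makes the layer cake formula applicable. *)
pose w1 (x : R) := Num.min (w x) 1%R.
have mw1 : measurable_fun setT w1 by exact: measurable_funM || exact: measurable_minr.
have mlt (g : R -> R) t : measurable_fun setT g -> measurable ([set x | (t < g x)%R] : set (measurableTypeR R)).
  move=> mg; rewrite -[X in measurable X]setTI.
  exact: measurable_fun_ltr.
apply: (@le_trans _ _ (\int[mu]_x (w1 x)%:E)); last first.
  apply: ge0_le_integral => //.
  - by move=> x _; rewrite lee_fin le_min w0/=.
  - exact/measurable_EFinP.
  - exact/measurable_EFinP.
  - by move=> x _; rewrite lee_fin ge_min lexx.
rewrite !layer_cake//; last first.
  by move=> x; rewrite le_min w0 ler01/= ge_min lexx orbT.
have mm (g : R -> R) : measurable_fun setT g ->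
    measurable_fun (`[0%R, 1%R[%classic : set R) (fun t => mu [set x | (t < g x)%R]).
  move=> mg; apply: measurable_funTS.
  pose S := [set z : measurableTypeR R * measurableTypeR R | (z.2 < g z.1)%R].
  have mS : measurable S by exact: measurable_subgraph.
  rewrite (_ : (fun t => _) = fun t => mu (ysection S t)); last first.
    by apply/funext => t; congr (mu _); apply/seteqP; split => x /=; rewrite /ysection/= ?inE.
  exact: measurable_fun_ysection.
rewrite -ge0_integralD//; [|exact: mm|exact: mm].
apply: ge0_le_integral => //; [|by apply: emeasurable_funD; exact: mm|exact: mm|].
  by move=> t _; rewrite adde_ge0.
move=> t; rewrite /= in_itv/= => /andP[t0 t1].
apply: (@brunn_minkowski1 _ _ _ N); [exact: mlt|exact: mlt|exact: mlt|exact: us|exact: vs| | |].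
- by move=> x /= tu; apply: uN; rewrite gt_eqF// (le_lt_trans t0).
- by move=> x /= tu; apply: vN; rewrite gt_eqF// (le_lt_trans t0).
- move=> x y /= tu tv; rewrite lt_min t1 andbT.
  rewrite -(@ltr_pXn2r _ 2)// ?nnegrE//.
  by apply: (lt_le_trans _ (uvw x y)); rewrite expr2 ltr_pM.
Qed.

(** Dividing [u] and [v] by their suprema [A] and [B], and [w] by [c = sqrt (A B)], leads to the
    linear inequality. The arithmetic-geometric mean inequality turns the sum into a product and
    produces the factor 4. *)
Lemma prekopa_leindler1 (u v w : R -> R) (C N : R) :
  measurable_fun setT u -> measurable_fun setT v -> measurable_fun setT w ->
  (forall x, (0 <= u x <= C)%R) -> (forall x, (0 <= v x <= C)%R) ->
  (forall x, (0 <= w x)%R) ->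
  (forall x, u x != 0%R -> (`|x| <= N)%R) ->
  (forall x, v x != 0%R -> (`|x| <= N)%R) ->
  (forall x y, (u x * v y <= w (x + y) ^+ 2)%R) ->
  4%:E * (\int[mu]_x (u x)%:E * \int[mu]_x (v x)%:E) <=
  \int[mu]_x (w x)%:E * \int[mu]_x (w x)%:E.
Proof.
move=> mfu mfv mfw u0 v0 w0 uN vN uvw.
have Iw0 : 0 <= \int[mu]_x (w x)%:E by apply: integral_ge0 => x _; rewrite lee_fin.
have [uz|/existsNP[xu /eqP nuz]] := pselect (forall x, u x = 0%R).
  rewrite (_ : \int[mu]_x (u x)%:E = 0) ?mul0e ?mule0 ?mule_ge0//.
  by rewrite integral0_eq// => x _; rewrite uz.
have [vz|/existsNP[xv /eqP nvz]] := pselect (forall x, v x = 0%R).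
  rewrite (_ : \int[mu]_x (v x)%:E = 0) ?mul0e ?mule0 ?mule_ge0//.
  by rewrite integral0_eq// => x _; rewrite vz.
have [A A0 [uA us]] := sup_normalize u0 (ex_intro _ xu nuz).
have [B B0 [vB vs]] := sup_normalize v0 (ex_intro _ xv nvz).
pose c := Num.sqrt (A * B).
have c0 : (0 < c)%R by rewrite sqrtr_gt0 mulr_gt0.
have c2 : (c ^+ 2 = A * B)%R by rewrite sqr_sqrtr// mulr_ge0// ltW.
have mscale_int (g : R -> R) (r : R) : measurable_fun setT g ->
    (forall x, (0 <= g x)%R) -> (0 < r)%R ->
    \int[mu]_x (g x / r)%:E = (r^-1)%:E * \int[mu]_x (g x)%:E.
  move=> mg g0 r0; rewrite -ge0_integralZl_EFin//.
  - by apply: eq_integral => x _; rewrite -EFinM mulrC.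
  - by move=> x _; rewrite lee_fin.
  - exact/measurable_EFinP.
  - by rewrite invr_ge0 ltW.
have u00 x : (0 <= u x)%R by have /andP[] := u0 x.
have v00 x : (0 <= v x)%R by have /andP[] := v0 x.
have := @prekopa_leindler1_normalized (fun x => u x / A)%R (fun x => v x / B)%R
  (fun x => w x / c)%R N.
rewrite !mscale_int// => PL.
have {PL} : (A^-1)%:E * \int[mu]_x (u x)%:E + (B^-1)%:E * \int[mu]_x (v x)%:E <=
    (c^-1)%:E * \int[mu]_x (w x)%:E.
  apply: PL.
  - exact: measurable_funM.
  - exact: measurable_funM.
  - exact: measurable_funM.
  - by move=> x; rewrite ler_pdivrMr// mul1r uA divr_ge0// ltW.
  - by move=> x; rewrite ler_pdivrMr// mul1r vB divr_ge0// ltW.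
  - by move=> x; rewrite divr_ge0// ltW.
  - by move=> t /us[x xt]; exists x; rewrite ltr_pdivlMr// mulrC.
  - by move=> t /vs[x xt]; exists x; rewrite ltr_pdivlMr// mulrC.
  - by move=> x h; apply: uN; apply: contra h => /eqP ->; rewrite mul0r.
  - by move=> x h; apply: vN; apply: contra h => /eqP ->; rewrite mul0r.
  - move=> x y; rewrite expr_div_n c2 ler_pdivlMr ?mulr_gt0//.
    rewrite (_ : _ * (A * B) = u x * v y)%R; first exact: uvw.
    by field; rewrite !gt_eqF.
have Iu0 : 0 <= \int[mu]_x (u x)%:E by apply: integral_ge0 => x _; rewrite lee_fin.
have Iv0 : 0 <= \int[mu]_x (v x)%:E by apply: integral_ge0 => x _; rewrite lee_fin.
move: Iu0 Iv0 Iw0.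
move: (\int[mu]_x (w x)%:E) => [r| |]//; last first.
  by move=> *; rewrite mulyy leey.
(* With [w] of finite integral, an infinite integral of [u] or [v] contradicts the linear
   inequality. *)
move: (\int[mu]_x (u x)%:E) => [p| |]//; last first.
  move=> _ v0' _; rewrite gt0_muley ?lte_fin ?invr_gt0// addye; last first.
    by rewrite gt_eqF// (@lt_le_trans _ _ 0)// mule_ge0// lee_fin invr_ge0 ltW.
  by rewrite -EFinM leye_eq.
move: (\int[mu]_x (v x)%:E) => [q| |]//; last first.
  by move=> p0 _ _; rewrite gt0_muley ?lte_fin ?invr_gt0// -EFinM addey// -EFinM leye_eq.
rewrite !(lee_fin 0) => p0 q0 r0.
  rewrite -!EFinM -EFinD !lee_fin => PL.
  have {}PL : (c * (p / A + q / B) <= r)%R.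
    by rewrite -ler_pdivlMl// (le_trans _ PL)// [(A^-1 * _)%R]mulrC [(B^-1 * _)%R]mulrC.
  have h0 : (0 <= c * (p / A + q / B))%R.
    by rewrite mulr_ge0 ?addr_ge0 ?divr_ge0// ltW.
  apply: (@le_trans _ _ ((c * (p / A + q / B)) ^+ 2)%R); last first.
    by rewrite -expr2 ler_pXn2r ?nnegrE.
  rewrite exprMn c2.
  rewrite -subr_ge0 (_ : _ - _ = A * B * (p / A - q / B) ^+ 2)%R; last first.
    by field; rewrite !gt_eqF.
  by rewrite mulr_ge0 ?sqr_ge0// mulr_ge0// ltW.
Qed.

End layer_cake.

(** * The Prekopa-Leindler inequality in power coordinates *)

Section rV_integral.
Local Open Scope ereal_scope.
Variable R : realType.
Notation mu := (@lebesgue_measure R).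
Notation lam := (@lebesgue_rV R).

Lemma measurable_row_consr n (x : R) :
  measurable_fun setT (fun v : 'rV[R]_n => row_cons (x : measurableTypeR R, v)).
Proof.
by apply: measurableT_comp; [exact: measurable_row_cons|exact: pair1_measurable].
Qed.

Lemma ge0_integral_rVS n (F : 'rV[R]_n.+1 -> \bar R) :
  measurable_fun setT F -> (forall v, 0 <= F v) ->
  \int[lam n.+1]_v F v = \int[mu]_x \int[lam n]_v F (row_cons (x, v)).
Proof.
move=> mF F0.
transitivity (\int[pushforward (mu \x lam n) (@row_cons R n)]_v F v).
  by apply: eq_measure_integral; [exact: measurable_row_cons|].
rewrite ge0_integral_pushforward//; last exact: measurable_row_cons.
rewrite preimage_setT fubini_tonelli1//; last by move=> z; exact: F0.
by apply: measurableT_comp => //; exact: measurable_row_cons.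
Qed.

Lemma ge0_integral_rVS_swap n (F : 'rV[R]_n.+1 -> \bar R) :
  measurable_fun setT F -> (forall v, 0 <= F v) ->
  \int[lam n.+1]_v F v = \int[lam n]_v \int[mu]_x F (row_cons (x, v)).
Proof.
move=> mF F0; rewrite ge0_integral_rVS//.
rewrite (@fubini_tonelli _ _ _ _ R mu (lam n) (F \o @row_cons R n))//.
  by apply: measurableT_comp => //; exact: measurable_row_cons.
by move=> z; exact: F0.
Qed.

Lemma measurable_integral_rVS n (F : 'rV[R]_n.+1 -> \bar R) :
  measurable_fun setT F -> (forall v, 0 <= F v) ->
  measurable_fun setT (fun x : measurableTypeR R => \int[lam n]_v F (row_cons (x, v))).
Proof.
move=> mF F0.
apply: (@measurable_fun_fubini_tonelli_F _ _ _ _ R (lam n) (F \o @row_cons R n)).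
  by apply: measurableT_comp => //; exact: measurable_row_cons.
by move=> z; exact: F0.
Qed.

Lemma measurable_integral_rVS_swap n (F : 'rV[R]_n.+1 -> \bar R) :
  measurable_fun setT F -> (forall v, 0 <= F v) ->
  measurable_fun setT (fun v : 'rV[R]_n => \int[mu]_x F (row_cons (x, v))).
Proof.
move=> mF F0.
apply: (@measurable_fun_fubini_tonelli_G _ _ _ _ R mu (F \o @row_cons R n)).
  by apply: measurableT_comp => //; exact: measurable_row_cons.
by move=> z; exact: F0.
Qed.

Lemma integral_rV0 (F : 'rV[R]_0 -> \bar R) : measurable_fun setT F ->
  \int[lam 0]_v F v = F 0%R.
Proof. by move=> mF; rewrite integral_dirac// diracE mem_set// mul1e. Qed.

End rV_integral.

(** * Cubes and their sections *)

Section rV_box.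
Variable R : realType.

(** The same bounds serve all coordinates: the cubes with bounds [1 / m] and [m] already exhaust the
    orthant. *)
Definition rV_box n (a b : R) : set 'rV[R]_n :=
  [set v | forall i, a <= v ord0 i <= b].
Arguments rV_box n a b : clear implicits.

Lemma rV_boxE n a b : rV_box n a b =
  \bigcap_(i in [set: 'I_n]) ((fun v : 'rV[R]_n => v ord0 i) @^-1` `[a, b]).
Proof.
apply/seteqP; split => [v h i _ /=|v h i]; first by rewrite in_itv/= h.
by have := h i Logic.I; rewrite /= in_itv/=.
Qed.

Lemma measurable_rV_box n a b : measurable (rV_box n a b).
Proof.
rewrite rV_boxE; apply: fin_bigcap_measurable => // i _.
rewrite -[X in measurable X]setTI.
by apply: (measurable_coord_rV i) => //; exact: measurable_itv.
Qed.

Lemma rV_box_measure n a b : (lebesgue_rV R n (rV_box n a b) < +oo)%E.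
Proof.
rewrite (_ : rV_box n a b = [set v | forall i, (fun=> `[a, b]%classic : set (measurableTypeR R)) i (v ord0 i)]).
  rewrite (@lebesgue_rV_box R n (fun=> `[a, b]%classic)); last by move=> i; exact: measurable_itv.
  rewrite -ge0_fin_numE; last first.
    by apply: prode_ge0 => i _; exact: measure_ge0.
  apply: (big_ind (fun x => x \is a fin_num)) => //; first exact: fin_numM.
  by move=> i _; rewrite lebesgue_measure_itv/=; case: ifP.
by apply/seteqP; split => v h i; have := h i; rewrite /= in_itv.
Qed.

Lemma row_cons_ord0 n x (v : 'rV[R]_n) : row_cons (x, v) ord0 ord0 = x.
Proof. by rewrite mxE unlift_none. Qed.

Lemma row_cons_lift n x (v : 'rV[R]_n) j : row_cons (x, v) ord0 (lift ord0 j) = v ord0 j.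
Proof. by rewrite mxE liftK. Qed.

Lemma row_cons_all n (P : 'I_n.+1 -> R -> Prop) x (v : 'rV[R]_n) :
  (forall i, P i (row_cons (x, v) ord0 i)) <->
  P ord0 x /\ forall j, P (lift ord0 j) (v ord0 j).
Proof.
split=> [h|[h0 h] i].
  split; first by have := h ord0; rewrite row_cons_ord0.
  by move=> j; have := h (lift ord0 j); rewrite row_cons_lift.
by case: (unliftP ord0 i) => [j|] ->; rewrite ?row_cons_lift ?row_cons_ord0.
Qed.

Lemma rV_box_row_cons n a b x (v : 'rV[R]_n) :
  rV_box n.+1 a b (row_cons (x, v)) <-> a <= x <= b /\ rV_box n a b v.
Proof. exact: (row_cons_all (fun _ y => a <= y <= b : Prop)). Qed.

Lemma coord_pow_row_cons n (k : 'I_n.+1 -> R) (x : R) (v : 'rV[R]_n) :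
  coord_pow k (row_cons (x, v)) =
  row_cons ((x `^ k ord0)%R : measurableTypeR R, coord_pow (fun j => k (lift ord0 j)) v).
Proof.
apply/rowP => i; rewrite mxE; case: (unliftP ord0 i) => [j|] ->.
  by rewrite !row_cons_lift mxE.
by rewrite !row_cons_ord0.
Qed.

End rV_box.
Arguments rV_box {R} n a b.

Section prekopa_leindler.
Variable R : realType.
Notation mu := (@lebesgue_measure R).
Notation lam := (@lebesgue_rV R).
Variables (a b : R).
Hypotheses (a0 : 0 < a) (ab : a < b).

(** A class with finite integrals whose sections and marginals are of the same kind, so that the
    induction on the dimension can work with real numbers. *)
Definition box_fun n (u : 'rV[R]_n -> R) :=
  [/\ measurable_fun setT u, forall v, 0 <= u v,
      exists C, forall v, u v <= C & forall v, ~ rV_box n a b v -> u v = 0].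

Arguments box_fun n u : clear implicits.

Definition itv_fun (u : R -> R) :=
  [/\ measurable_fun setT u, forall x, 0 <= u x,
      exists C, forall x, u x <= C & forall x, ~~ (a <= x <= b) -> u x = 0].

Lemma itv_fun_finite u : itv_fun u ->
  (\int[mu]_x (u x)%:E)%E = (fine (\int[mu]_x (u x)%:E)%E)%:E.
Proof.
move=> [mfu u0 [C uC] uab]; rewrite fineK// ge0_fin_numE; last first.
  by apply: integral_ge0 => x _; rewrite lee_fin.
apply: (@le_lt_trans _ _ (\int[mu]_x (C%:E * (\1_`[a, b] x)%:E))%E).
  apply: ge0_le_integral => //.
  - by move=> x _; rewrite lee_fin.
  - exact/measurable_EFinP.
  - by apply: measurable_funeM; exact/measurable_EFinP.
  - move=> x _; rewrite -EFinM lee_fin indicE.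
    have [xab|xab] := boolP (a <= x <= b); first by rewrite mem_set ?mulr1//= in_itv.
    by rewrite uab// memNset ?mulr0//= in_itv/=; exact/negP.
have C0 : 0 <= C by exact: le_trans (u0 0) (uC 0).
rewrite ge0_integralZl//; [|exact/measurable_EFinP].
rewrite integral_indic//= setIT lebesgue_measure_itv/= lte_fin ab -EFinB -EFinM ltry//.
Qed.

Lemma box_fun_finite n u : box_fun n u ->
  (\int[lam n]_x (u x)%:E)%E = (fine (\int[lam n]_x (u x)%:E)%E)%:E.
Proof.
move=> [mfu u0 [C uC] uab]; rewrite fineK// ge0_fin_numE; last first.
  by apply: integral_ge0 => x _; rewrite lee_fin.
apply: (@le_lt_trans _ _ (\int[lam n]_x (C%:E * (\1_(rV_box n a b) x)%:E))%E).
  apply: ge0_le_integral => //.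
  - by move=> x _; rewrite lee_fin.
  - exact/measurable_EFinP.
  - apply: measurable_funeM; apply/measurable_EFinP.
    by apply: measurable_indic; exact: measurable_rV_box.
  - move=> x _; rewrite -EFinM lee_fin indicE.
    have [xab|xab] := pselect (rV_box n a b x); first by rewrite mem_set ?mulr1.
    by rewrite uab// memNset ?mulr0.
have C0 : 0 <= C by exact: le_trans (u0 0) (uC 0).
rewrite ge0_integralZl//; last first.
  by apply/measurable_EFinP; apply: measurable_indic; exact: measurable_rV_box.
rewrite integral_indic//= ?setIT; last exact: measurable_rV_box.
by rewrite lte_mul_pinfty// rV_box_measure.
Qed.

(** The substitution [z = x^k] turns the integrals into those of [u (x^k) k x^(k-1)] and its
    analogues, to which the one-dimensional inequality applies. *)
Lemma prekopa_leindler_powR (k : R) (u v w : R -> R) : 1 < k ->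
  itv_fun u -> itv_fun v -> itv_fun w ->
  (forall x y, 0 < x -> 0 < y ->
    u (x `^ k) * v (y `^ k) * (x * y) `^ (k - 1) <=
    (w (((x + y) / 2) `^ k) * ((x + y) / 2) `^ (k - 1)) ^+ 2) ->
  (\int[mu]_x (u x)%:E * \int[mu]_x (v x)%:E <=
   \int[mu]_x (w x)%:E * \int[mu]_x (w x)%:E)%E.
Proof.
move=> k1 hu hv hw uvw.
have k0 : 0 < k by exact: lt_trans k1.
(* Starting at [a / 2] makes the half-open interval contain the closed [[a, b]], off which the
   functions vanish. *)
pose p := (a / 2) `^ k^-1; pose q := b `^ k^-1.
have a20 : 0 < a / 2 by rewrite divr_gt0.
have b0 : 0 < b by exact: lt_trans ab.
have p0 : 0 < p by rewrite powR_gt0.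
have pq : p < q.
  by rewrite /p /q ltr_powR_mono ?invr_gt0 ?ltW// ltr_pdivrMr// (lt_trans ab)// ltr_pMr// ltr1n.
have q0 := lt_trans p0 pq.
have pk : p `^ k = a / 2 by rewrite /p powRVK// ltW.
have qk : q `^ k = b by rewrite /q powRVK// ltW.
pose tr (g : R -> R) (x : R) := \1_`]p, q] x * (g (x `^ k) * (k * x `^ (k - 1))).
have trint g : itv_fun g -> (\int[mu]_x (g x)%:E = \int[mu]_x (tr g x)%:E)%E.
  move=> [mg g0 _ gab].
  transitivity (\int[mu]_(x in `](p `^ k)%R, (q `^ k)%R]) (g x)%:E)%E.
    rewrite [RHS]integral_mkcond; apply: eq_integral => x _; rewrite patchE.
    case: ifPn => //; rewrite pk qk notin_setE/= in_itv/= => /negP xab.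
    rewrite gab//; apply: contra xab => /andP[ax ->]; rewrite andbT.
    by apply: (lt_le_trans _ ax); rewrite ltr_pdivrMr// ltr_pMr// ltr1n.
  rewrite (@ge0_integral_powR _ k p q (EFin \o g))//; [|exact/measurable_EFinP].
  rewrite integral_mkcond; apply: eq_integral => x _; rewrite patchE /tr indicE.
  by case: ifPn => _ /=; rewrite ?mul1r ?mul0r.
have trm g : itv_fun g -> measurable_fun setT (tr g).
  move=> [mg g0 _ gab]; apply: measurable_funM => //.
  apply: measurable_funM; first by apply: measurableT_comp => //; exact: measurable_powR.
  by apply: measurable_funM => //; exact: measurable_powR.
have tr0 g x : itv_fun g -> 0 <= tr g x.
  by move=> [_ g0 _ _]; rewrite !mulr_ge0 ?powR_ge0// ltW.
have trC g : itv_fun g -> exists C, forall x, 0 <= tr g x <= C.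
  move=> hg; have [mg g0 [C gC] gab] := hg.
  have C0 : 0 <= C by exact: le_trans (g0 0) (gC 0).
  exists (C * (k * q `^ (k - 1))) => x; rewrite tr0//= /tr indicE.
  have [xI|xI] := boolP (x \in _); last first.
    by rewrite mul0r !mulr_ge0 ?powR_ge0// ltW.
  move: xI => /set_mem; rewrite /= in_itv/= => /andP[px xq].
  rewrite mul1r ler_pM ?mulr_ge0 ?powR_ge0 ?g0 ?gC ?(ltW k0)// ler_pM2l//.
  apply: ge0_ler_powR => //; rewrite ?nnegrE ?subr_ge0; [exact: ltW| |exact: ltW].
  exact/ltW/(lt_trans p0).
have trN g x : tr g x != 0 -> `|x| <= q.
  rewrite /tr indicE; have [xI _|_] := boolP (x \in _); last by rewrite mul0r eqxx.
  move: xI => /set_mem; rewrite /= in_itv/= => /andP[px xq].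
  by rewrite ger0_norm// ltW// (lt_trans p0).
have [Cu uC] := trC _ hu; have [Cv vC] := trC _ hv.
(* Halving the argument turns [x + y] into the midpoint and doubles the integral; the doubling,
   squared, cancels the factor 4. *)
pose w2 (s : R) := tr w (2^-1 * s + 0).
have mw2 : measurable_fun setT w2.
  by apply: (measurableT_comp (trm _ hw)); exact: measurable_affine.
have Iw2 : (\int[mu]_x (w2 x)%:E = 2%:E * \int[mu]_x (w x)%:E)%E.
  have mtr : measurable_fun setT (EFin \o tr w) by apply/measurable_EFinP; exact: trm hw.
  have tr0' x : (0 <= (EFin \o tr w) x)%E by rewrite lee_fin tr0.
  by rewrite trint// (@ge0_integral_affine _ 2^-1 0 (EFin \o tr w))// invrK.
have := @prekopa_leindler1 R (tr u) (tr v) w2 (Num.max Cu Cv) q (trm _ hu) (trm _ hv) mw2.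
rewrite Iw2 -!trint// (itv_fun_finite hu) (itv_fun_finite hv) (itv_fun_finite hw).
rewrite -!EFinM !lee_fin => PL.
have halve (A B C : R) : 4 * (A * B) <= 2 * C * (2 * C) -> A * B <= C * C.
  by clear; lra.
apply: halve; apply: PL.
- by move=> x; rewrite tr0//= le_max; have /andP[_ ->] := uC x.
- by move=> x; rewrite tr0//= le_max; have /andP[_ ->] := vC x; rewrite orbT.
- by move=> x; exact: tr0.
- exact: trN.
- exact: trN.
- move=> x y; rewrite /w2 addr0 [2^-1 * _]mulrC /tr !indicE.
  have [xI|xI] := boolP (x \in _); last by rewrite !mul0r sqr_ge0.
  have [yI|yI] := boolP (y \in _); last by rewrite !(mul0r, mulr0) sqr_ge0.
  move: xI yI => /set_mem + /set_mem; rewrite /= !in_itv/= => /andP[px xq] /andP[py yq].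
  have x0 := lt_trans p0 px; have y0 := lt_trans p0 py.
  rewrite mem_set/=; last first.
    by rewrite /= in_itv/= ltr_pdivlMr// ler_pdivrMr// !mulr_natr !mulr2n ltrD// lerD.
  rewrite !mul1r.
  rewrite (_ : u (x `^ k) * _ * _ = k ^+ 2 * (u (x `^ k) * v (y `^ k) * (x * y) `^ (k - 1))); last first.
    by rewrite powRM ?ltW//; ring.
  rewrite (_ : w _ * _ = k * (w (((x + y) / 2) `^ k) * ((x + y) / 2) `^ (k - 1))); last by ring.
  by rewrite exprMn ler_pM2l ?exprn_gt0// uvw.
Qed.

(** Induction on the dimension: for fixed first coordinates the induction hypothesis, applied to
    sections weighted by the first Jacobian factor, yields the one-dimensional hypothesis for the
    marginals. *)
Lemma prekopa_leindler_rV n (k : 'I_n -> R) (u v w : 'rV[R]_n -> R) :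
  (forall i, 1 < k i) -> box_fun n u -> box_fun n v -> box_fun n w ->
  (forall x y, pos_orthant x -> pos_orthant y ->
    u (coord_pow k x) * v (coord_pow k y) *
      \prod_i (x ord0 i * y ord0 i) `^ (k i - 1) <=
    (w (coord_pow k (2^-1 *: (x + y))) *
      \prod_i ((x ord0 i + y ord0 i) / 2) `^ (k i - 1)) ^+ 2) ->
  (\int[lam n]_x (u x)%:E * \int[lam n]_x (v x)%:E <=
   \int[lam n]_x (w x)%:E * \int[lam n]_x (w x)%:E)%E.
Proof.
elim: n k u v w => [|n IH] k u v w k1 hu hv hw uvw.
  have mE g : box_fun 0 g -> measurable_fun setT (fun x : 'rV[R]_0 => (g x)%:E).
    by case=> mg _ _ _; exact/measurable_EFinP.
  rewrite !integral_rV0; [|exact: mE..].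
  have E (x : 'rV[R]_0) : x = 0 by apply/rowP => -[].
  have := uvw 0 0; rewrite !big_ord0 !mulr1 -!EFinM lee_fin -expr2.
  by rewrite (E (coord_pow k 0)) (E (coord_pow k _)); apply => -[].
pose sec (g : 'rV[R]_n.+1 -> R) (x : R) (y : 'rV[R]_n) := g (row_cons (x, y)).
have hsec g x (c : R) : 0 <= c -> box_fun n.+1 g -> box_fun n (fun y => c * sec g x y).
  move=> c0 [mg g0 [C gC] gab]; split.
  - by apply: measurable_funM => //; apply: measurableT_comp => //; exact: measurable_row_consr.
  - by move=> y; rewrite mulr_ge0 ?g0.
  - by exists (c * C) => y; rewrite ler_wpM2l ?gC.
  - by move=> y ny; rewrite /sec gab ?mulr0// => /rV_box_row_cons[].
have hsec1 g x : box_fun n.+1 g -> box_fun n (sec g x).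
  move=> hg; have := hsec g x 1 ler01 hg.
  by congr box_fun; apply/funext => y; rewrite mul1r.
pose mar (g : 'rV[R]_n.+1 -> R) (x : R) := fine (\int[lam n]_y (sec g x y)%:E)%E.
have marE g x : box_fun n.+1 g -> (\int[lam n]_y (g (row_cons (x, y)))%:E)%E = (mar g x)%:E.
  by move=> hg; exact: box_fun_finite (hsec1 g x hg).
have hmar g : box_fun n.+1 g -> itv_fun (mar g).
  move=> hg; have [mg g0 [C gC] gab] := hg.
  have C0 : 0 <= C by exact: le_trans (g0 0) (gC 0).
  split.
  - apply/measurable_EFinP; rewrite (_ : _ \o _ = fun x => \int[lam n]_y (g (row_cons (x, y)))%:E)%E.
      apply: (@measurable_integral_rVS R n (EFin \o g)); first exact/measurable_EFinP.
      by move=> y; rewrite lee_fin.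
    by apply/funext => x; rewrite marE.
  - by move=> x; rewrite fine_ge0// integral_ge0// => y _; rewrite lee_fin g0.
  - exists (C * fine (lam n (rV_box n a b))) => x; rewrite -lee_fin -marE//.
    rewrite EFinM fineK; last by rewrite ge0_fin_numE// rV_box_measure.
    have -> : lam n (rV_box n a b) = (\int[lam n]_x (\1_(rV_box n a b) x)%:E)%E.
      by rewrite integral_indic ?setIT//; exact: measurable_rV_box.
    rewrite -ge0_integralZl//; last by apply/measurable_EFinP; apply: measurable_indic; exact: measurable_rV_box.
    have [ms s0 _ sab] := hsec1 g x hg.
    apply: ge0_le_integral => //.
    + by move=> y _; rewrite lee_fin.
    + exact/measurable_EFinP.
    + by apply: measurable_funeM; apply/measurable_EFinP; apply: measurable_indic; exact: measurable_rV_box.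
    + move=> y _; rewrite -EFinM lee_fin indicE.
      have [yab|yab] := pselect (rV_box n a b y); first by rewrite mem_set ?mulr1.
      by rewrite -/(sec g x y) sab// memNset ?mulr0.
  - move=> x xab; rewrite /mar integral0_eq// => y _.
    by rewrite /sec gab// => /rV_box_row_cons[xab' _]; move: xab; rewrite xab'.
have Imar g : box_fun n.+1 g -> (\int[lam n.+1]_x (g x)%:E = \int[mu]_x (mar g x)%:E)%E.
  move=> hg; have [mg g0 _ _] := hg.
  rewrite (@ge0_integral_rVS R n (EFin \o g)); [|exact/measurable_EFinP|by move=> y; rewrite lee_fin].
  by apply: eq_integral => x _; rewrite marE.
rewrite (Imar _ hu) (Imar _ hv) (Imar _ hw).
apply: (@prekopa_leindler_powR (k ord0)) => //; [exact: hmar|exact: hmar|exact: hmar|].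
move=> x y x0 y0.
pose z := (x + y) / 2.
have z0 : 0 < z by rewrite divr_gt0// addr_gt0.
pose k' j := k (lift ord0 j).
(* The weight [(x y)^(k-1)] goes entirely to [u], and [v] stays unweighted; [w] receives [z^(k-1)],
   which the right side squares. *)
have := IH k' (fun t => (x * y) `^ (k ord0 - 1) * sec u (x `^ k ord0) t)
  (fun t => sec v (y `^ k ord0) t)
  (fun t => z `^ (k ord0 - 1) * sec w (z `^ k ord0) t).
have scal c g t : 0 <= c -> box_fun n.+1 g ->
    (\int[lam n]_y (c * sec g t y)%:E = (c * mar g t)%:E)%E.
  move=> c0 hg; have [ms s0 _ _] := hsec1 g t hg.
  have ms' : measurable_fun setT (fun y => (sec g t y)%:E) by apply/measurable_EFinP.
  have s0' s : (setT : set 'rV[R]_n) s -> (0 <= (sec g t s)%:E)%E by rewrite lee_fin.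
  have := @ge0_integralZl _ _ _ (lam n) setT measurableT _ ms' c%:E s0'.
  by rewrite lee_fin => /(_ c0) E; rewrite EFinM -marE// -E.
rewrite (scal _ _ _ (powR_ge0 _ _) hu) (scal _ _ _ (powR_ge0 _ _) hw) (marE _ _ hv).
have EFin_le (A B C : R) : (A%:E * B%:E <= C%:E * C%:E)%E = (A * B <= C ^+ 2).
  by rewrite -!EFinM lee_fin expr2.
rewrite EFin_le => h.
rewrite [leLHS]mulrC mulrA.
rewrite [mar w _ * _]mulrC; apply: h.
- by move=> i; exact: k1.
- by apply: hsec => //; exact: powR_ge0.
- exact: hsec1.
- by apply: hsec => //; exact: powR_ge0.
move=> s t s0 t0.
have := uvw (row_cons (x, s)) (row_cons (y, t)).
rewrite !big_ord_recl !coord_pow_row_cons !row_cons_ord0.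
have -> : 2^-1 *: (row_cons (x, s) + row_cons (y, t)) = row_cons (z, 2^-1 *: (s + t)).
  apply/rowP => i; rewrite !mxE; case: unliftP => [j|] _; first by rewrite !mxE.
  by rewrite /z mulrC.
rewrite coord_pow_row_cons.
have -> : \prod_(i < n) (row_cons (x, s) ord0 (lift ord0 i) *
    row_cons (y, t) ord0 (lift ord0 i)) `^ (k (lift ord0 i) - 1) =
    \prod_(i < n) (s ord0 i * t ord0 i) `^ (k' i - 1).
  by apply: eq_bigr => i _; rewrite !row_cons_lift.
have -> : \prod_(i < n) ((row_cons (x, s) ord0 (lift ord0 i) +
    row_cons (y, t) ord0 (lift ord0 i)) / 2) `^ (k (lift ord0 i) - 1) =
    \prod_(i < n) ((s ord0 i + t ord0 i) / 2) `^ (k' i - 1).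
  by apply: eq_bigr => i _; rewrite !row_cons_lift.
move=> h; rewrite /sec; set P := \prod_i _; set Q := \prod_i _.
apply: (@le_trans _ _ (u (row_cons (x `^ k ord0, coord_pow k' s)) *
  v (row_cons (y `^ k ord0, coord_pow k' t)) * ((x * y) `^ (k ord0 - 1) * P))).
  by rewrite le_eqVlt; apply/orP; left; apply/eqP; rewrite -/k'; ring.
apply: (le_trans (h _ _)).
- by apply/(row_cons_all (fun _ r => 0 < r : Prop)).
- by apply/(row_cons_all (fun _ r => 0 < r : Prop)).
- by rewrite -/z -/Q; rewrite le_eqVlt; apply/orP; left; apply/eqP; congr (_ ^+ 2); ring.
Qed.

End prekopa_leindler.

(** * Almost everywhere differentiability of Lipschitz functions *)

Section rademacher1.
Variable R : realType.
Notation mu := (@lebesgue_measure R).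

Section cumulative_lipschitz.
Variables (g : R -> R) (L : R).
Hypothesis g_nd : {homo g : x y / x <= y}.
Hypothesis g_lip : forall x y, `|g x - g y| <= L * `|x - y|.

Lemma lipschitz_continuous_real : continuous g.
Proof.
move=> x; apply/cvgrPdist_le => e e0.
have L1 : 0 < `|L| + 1 by rewrite ltr_wpDl.
near=> y; apply: (le_trans (g_lip _ _)).
have : `|x - y| <= e / (`|L| + 1).
  by near: y; apply: cvgr_dist_le => //; rewrite divr_gt0.
rewrite ler_pdivlMr// => h; apply: le_trans h.
rewrite mulrC ler_wpM2l//; have := ler_norm L; lra.
Unshelve. all: by end_near. Qed.

HB.instance Definition _ := isCumulative.Build R _ R g g_nd
  (right_continuousW lipschitz_continuous_real).

Lemma lipschitz_stieltjes : exists nu : {measure set (measurableTypeR R) -> \bar R},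
  forall a b, a <= b -> nu `]a, b]%classic = (g b - g a)%:E.
Proof.
exists (lebesgue_stieltjes_measure g) => a b ab.
transitivity (wlength g `]a, b]%classic); last by rewrite wlength_itv_bnd.
by apply: (measurable_mu_extE (wlength g)); exact: is_ocitv.
Qed.

End cumulative_lipschitz.

Lemma derivable_shift_eq (F G : R -> R) (c x : R) :
  (\forall y \near x, F y = G y + c) -> derivable F x 1 -> derivable G x 1.
Proof.
move=> FG dF; rewrite (_ : G = (fun y => (G y + c) - c)); last first.
  by apply/funext => y; rewrite addrK.
apply: derivableB; last exact: derivable_cst.
exact: near_eq_derivable FG dF.
Qed.

(* The functions L x + q x and L x - q x are nondecreasing and their Stieltjes measures
   add up to 2 L times Lebesgue measure, so the first one has a density and the
   fundamental theorem of calculus applies. *)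
Lemma ae_derivable_lipschitz_itv (q : R -> R) (L N : R) : 0 < L -> 0 < N ->
  (forall x y, `|q x - q y| <= L * `|x - y|) ->
  {ae mu, forall x, - N < x < N -> derivable q x 1}.
Proof.
move=> L0 N0 ql.
have hom (s : R) : `|s| <= 1 -> {homo (fun x => L * x + s * q x) : x y / x <= y}.
  move=> s1 x y xy.
  have h : `|s * (q x - q y)| <= L * (y - x).
    rewrite normrM; apply: (@le_trans _ _ (1 * `|q x - q y|)).
      by rewrite ler_wpM2r.
    by rewrite mul1r (le_trans (ql _ _))// distrC ger0_norm// subr_ge0.
  have := le_trans (ler_norm _) h; lra.
have lip (s : R) : `|s| <= 1 -> forall x y,
    `|(L * x + s * q x) - (L * y + s * q y)| <= (2 * L) * `|x - y|.
  move=> s1 x y; rewrite (_ : _ - _ = L * (x - y) + s * (q x - q y)); last by ring.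
  apply: (le_trans (ler_normD _ _)); rewrite !normrM (gtr0_norm L0).
  have : `|s| * `|q x - q y| <= 1 * (L * `|x - y|) by rewrite ler_pM.
  lra.
have s1 : `|1 : R| <= 1 by rewrite normr1.
have sN1 : `|-1 : R| <= 1 by rewrite normrN1.
have [nu1 nu1E] := lipschitz_stieltjes (hom _ s1) (lip _ s1).
have [nu2 nu2E] := lipschitz_stieltjes (hom _ sN1) (lip _ sN1).
have L2 : 0 <= (2 * L)^-1 by rewrite invr_ge0 mulr_ge0// ltW.
pose m : {measure set (measurableTypeR R) -> \bar R} :=
  mscale (NngNum L2) (measure_add nu1 nu2).
have mE A : m A = ((2 * L)^-1%:E * (nu1 A + nu2 A))%E.
  by congr (_ * _)%E; exact: measure_addE.
(* Half-open intervals determine the measure, and on them the increments of [q] cancel in the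
   sum. *)
have mum A : measurable A -> mu A = m A.
  move=> mA; apply: lebesgue_measure_unique => // _ [[a b] _ <-] /=.
  rewrite mE lebesgue_measure_itv/= lte_fin; case: ltP => [ab|ba].
    rewrite nu1E ?ltW// nu2E ?ltW// -!EFinD -EFinM; congr EFin.
    by field; rewrite gt_eqF.
  by rewrite set_itv_ge ?bnd_simp -?leNgt// !measure0 adde0 mule0.
pose I := `](- N), N]%classic : set (measurableTypeR R).
have mI : measurable I by exact: measurable_itv.
have NN : - N <= N by rewrite ge0_cp ?ltW.
have nuI : (nu1 I < +oo)%E by rewrite nu1E// ltry.
(* Restriction to [I] makes the measure finite, so its density is integrable on the whole line;
   nothing lies below [- N], so an integral over []-oo, y]] is the increment from [- N] to [y]. *)
pose nuN : {finite_measure set (measurableTypeR R) -> \bar R} := mfrestr mI nuI.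
have nuNE A : nuN A = nu1 (A `&` I) by [].
have dom : nuN `<< mu.
  apply/null_content_dominatesP => A mA muA0.
  have : (nu1 A + nu2 A = 0)%E.
    have := mum _ mA; rewrite muA0 mE => /esym/eqP; rewrite mule_eq0 eqe.
    by rewrite invr_eq0 mulf_eq0 pnatr_eq0/= (gt_eqF L0)/= => /eqP.
  move=> /eqP; rewrite padde_eq0// => /andP[/eqP A0 _].
  rewrite nuNE; apply/eqP; rewrite eq_le measure_ge0 andbT -A0.
  by apply: le_measure; rewrite ?inE//; exact: measurableI.
have [h [h0 hfin hint hE]] := radon_nikodym_sigma_finite dom.
pose rho x := fine (h x).
have rhoE x : (rho x)%:E = h x by rewrite fineK.
have rint : mu.-integrable setT (EFin \o rho).
  by apply: eq_integrable hint => // x _; rewrite /= rhoE.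
have := @FTC1Ny R rho.
have loc : locally_integrable setT rho by apply: open_integrable_locally => //; exact: openT.
move=> /(_ _ loc) FTC.
have inty y : mu.-integrable `]-oo, y] (EFin \o rho).
  by apply: integrableS rint => //; exact: measurable_itv.
have {}FTC := FTC inty.
move: FTC => /=; apply: filterS; first exact: (ae_filter_ringOfSetsType mu).
move=> x [dF _] /andP[Nx xN].
suff : derivable (fun x => L * x + 1 * q x) x 1.
  move=> dg; rewrite (_ : q = (fun x => (L * x + 1 * q x) - L * x)); last first.
    by apply/funext => y; rewrite mul1r addrC addKr.
  apply: derivableB; first exact: dg.
  by apply: derivableM; [exact: derivable_cst|exact: derivable_id].
apply: (@derivable_shift_eq _ _ (- (L * (- N) + 1 * q (- N))) _ _ dF) => /=.
have xN0 : 0 < Num.min (x + N) (N - x) by rewrite lt_min !subr_gt0 -ltrBlDr sub0r Nx xN.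
exists (Num.min (x + N) (N - x)) => //= y /=; rewrite lt_min => /andP[yx1 yx2].
have yN : - N < y < N.
  move: yx1 yx2; rewrite !ltr_distlC => /andP[h1 h2] /andP[h3 h4].
  by apply/andP; split; clear -h1 h2 h3 h4; lra.
have /andP[Ny1 yN1] := yN.
have -> : \int[mu]_(t in `]-oo, y]) rho t = (L * y + 1 * q y) - (L * (- N) + 1 * q (- N)).
  apply: EFin_inj; rewrite -nu1E ?ltW// /Rintegral fineK; last first.
    by apply: integrable_fin_num => //; exact: measurable_itv.
  under eq_integral do rewrite /= rhoE.
  rewrite -hE// nuNE; congr (nu1 _).
  have IE t : I t = (- N < t <= N) :> Prop by rewrite /I /= in_itv.
  apply/seteqP; split => t.
    by move=> [ty It]; move: ty It; rewrite IE /= !in_itv/= => -> /andP[-> _].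
  rewrite /= in_itv/= => /andP[Nt ty]; split; first by rewrite /= in_itv/=.
  by rewrite IE Nt (le_trans ty)// ltW.
by [].
Qed.

Lemma ae_derivable_lipschitz (q : R -> R) (L : R) :
  (forall x y, `|q x - q y| <= L * `|x - y|) ->
  {ae mu, forall x, derivable q x 1}.
Proof.
move=> ql.
have L1 : 0 < `|L| + 1 by rewrite ltr_wpDl.
have : {ae mu, forall x (n : nat), - n.+1%:R < x < n.+1%:R -> derivable q x 1}.
  apply: ae_foralln => n; apply: (ae_derivable_lipschitz_itv L1) => // x y.
  apply: (le_trans (ql x y)); rewrite ler_wpM2r//; have := ler_norm L; lra.
apply: filterS; first exact: (ae_filter_ringOfSetsType mu).
move=> x h; have /archi_boundP := normr_ge0 x; set N := Num.bound _ => xN.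
apply: (h N); rewrite -ltr_norml; apply: (lt_trans xN).
by rewrite ltr_nat.
Qed.

End rademacher1.

(** * Integration along coordinate lines *)

Section coordinate_slices.
Variable R : realType.
Notation mu := (@lebesgue_measure R).
Notation lam := (@lebesgue_rV R).

Definition row_upd n (v : 'rV[R]_n) (i : 'I_n) (t : R) : 'rV[R]_n :=
  \row_j (if j == i then t else v ord0 j).

Lemma measurable_row_upd n (v : 'rV[R]_n) i :
  measurable_fun setT (row_upd v i : measurableTypeR R -> 'rV[R]_n).
Proof.
apply: measurable_fun_rV => j.
have [ji|ji] := eqVneq j i.
  by apply: (eq_measurable_fun id) => // t _; rewrite mxE ji eqxx.
apply: (eq_measurable_fun (cst (v ord0 j))) => // t _.
by rewrite mxE (negbTE ji).
Qed.

Lemma row_upd0 n x (v : 'rV[R]_n) t : row_upd (row_cons (x, v)) ord0 t = row_cons (t, v).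
Proof.
apply/rowP => j; rewrite mxE; case: (unliftP ord0 j) => [i|] ->.
  by rewrite !row_cons_lift eq_sym (negbTE (neq_lift _ _)).
by rewrite eqxx row_cons_ord0.
Qed.

Lemma row_upd_lift n x (v : 'rV[R]_n) i t :
  row_upd (row_cons (x, v)) (lift ord0 i) t = row_cons (x, row_upd v i t).
Proof.
apply/rowP => j; rewrite mxE; case: (unliftP ord0 j) => [l|] ->.
  by rewrite !row_cons_lift mxE (inj_eq lift_inj).
by rewrite (negbTE (neq_lift _ _)) !row_cons_ord0.
Qed.

(** Tonelli in an order that makes coordinate [i] innermost: leading coordinates are peeled off by
    induction, and once [i] is the leading one the order of integration is swapped. This transfers
    one-dimensional facts to ['rV[R]_n]. *)
Lemma slice_le_integral n (i : 'I_n) (F G : 'rV[R]_n -> \bar R) :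
  measurable_fun setT F -> measurable_fun setT G ->
  (forall v, 0 <= F v)%E -> (forall v, 0 <= G v)%E ->
  (forall v, \int[mu]_t F (row_upd v i t) <= \int[mu]_t G (row_upd v i t))%E ->
  (\int[lam n]_v F v <= \int[lam n]_v G v)%E.
Proof.
elim: n i F G => [[]//|n IH] i F G mF mG F0 G0 FG.
case: (unliftP ord0 i) FG => [j|] -> FG.
  rewrite (ge0_integral_rVS mF F0) (ge0_integral_rVS mG G0); apply: ge0_le_integral => //.
  - by move=> x _; exact: integral_ge0.
  - exact: measurable_integral_rVS.
  - exact: measurable_integral_rVS.
  - move=> x _; apply: (IH j) => //.
    + by apply: measurableT_comp => //; exact: measurable_row_consr.
    + by apply: measurableT_comp => //; exact: measurable_row_consr.
    + move=> v; have := FG (row_cons (x, v)).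
      by under eq_integral do rewrite row_upd_lift; under [X in (_ <= X)%E]eq_integral do rewrite row_upd_lift.
rewrite (ge0_integral_rVS_swap mF F0) (ge0_integral_rVS_swap mG G0); apply: ge0_le_integral => //.
- by move=> x _; exact: integral_ge0.
- exact: measurable_integral_rVS_swap.
- exact: measurable_integral_rVS_swap.
- move=> v _; have := FG (row_cons (0 : measurableTypeR R, v)).
  by under eq_integral do rewrite row_upd0; under [X in (_ <= X)%E]eq_integral do rewrite row_upd0.
Qed.

Lemma measurable_translate n (c : 'rV[R]_n) : measurable_fun setT (fun v : 'rV[R]_n => v + c).
Proof.
apply: measurable_fun_rV => i.
apply: (eq_measurable_fun (fun v : 'rV[R]_n => v ord0 i + c ord0 i)).
  by move=> v _; rewrite mxE.
by apply: measurable_funD => //; exact: measurable_coord_rV.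
Qed.

Lemma row_cons_addr n x (v : 'rV[R]_n) (c : 'rV[R]_n.+1) :
  row_cons (x, v) + c =
  row_cons ((x : R) + c ord0 ord0 : measurableTypeR R, v + \row_j c ord0 (lift ord0 j)).
Proof.
apply/rowP => j; rewrite mxE; case: (unliftP ord0 j) => [l|] ->.
  by rewrite !row_cons_lift !mxE.
by rewrite !row_cons_ord0.
Qed.

Lemma ge0_integral_translate n (F : 'rV[R]_n -> \bar R) c :
  measurable_fun setT F -> (forall v, 0 <= F v)%E ->
  (\int[lam n]_v F (v + c)%R = \int[lam n]_v F v)%E.
Proof.
elim: n F c => [|n IH] F c mF F0.
  by apply: eq_integral => v _; congr F; apply/rowP => -[].
have mFc : measurable_fun setT (fun v : 'rV[R]_n.+1 => F (v + c)).
  by apply: measurableT_comp => //; exact: measurable_translate.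
rewrite (ge0_integral_rVS mFc (fun v => F0 (v + c))) (ge0_integral_rVS mF F0).
under eq_integral => x _.
  under eq_integral do rewrite row_cons_addr.
  rewrite (IH (fun v : 'rV[R]_n => F (row_cons ((x : R) + c ord0 ord0 : measurableTypeR R, v)))).
  over.
  by apply: measurableT_comp => //; exact: measurable_row_consr.
  by [].
have := @ge0_integral_affine R 1 (c ord0 ord0)
  (fun x => \int[lam n]_v F (row_cons (x : measurableTypeR R, v)))%E ltr01.
rewrite invr1 mul1e => <-.
- by apply: eq_integral => x _; rewrite mul1r.
- exact: measurable_integral_rVS.
- by move=> x; exact: integral_ge0.
Qed.

End coordinate_slices.

Section rV_norm.
Variable R : realType.

Lemma exists_natSinv_lt (e : R) : 0 < e -> exists k, k.+1%:R^-1 < e.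
Proof.
move=> e0; have [k _ /(_ k (leqnn _))/= ke] := near_infty_natSinv_lt (PosNum e0).
by exists k.
Qed.

Lemma rV_norm_le n (v : 'rV[R]_n) (M : R) : 0 <= M ->
  (forall i, `|v ord0 i| <= M) -> `|v| <= M.
Proof.
move=> M0 vM; rewrite [leLHS]/Num.norm/= mx_normrE; apply/bigmax_leP; split => //.
by move=> [i j] _ /=; rewrite (ord1 i).
Qed.

Lemma coord_norm_le n (v : 'rV[R]_n) i : `|v ord0 i| <= `|v|.
Proof.
rewrite [leRHS]/Num.norm/= mx_normrE.
exact: (@le_bigmax _ _ _ _ (fun i : 'I_1 * 'I_n => `|v i.1 i.2|) (ord0, i)).
Qed.

Lemma norm_scale_delta n (h : R) (i : 'I_n) :
  `|h *: delta_mx ord0 i : 'rV[R]_n| <= `|h|.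
Proof.
apply: rV_norm_le => // j; rewrite !mxE eqxx /=.
by case: (j == i); rewrite ?mulr1 ?mulr0 ?normr0.
Qed.

Lemma continuous_measurable_rV n (F : 'rV[R]_n -> R) : continuous F ->
  measurable_fun setT F.
Proof.
move=> cF; apply: (measurability (@RGenOpens.G R)).
  exact: RGenOpens.measurableE.
move=> _ [_ [a [b ->] <-]]; rewrite setTI; apply: open_measurable_rV.
by move/continuousP : cF; apply; exact: interval_open.
Qed.

Lemma lipschitz_continuous_rV n (F : 'rV[R]_n -> R) L :
  (forall x y, `|F x - F y| <= L * `|x - y|) -> continuous F.
Proof.
move=> Fl x; have FF : Filter (nbhs x) := nbhs_filter (x : 'rV[R]_n).
apply/cvgrPdist_le => e e0.
have L1 : 0 < `|L| + 1 by rewrite ltr_wpDl.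
near=> y; apply: (le_trans (Fl _ _)).
have : `|x - y| <= e / (`|L| + 1).
  by near: y; apply: cvgr_dist_le => //; rewrite divr_gt0.
rewrite ler_pdivlMr// => h; apply: le_trans h.
rewrite mulrC ler_wpM2l//; have := ler_norm L; lra.
Unshelve. all: by end_near. Qed.

End rV_norm.

(** * Partial derivatives almost everywhere *)

Section partial_ae.
Variable R : realType.
Notation mu := (@lebesgue_measure R).
Notation lam := (@lebesgue_rV R).

Definition diff_quot n (F : 'rV[R]_n -> R) (i : 'I_n) (h : R) (z : 'rV[R]_n) : R :=
  h^-1 * (F (h *: delta_mx ord0 i + z) - F z).

(* Cauchy criterion for the difference quotients, which makes the set visibly Borel. *)
Definition derivable_set n (F : 'rV[R]_n -> R) (i : 'I_n) : set 'rV[R]_n :=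
  \bigcap_p \bigcup_k
    \bigcap_(h in [set h : R * R | (0 < `|h.1| < k.+1%:R^-1) /\ (0 < `|h.2| < k.+1%:R^-1)])
      [set z | `|diff_quot F i h.1 z - diff_quot F i h.2 z| <= p.+1%:R^-1].

Lemma continuous_diff_quot n (F : 'rV[R]_n -> R) i h :
  continuous F -> continuous (diff_quot F i h).
Proof.
move=> cF z; have FF : Filter (nbhs z) := nbhs_filter (z : 'rV[R]_n).
apply: cvgM; first exact: cvg_cst.
apply: cvgB; last exact: cF.
apply: (@cvg_comp _ _ _ (fun z => h *: delta_mx ord0 i + z) F); last exact: cF.
by apply: cvgD; [exact: cvg_cst|exact: cvg_id].
Qed.

Lemma measurable_derivable_set n (F : 'rV[R]_n -> R) i :
  continuous F -> measurable (derivable_set F i).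
Proof.
move=> cF; apply: bigcap_measurable => // p _.
apply: bigcup_measurable => k _.
rewrite -[X in measurable X]setCK; apply: measurableC.
apply: open_measurable_rV; apply: closed_openC.
apply: closed_bigI => h _.
rewrite (_ : [set z | _] = (fun z => `|diff_quot F i h.1 z - diff_quot F i h.2 z|) @^-1` [set x | x <= p.+1%:R^-1])//.
apply: closed_comp; last exact: closed_le.
move=> z _; have FF : Filter (nbhs z) := nbhs_filter (z : 'rV[R]_n).
apply: cvg_norm.
by apply: cvgB; exact: continuous_diff_quot.
Qed.

(** Completeness of the reals: difference quotients that are Cauchy at 0 have a limit there. *)
Lemma derivable_setP n (F : 'rV[R]_n -> R) i z :
  derivable_set F i z <-> derivable F z (delta_mx ord0 i).
Proof.
split=> [zD|].
  apply/cauchy_cvgP/cauchy_exP => e e0.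
  have [p pe] := exists_natSinv_lt e0.
  have [k _ zk] := zD p I.
  (* An admissible increment, nonzero and below [1 / (k + 1)], whose quotient serves as the centre
     of the Cauchy ball. *)
  pose h0 : R := k.+2%:R^-1.
  have h00 : 0 < `|h0| < k.+1%:R^-1.
    by rewrite /h0 gtr0_norm ?invr_gt0 ?ltr0n//= ltf_pV2 ?posrE ?ltr0n// ltr_nat.
  exists (diff_quot F i h0 z).
  have k0 : 0 < k.+1%:R^-1 :> R by rewrite invr_gt0.
  change (\forall h \near 0^', ball (diff_quot F i h0 z) e (diff_quot F i h z)).
  near=> h; rewrite -ball_normE /=; apply: (le_lt_trans _ pe).
  have zkh : (0 < `|h0| < k.+1%:R^-1) /\ (0 < `|h| < k.+1%:R^-1) ->
    `|diff_quot F i h0 z - diff_quot F i h z| <= p.+1%:R^-1 := zk (h0, h).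
  apply: zkh; split => //.
  apply/andP; split; first by rewrite normr_gt0; near: h; exact: nbhs_dnbhs_neq.
  by near: h; apply: dnbhs0_lt.
move=> /cvg_ex[l dl] p _.
have e0 : 0 < (p.+1%:R^-1 : R) / 2 by rewrite divr_gt0// invr_gt0.
have := @cvgr_dist_le _ _ _ _ _ _ _ dl _ e0.
move=> [d /= d0 hd].
have [k kd] := exists_natSinv_lt d0.
exists k => // -[h h'] /= [/andP[h0 hk] /andP[h'0 h'k]].
have H r : 0 < `|r| -> `|r| < k.+1%:R^-1 -> `|l - diff_quot F i r z| <= p.+1%:R^-1 / 2.
  move=> r0 rk; have := hd r; rewrite /ball_/= sub0r normrN; apply.
    exact: lt_trans kd.
  by rewrite -normr_gt0.
rewrite (_ : _ - _ = (l - diff_quot F i h' z) - (l - diff_quot F i h z)); last by ring.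
apply: (le_trans (ler_normB _ _)).
by rewrite [leRHS]splitr lerD// H.
Unshelve. all: by end_near. Qed.

Lemma row_updE n (v : 'rV[R]_n) i t :
  row_upd v i t = (t - v ord0 i) *: delta_mx ord0 i + v.
Proof.
apply/rowP => j; rewrite !mxE eqxx/=; case: eqVneq => [->|_].
  by rewrite mulr1 subrK.
by rewrite mulr0 add0r.
Qed.

Lemma derivable_row_upd n (F : 'rV[R]_n -> R) i v t :
  derivable (fun t => F (row_upd v i t)) t 1 ->
  derivable F (row_upd v i t) (delta_mx ord0 i).
Proof.
rewrite /derivable; set f := (X in cvg (X @ _)); set g := (X in _ -> cvg (X @ _)).
suff -> : f = g by [].
apply/funext => h; rewrite /f /g /=; congr (_ *: (F _ - _)).
by rewrite !row_updE /GRing.scale/= mulr1 addrA -scalerDl addrA.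
Qed.

(** On each line parallel to axis [i] the function is Lipschitz, so the exceptional set has a null
    section there; integrating over these lines makes it null. *)
Lemma derivable_set_ae n (F : 'rV[R]_n -> R) i (L : R) : 0 <= L ->
  (forall x y, `|F x - F y| <= L * `|x - y|) ->
  lam n (~` derivable_set F i) = 0%E.
Proof.
move=> L0 Fl; have cF := lipschitz_continuous_rV Fl.
have mD := measurable_derivable_set i cF.
have mN : measurable (~` derivable_set F i) by exact: measurableC.
apply/eqP; rewrite -measure_le0.
apply: (@le_trans _ _ (\int[lam n]_v (\1_(~` derivable_set F i) v)%:E)%E).
  by rewrite integral_indic ?setIT.
rewrite -[leRHS](integral0 (lam n) setT).
apply: (@slice_le_integral _ _ i (fun v => (\1_(~` derivable_set F i) v)%:E) (cst 0%E)) => //.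
- exact/measurable_EFinP.
move=> v; rewrite integral0.
have mNv : measurable ((row_upd v i : measurableTypeR R -> _) @^-1` (~` derivable_set F i)).
  rewrite -[X in measurable X]setTI; exact: (measurable_row_upd v i).
rewrite (_ : (fun t => _) = fun t => (\1_((row_upd v i : measurableTypeR R -> _) @^-1` (~` derivable_set F i)) t)%:E); last first.
  by apply/funext => t; rewrite !indicE.
rewrite integral_indic// setIT.
have ql x y : `|F (row_upd v i x) - F (row_upd v i y)| <= L * `|x - y|.
  apply: (le_trans (Fl _ _)); rewrite ler_wpM2l// !row_updE.
  rewrite opprD addrACA subrr addr0 -scalerBl opprB addrA subrK.
  exact: norm_scale_delta.
have [A [mA A0 sA]] := ae_derivable_lipschitz ql.
rewrite -A0; apply: le_measure; rewrite ?inE//.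
move=> t /= nt; apply: sA => /= dt; apply: nt.
by apply/derivable_setP; exact: derivable_row_upd.
Qed.

End partial_ae.

(** * Energy of difference quotients *)

Section energy.
Variable R : realType.
Notation lam := (@lebesgue_rV R).

(** The sum of the squared deviations from the mean is nonnegative. *)
Lemma sqr_sum_le m (x : 'I_m -> R) :
  (\sum_j x j) ^+ 2 <= m%:R * \sum_j x j ^+ 2.
Proof.
case: m x => [|m] x; first by rewrite !big_ord0 mul0r expr0n.
have m0 : 0 < m.+1%:R :> R by rewrite ltr0n.
set S := \sum_j x j.
have : 0 <= \sum_j (x j - S / m.+1%:R) ^+ 2 by apply: sumr_ge0 => j _; exact: sqr_ge0.
have sumE (c k : R) : \sum_(j < m.+1) (x j ^+ 2 + (c + k * x j)) =
    \sum_(j < m.+1) x j ^+ 2 + (m.+1%:R * c + k * S).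
  by rewrite !big_split/= -mulr_sumr sumr_const card_ord mulr_natl.
rewrite (_ : \sum_j _ = \sum_j x j ^+ 2 - S ^+ 2 / m.+1%:R).
  by rewrite subr_ge0 ler_pdivrMr// mulrC.
rewrite (eq_bigr (fun j => x j ^+ 2 + ((S / m.+1%:R) ^+ 2 + (- (2 * (S / m.+1%:R))) * x j))); last first.
  by move=> j _; ring.
by rewrite sumE; field; rewrite addrC natr1 gt_eqF.
Qed.

(** Telescoping over [m + 1] equal steps. It allows the step to tend to 0 while [h] stays fixed. *)
Lemma diff_quot_subdiv n (F : 'rV[R]_n -> R) i (h : R) m z : h != 0 ->
  diff_quot F i h z = m.+1%:R^-1 *
    \sum_(j < m.+1) diff_quot F i (h / m.+1%:R) (z + (j%:R * (h / m.+1%:R)) *: delta_mx ord0 i).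
Proof.
move=> h0; rewrite /diff_quot -mulr_sumr.
pose s (j : nat) := F (z + (j%:R * (h / m.+1%:R)) *: delta_mx ord0 i).
have -> : \sum_(j < m.+1) (F ((h / m.+1%:R) *: delta_mx ord0 i + (z + (j%:R * (h / m.+1%:R)) *: delta_mx ord0 i)) -
    F (z + (j%:R * (h / m.+1%:R)) *: delta_mx ord0 i)) = s m.+1 - s 0%N.
  rewrite -(telescope_sumr s (leq0n _)) big_mkord; apply: eq_bigr => j _.
  rewrite /s; congr (F _ - _); rewrite addrCA -scalerDl; congr (_ + _ *: _).
  by rewrite -[j.+1%:R]natr1 mulrDl mul1r addrC.
have m0 : m.+1%:R != 0 :> R by rewrite pnatr_eq0.
have -> : s m.+1 = F (h *: delta_mx ord0 i + z) by rewrite /s mulrC divfK// addrC.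
have -> : s 0%N = F z by rewrite /s mul0r scale0r addr0.
by rewrite mulrA; congr (_ * _); rewrite invf_div; field; rewrite h0 addrC natr1 m0.
Qed.

Lemma sume_cst_ord m (X : \bar R) : (0 <= X)%E ->
  (\sum_(j < m) X = (m%:R)%:E * X)%E.
Proof.
move=> X0; elim: m => [|m IH]; first by rewrite big_ord0 mul0e.
by rewrite big_ord_recr/= IH -natr1 EFinD ge0_muleDl ?mul1e// lee_fin.
Qed.

Lemma diff_quot_bound n (F : 'rV[R]_n -> R) i h L z : 0 <= L ->
  (forall x y, `|F x - F y| <= L * `|x - y|) -> `|diff_quot F i h z| <= L.
Proof.
move=> L0 Fl; have [->|h0] := eqVneq h 0.
  by rewrite /diff_quot invr0 mul0r normr0.
rewrite /diff_quot normrM normfV ler_pdivrMl ?normr_gt0//.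
apply: (le_trans (Fl _ _)); rewrite addrK mulrC ler_wpM2r//.
exact: norm_scale_delta.
Qed.

(* The partial derivative, replaced by 0 where it does not exist so that it is measurable. *)
Definition partial_ae n (F : 'rV[R]_n -> R) (i : 'I_n) (z : 'rV[R]_n) : R :=
  \1_(derivable_set F i) z * 'D_(delta_mx ord0 i) F z.

Lemma partial_ae_cvg n (F : 'rV[R]_n -> R) i (d : R) z : d != 0 -> derivable_set F i z ->
  (fun m => diff_quot F i (d / m.+1%:R) z) @ \oo --> partial_ae F i z.
Proof.
move=> d0 Dz; rewrite /partial_ae indicE mem_set// mul1r.
have /derivable_setP dF := Dz.
have cv : (fun h => diff_quot F i h z) @ 0^' --> 'D_(delta_mx ord0 i) F z by exact: dF.
apply/cvgrPdist_le => e e0.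
have [r /= r0 hr] := (cvgrPdist_le _ _).1 cv e e0.
have rd : 0 < r / `|d| by rewrite divr_gt0// normr_gt0.
have [N Nr] := exists_natSinv_lt rd.
exists N => // m /= Nm; apply: hr.
  rewrite /ball_/= sub0r normrN normrM normfV [`|m.+1%:R|]ger0_norm//.
  rewrite mulrC -ltr_pdivlMr ?normr_gt0//; apply: le_lt_trans Nr.
  by rewrite lef_pV2 ?posrE ?ltr0n// ler_nat.
by rewrite mulf_neq0// invr_neq0// pnatr_eq0.
Qed.

Lemma measurable_partial_ae n (F : 'rV[R]_n -> R) i : continuous F ->
  measurable_fun setT (partial_ae F i).
Proof.
move=> cF.
apply: (@measurable_fun_cvg _ _ _ _ (fun m z => \1_(derivable_set F i) z * diff_quot F i (1 / m.+1%:R) z)).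
- move=> m; apply: measurable_funM.
    by apply: measurable_indic; exact: measurable_derivable_set.
  by apply: continuous_measurable_rV; exact: continuous_diff_quot.
- move=> z _; have [zD|zD] := pselect (derivable_set F i z).
    have := partial_ae_cvg (oner_neq0 R) zD; apply: cvg_trans; apply: near_eq_cvg.
    by apply: nearW => m; rewrite indicE mem_set//= !mul1r.
  have z0 : \1_(derivable_set F i) z = 0 :> R by rewrite indicE memNset.
  rewrite /partial_ae z0 mul0r; under eq_fun do rewrite mul0r.
  exact: cvg_cst.
Qed.

(** The quotient with step [d] is a mean of quotients with step [d / (m + 1)] at shifted points.
    Convexity of the square, translation invariance and the oscillation bound on [alpha] reduce the
    claim to these small quotients on the larger box, where they converge to the partial derivative
    under the majorant [A L^2]. Since [c] has no component along [i], the total shift stays in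
    [[0, d]^n]. *)
Lemma energy_diff_quot n (F : 'rV[R]_n -> R) i (L a b d eta A : R) (alpha : 'rV[R]_n -> R) c :
  0 <= L -> (forall x y, `|F x - F y| <= L * `|x - y|) ->
  0 < d -> 0 <= eta -> measurable_fun setT alpha -> (forall z, 0 <= alpha z) ->
  (forall z, rV_box n a (b + d) z -> alpha z <= A) ->
  (forall z c, rV_box n a b z -> rV_box n 0 d c -> alpha z <= (1 + eta) * alpha (z + c)) ->
  rV_box n 0 d c -> c ord0 i = 0 ->
  (\int[lam n]_(z in rV_box n a b) (alpha z * diff_quot F i d (z + c) ^+ 2)%:E <=
   (1 + eta)%:E * \int[lam n]_(z in rV_box n a (b + d)) (alpha z * partial_ae F i z ^+ 2)%:E)%E.
Proof.
move=> L0 Fl d0 eta0 malpha alpha0 alphaA osc hc ci.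
have cF := lipschitz_continuous_rV Fl.
have mK := @measurable_rV_box R n a b.
have mK' := @measurable_rV_box R n a (b + d).
have e1 : 0 <= 1 + eta by rewrite addr_ge0.
have mdq h : measurable_fun setT (diff_quot F i h).
  by apply: continuous_measurable_rV; exact: continuous_diff_quot.
pose E m := (\int[lam n]_(z in rV_box n a (b + d)) (alpha z * diff_quot F i (d / m.+1%:R) z ^+ 2)%:E)%E.
have step m : (\int[lam n]_(z in rV_box n a b) (alpha z * diff_quot F i d (z + c) ^+ 2)%:E <=
    (1 + eta)%:E * E m)%E.
  pose cj (j : 'I_m.+1) := c + (j%:R * (d / m.+1%:R)) *: delta_mx ord0 i.
  have hcj j : rV_box n 0 d (cj j).
    move=> l; rewrite /cj !mxE eqxx/=; have [->|_] := eqVneq l i; last first.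
      by rewrite mulr0 addr0; exact: hc.
    rewrite ci add0r mulr1 mulr_ge0 ?divr_ge0 ?(ltW d0)//=.
    by rewrite mulrCA ger_pMr// ler_pdivrMr ?ltr0n// mul1r ler_nat ltnW.
  pose q j z := alpha z * diff_quot F i (d / m.+1%:R) (z + cj j) ^+ 2.
  have mshift (g : 'rV[R]_n -> R) (c' : 'rV[R]_n) : measurable_fun setT g -> measurable_fun setT (fun z : 'rV[R]_n => g (z + c')).
    by move=> mg; apply: measurableT_comp => //; exact: measurable_translate.
  have q0 j z : 0 <= q j z by rewrite mulr_ge0 ?sqr_ge0.
  have mq j : measurable_fun setT (q j).
    by apply: measurable_funM => //; apply: measurable_funX; exact: mshift.
  apply: (@le_trans _ _ (\int[lam n]_(z in rV_box n a b) ((m.+1%:R^-1)%:E * \sum_(j < m.+1) (q j z)%:E))%E).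
    apply: ge0_le_integral => //.
    - by move=> z _; rewrite lee_fin mulr_ge0 ?sqr_ge0.
    - apply/measurable_EFinP/measurable_funTS; apply: measurable_funM => //.
      by apply: measurable_funX; exact: mshift.
    - apply: measurable_funTS; apply: measurable_funeM; apply: emeasurable_sum => j.
      exact/measurable_EFinP.
    - move=> z _; rewrite sumEFin -EFinM lee_fin /q -mulr_sumr [leRHS]mulrCA ler_wpM2l//.
      rewrite (diff_quot_subdiv F i m _ (lt0r_neq0 d0)).
      rewrite exprMn expr2 -mulrA ler_wpM2l ?invr_ge0//.
      rewrite ler_pdivrMl ?ltr0n//.
      by under eq_bigr do rewrite -addrA; exact: sqr_sum_le.
  have mEq j : measurable_fun (rV_box n a b) (fun z => (q j z)%:E).
    by apply/measurable_EFinP/measurable_funTS.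
  have Eq0 j z : rV_box n a b z -> (0 <= (q j z)%:E)%E by rewrite lee_fin.
  rewrite ge0_integralZl//; [|by apply: emeasurable_sum => j; exact: mEq
    |by move=> z zK; apply: sume_ge0 => j _; exact: Eq0].
  rewrite ge0_integral_sum//.
  have qE j : (\int[lam n]_(z in rV_box n a b) (q j z)%:E <= (1 + eta)%:E * E m)%E.
    rewrite integral_mkcond /E [X in (_ <= _ * X)%E]integral_mkcond.
    pose G z := ((fun z => (alpha z * diff_quot F i (d / m.+1%:R) z ^+ 2)%:E) \_ (rV_box n a (b + d))) z.
    have mG : measurable_fun setT G.
      apply/(measurable_restrictT _ _).1 => //; apply/measurable_EFinP/measurable_funTS.
      by apply: measurable_funM => //; exact: measurable_funX.
    have G0 z : (0 <= G z)%E.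
      by rewrite /G patchE; case: ifPn => // _; rewrite lee_fin mulr_ge0 ?sqr_ge0.
    rewrite -[X in (_ <= _ * X)%E](ge0_integral_translate (cj j) mG G0) -ge0_integralZl//; last first.
      by apply: measurableT_comp => //; exact: measurable_translate.
    apply: ge0_le_integral => //.
    - by move=> z _; rewrite patchE; case: ifPn => // _; rewrite lee_fin.
    - apply/(measurable_restrictT _ _).1 => //; exact/measurable_EFinP/measurable_funTS.
    - apply: measurable_funeM; apply: measurableT_comp => //; exact: measurable_translate.
    - move=> z _; rewrite patchE; case: ifPn => [/set_mem zK|_]; last by rewrite mule_ge0.
      rewrite /G patchE mem_set; last first.
        move=> l; rewrite mxE; have := zK l; have := hcj j l; lra.
      rewrite -EFinM lee_fin /q [leRHS]mulrA ler_wpM2r ?sqr_ge0//; exact: osc.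
  apply: (@le_trans _ _ ((m.+1%:R^-1)%:E * \sum_(j < m.+1) ((1 + eta)%:E * E m))%E).
    by apply: lee_wpmul2l; [rewrite lee_fin invr_ge0|apply: lee_sum => j _; exact: qE].
  have X0 : (0 <= (1 + eta)%:E * E m)%E.
    rewrite mule_ge0 ?lee_fin// integral_ge0// => z _.
    by rewrite lee_fin mulr_ge0 ?sqr_ge0.
  by rewrite sume_cst_ord// muleA -EFinM mulVf ?pnatr_eq0// mul1e.
have Ecv : E @ \oo --> (\int[lam n]_(z in rV_box n a (b + d)) (alpha z * partial_ae F i z ^+ 2)%:E)%E.
  have := @dominated_convergence _ _ _ (lam n) (rV_box n a (b + d)) mK'
    (fun m z => (alpha z * diff_quot F i (d / m.+1%:R) z ^+ 2)%:E)
    (fun z => (alpha z * partial_ae F i z ^+ 2)%:E) (cst (A * L ^+ 2)%:E).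
  case=> //.
  - by move=> m; apply/measurable_EFinP/measurable_funTS; apply: measurable_funM => //; exact: measurable_funX.
  - apply/measurable_EFinP/measurable_funTS; apply: measurable_funM => //.
    by apply: measurable_funX; exact: measurable_partial_ae.
  - exists (~` derivable_set F i); split.
    + by apply: measurableC; exact: measurable_derivable_set.
    + exact: (derivable_set_ae _ L0).
    + move=> z /= nz zD; apply: nz => _; apply: cvg_EFin; first exact: nearW.
      apply: cvgM; first exact: cvg_cst.
      by apply: (@cvg_comp _ _ _ _ (fun x => x ^+ 2) _ _ _ (partial_ae_cvg (lt0r_neq0 d0) zD)); exact: exprn_continuous.
  - apply/integrableP; split; first exact: measurable_cst.
    rewrite integral_cst// lte_mul_pinfty ?abse_ge0//.
    exact: rV_box_measure.
  - apply: aeW => z m zK; rewrite lee_fin ger0_norm; last by apply: mulr_ge0; [exact: alpha0|exact: sqr_ge0].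
    apply: ler_pM; [exact: alpha0|exact: sqr_ge0|exact: alphaA|].
    have := diff_quot_bound i (d / m.+1%:R) z L0 Fl; move: (diff_quot _ _ _ _) => r rL.
    by rewrite -(real_normK (num_real r)) lerXn2r ?nnegrE.
(* The left side of [step] does not depend on [m], so the bound passes to the limit. *)
have cv := cvgeZl (y := (1 + eta)%:E) isT Ecv.
by apply: (cvge_to_ge cv); exact: nearW.
Qed.

End energy.

(** * Steklov averages *)

Section bounded_means.
Variable R : realType.

Lemma bounded_integrable d (T : measurableType d) (m : {measure set T -> \bar R})
    (D : set T) (u : T -> R) (C : R) : measurable D -> (m D < +oo)%E ->
  measurable_fun D u -> (forall x, D x -> `|u x| <= C) ->
  m.-integrable D (EFin \o u).
Proof.
move=> mD Doo mu uC; apply: measurable_bounded_integrable => //.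
exists C; split; first exact: num_real.
by move=> M CM x Dx; apply: (le_trans (uC x Dx)); exact: ltW.
Qed.

Lemma itv_finite (x y : R) : (lebesgue_measure (`[x, y]%classic : set R) < +oo)%E.
Proof. by rewrite lebesgue_measure_itv/=; case: ifP => _; rewrite -?EFinB ltry. Qed.

Lemma EFin_Rintegral d (T : measurableType d) (m : {measure set T -> \bar R})
    (D : set T) (u : T -> R) : measurable D -> m.-integrable D (EFin \o u) ->
  ((\int[m]_(x in D) u x)%:E = \int[m]_(x in D) (u x)%:E)%E.
Proof. by move=> mD iu; rewrite /Rintegral fineK//; exact: integrable_fin_num. Qed.

End bounded_means.

Section steklov1.
Variable R : realType.
Notation mu := (@lebesgue_measure R).
Variables (q : R -> R) (L B : R).
Hypothesis L0 : 0 <= L.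
Hypothesis ql : forall x y, `|q x - q y| <= L * `|x - y|.
Hypothesis qB : forall x, `|q x| <= B.

Let mq : measurable_fun setT q.
Proof.
apply: continuous_measurable_fun; exact: lipschitz_continuous_real ql.
Qed.

Let iq (x y : R) : mu.-integrable `[x, y] (EFin \o q).
Proof.
apply: (@bounded_integrable _ _ _ _ _ _ B) => //.
- exact: itv_finite.
- exact: measurable_funTS.
Qed.

Lemma Rintegral_itv_split (x y z : R) : x <= y -> y <= z ->
  \int[mu]_(t in `[x, z]) q t = \int[mu]_(t in `[x, y]) q t + \int[mu]_(t in `[y, z]) q t.
Proof.
move=> xy yz; have := @Rintegral_itvB R q (BLeft x) (BRight z) y (iq x z).
rewrite !bnd_simp => /(_ xy yz) h.
have mqT D : measurable_fun D q by exact: measurable_funTS.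
rewrite -(@Rintegral_itv_obnd_cbnd _ y)//.
rewrite -h addrC subrK//.
apply: integrableS (iq x z) => // t; rewrite /= !in_itv/= => /andP[yt ->].
by rewrite andbT (le_trans xy)// ltW.
Qed.

Lemma Rintegral_itv_cst (x y c : R) : x <= y -> \int[mu]_(t in `[x, y]) c = c * (y - x).
Proof.
move=> xy; rewrite Rintegral_cst//= lebesgue_measure_itv/= lte_fin.
by move: xy; rewrite le_eqVlt => /predU1P[->|->]; rewrite ?ltxx ?subrr ?mulr0//= -EFinB.
Qed.

Lemma Rintegral_itv_shift (s : R) :
  \int[mu]_(t in `[0, 1]) q (t + s) = \int[mu]_(t in `[s, 1 + s]) q t.
Proof.
(* Adding [B] makes the integrand nonnegative, as the substitution rule requires; its contribution
   cancels at the end. *)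
pose F (t : R) : \bar R := (\1_`[s, 1 + s] t * (q t + B))%:E.
have F0 t : (0 <= F t)%E.
  rewrite lee_fin mulr_ge0// -lerBlDr sub0r; have := qB t; rewrite ler_norml; by case/andP.
have mF : measurable_fun setT F.
  apply/measurable_EFinP; apply: measurable_funM; first exact: measurable_indic.
  exact: measurable_funD.
have := @ge0_integral_affine R 1 s F ltr01 mF F0; rewrite invr1 mul1e.
have B0 : 0 <= B by apply: le_trans (qB 0).
have iqs : mu.-integrable `[0, 1] (EFin \o (fun t => q (t + s))).
  apply: (@bounded_integrable _ _ _ _ _ _ B) => //.
  - exact: itv_finite.
  - apply: measurable_funTS; apply: measurableT_comp => //; exact: measurable_funD.
have icst (x y : R) : mu.-integrable `[x, y] (EFin \o cst B).
  apply: (@bounded_integrable _ _ _ _ _ _ B) => //.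
  - exact: itv_finite.
  - by move=> t _; rewrite ger0_norm.
have -> : (\int[mu]_x F (1 * x + s)%R = (\int[mu]_(t in `[0, 1]) (q (t + s) + B))%:E)%E.
  rewrite EFin_Rintegral//; last exact: (integrableD _ iqs (icst 0 1)).
  rewrite [RHS]integral_mkcond; apply: eq_integral => t _; rewrite patchE /F mul1r indicE.
  rewrite (_ : (t + s \in _) = (t \in `[0, 1]%classic)); first by case: ifPn => _ /=; rewrite ?mul1r ?mul0r.
  by apply/idP/idP; rewrite !inE/= !in_itv/= => /andP[? ?]; apply/andP; split; lra.
have -> : (\int[mu]_x F x = (\int[mu]_(t in `[s, (1 + s)%R]) (q t + B))%:E)%E.
  rewrite EFin_Rintegral//; last exact: (integrableD _ (iq _ _) (icst _ _)).
  rewrite [RHS]integral_mkcond; apply: eq_integral => t _; rewrite patchE /F indicE.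
  by case: ifPn => _ /=; rewrite ?mul1r ?mul0r.
move=> [].
rewrite !RintegralD//; rewrite !Rintegral_itv_cst ?lerDr//; lra.
Qed.

Lemma Rintegral_itv_lip (c s : R) : 0 <= s ->
  `|\int[mu]_(t in `[c, c + s]) q t - s * q c| <= L * s ^+ 2.
Proof.
move=> s0; have cs : c <= c + s by rewrite lerDl.
have icst (x y e : R) : mu.-integrable `[x, y] (EFin \o cst e).
  apply: (@bounded_integrable _ _ _ _ _ _ `|e|) => //.
  exact: itv_finite.
have b t : t \in `[c, c + s] -> q c - L * s <= q t <= q c + L * s.
  rewrite in_itv/= => /andP[ct ts]; rewrite -ler_distl.
  apply: (le_trans (ql _ _)); rewrite ler_wpM2l// ger0_norm; lra.
rewrite ler_distl; apply/andP; split.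
  rewrite [leLHS](_ : _ = \int[mu]_(t in `[c, c + s]) (q c - L * s)).
    by apply: le_Rintegral => //; [exact: icst|move=> t /b /andP[]].
  by rewrite Rintegral_itv_cst//; ring.
rewrite [leRHS](_ : _ = \int[mu]_(t in `[c, c + s]) (q c + L * s)).
  by apply: le_Rintegral => //; [exact: icst|move=> t /b /andP[]].
by rewrite Rintegral_itv_cst//; ring.
Qed.

(** The difference of the two means is the integral over [[1, 1 + s]] minus that over [[0, s]], and
    each of these is within [L s^2] of [s] times the value of [q] at the left end. Thus the running
    mean has slope [q 1 - q 0] up to a quadratic error. *)
Lemma steklov1_ge0 (s : R) : 0 <= s ->
  `|\int[mu]_(t in `[0, 1]) q (t + s) - \int[mu]_(t in `[0, 1]) q t - s * (q 1 - q 0)|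
    <= 2 * L * s ^+ 2.
Proof.
move=> s0; rewrite Rintegral_itv_shift.
have e1 : \int[mu]_(t in `[0, 1 + s]) q t =
    \int[mu]_(t in `[0, s]) q t + \int[mu]_(t in `[s, 1 + s]) q t.
  by apply: Rintegral_itv_split => //; lra.
have e2 : \int[mu]_(t in `[0, 1 + s]) q t =
    \int[mu]_(t in `[0, 1]) q t + \int[mu]_(t in `[1, 1 + s]) q t.
  by apply: Rintegral_itv_split => //; lra.
have h0 := Rintegral_itv_lip 0 s0; rewrite add0r in h0.
have h1 := Rintegral_itv_lip 1 s0.
rewrite (_ : _ - _ = (\int[mu]_(t in `[1, 1 + s]) q t - s * q 1) -
  (\int[mu]_(t in `[0, s]) q t - s * q 0)); last by move: e1 e2; lra.
apply: (le_trans (ler_normB _ _)); lra.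
Qed.

End steklov1.

(** For negative [s] the previous bound is applied to the shifted function. Its slope is
    [q (1 + s) - q s], and replacing that by [q 1 - q 0] costs another [2 L s^2]. *)
Lemma steklov1 (R : realType) (q : R -> R) (L B s : R) : 0 <= L ->
  (forall x y, `|q x - q y| <= L * `|x - y|) -> (forall x, `|q x| <= B) ->
  `|\int[lebesgue_measure]_(t in `[0, 1]) q (t + s) -
    \int[lebesgue_measure]_(t in `[0, 1]) q t - s * (q 1 - q 0)| <= 4 * L * s ^+ 2.
Proof.
move=> L0 ql qB; have [s0|s0] := leP 0 s.
  apply: (le_trans (steklov1_ge0 L0 ql qB s0)).
  by rewrite ler_wpM2r ?sqr_ge0// ler_wpM2r// ler_nat.
pose r t := q (t + s).
have rl x y : `|r x - r y| <= L * `|x - y|.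
  by apply: (le_trans (ql _ _)); rewrite opprD addrACA subrr addr0.
have s0' : 0 <= - s by rewrite oppr_ge0 ltW.
have h := steklov1_ge0 L0 rl (fun x => qB _) s0'.
rewrite /r in h; move: h; rewrite (_ : (fun t : R => q (t - s + s)) = q); last first.
  by apply/funext => t; rewrite subrK.
rewrite sqrrN add0r => h.
have h1 := ql (1 + s) 1; have h2 := ql s 0.
have s2 : s ^+ 2 = `|s| * `|s| by rewrite -normrM -expr2 ger0_norm// sqr_ge0.
have h3 : `|s * ((q (1 + s) - q 1) - (q s - q 0))| <= 2 * L * s ^+ 2.
  rewrite normrM s2 (_ : 2 * L * _ = `|s| * (2 * L * `|s|)); last by ring.
  rewrite ler_wpM2l//; apply: (le_trans (ler_normB _ _)).
  by move: h1 h2; rewrite [1 + s - 1]addrC addKr subr0; lra.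
pose X := \int[lebesgue_measure]_(t in `[0, 1]) q (t + s).
pose Y := \int[lebesgue_measure]_(t in `[0, 1]) q t.
rewrite -/X -/Y in h *.
rewrite (_ : _ - _ = - (Y - X - - s * (q (1 + s) - q s)) + s * ((q (1 + s) - q 1) - (q s - q 0))); last by ring.
by apply: (le_trans (ler_normD _ _)); rewrite normrN; lra.
Qed.

Section steklov.
Variable R : realType.
Notation mu := (@lebesgue_measure R).
Notation lam := (@lebesgue_rV R).

Notation cube n := (rV_box n 0 1).
Definition cube_mean n (u : 'rV[R]_n -> R) : R := \int[lam n]_(y in cube n) u y.

Lemma cube_measure n : lam n (cube n) = 1%E.
Proof.
rewrite (_ : cube n = [set v : 'rV[R]_n | forall i, (fun=> `[0, 1]%classic : set (measurableTypeR R)) i (v ord0 i)]); last first.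
  by apply/seteqP; split => v h i; have := h i; rewrite /= in_itv.
rewrite (@lebesgue_rV_box R n (fun=> `[0, 1]%classic)); last by move=> i; exact: measurable_itv.
by rewrite big1// => i _; rewrite lebesgue_measure_itv/= lte_fin ltr01 sube0.
Qed.

Lemma cube_integrable n (u : 'rV[R]_n -> R) (C : R) : measurable_fun setT u ->
  (forall y, `|u y| <= C) -> (lam n).-integrable (cube n) (EFin \o u).
Proof.
move=> mu' uC; apply: (@bounded_integrable _ _ _ _ _ _ C) => //.
- exact: measurable_rV_box.
- exact: rV_box_measure.
- exact: measurable_funTS.
Qed.

Lemma cube_mean_cst n (c : R) : cube_mean (fun _ : 'rV[R]_n => c) = c.
Proof.
rewrite /cube_mean Rintegral_cst; last exact: measurable_rV_box.
by rewrite /= cube_measure mulr1.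
Qed.

Lemma cube_mean_le n (u v : 'rV[R]_n -> R) (C : R) : measurable_fun setT u ->
  measurable_fun setT v -> (forall y, `|u y| <= C) -> (forall y, `|v y| <= C) ->
  (forall y, cube n y -> u y <= v y) -> cube_mean u <= cube_mean v.
Proof.
move=> mu' mv uC vC uv; apply: le_Rintegral => //.
- exact: measurable_rV_box.
- exact: cube_integrable uC.
- exact: cube_integrable vC.
Qed.

Lemma cube_meanB n (u v : 'rV[R]_n -> R) (C : R) : measurable_fun setT u ->
  measurable_fun setT v -> (forall y, `|u y| <= C) -> (forall y, `|v y| <= C) ->
  cube_mean (fun y => u y - v y) = cube_mean u - cube_mean v.
Proof.
move=> mu' mv uC vC; apply: RintegralB.
- exact: measurable_rV_box.
- exact: cube_integrable uC.
- exact: cube_integrable vC.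
Qed.

Lemma cube_meanZ n (u : 'rV[R]_n -> R) (c C : R) : measurable_fun setT u ->
  (forall y, `|u y| <= C) ->
  cube_mean (fun y => c * u y) = c * cube_mean u.
Proof.
move=> mu' uC; apply: RintegralZl; first exact: measurable_rV_box.
exact: cube_integrable uC.
Qed.

Lemma cube_mean_abs n (u : 'rV[R]_n -> R) (C : R) : measurable_fun setT u ->
  (forall y, `|u y| <= C) -> `|cube_mean u| <= C.
Proof.
move=> mu' uC; have C0 : 0 <= C by apply: le_trans (uC 0).
rewrite ler_norml -[X in - X](cube_mean_cst n C) -{2}(cube_mean_cst n C); apply/andP; split.
  rewrite -mulN1r -(@cube_meanZ n _ _ C)//; last by move=> _; rewrite ger0_norm.
  apply: (@cube_mean_le _ _ _ C) => //.
    by move=> y; rewrite mulN1r normrN ger0_norm.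
  by move=> y _; rewrite mulN1r; have := uC y; rewrite ler_norml => /andP[].
apply: (@cube_mean_le _ _ _ C) => //; first by move=> y; rewrite ger0_norm.
by move=> y _; have := uC y; rewrite ler_norml => /andP[].
Qed.

(** Jensen, by averaging [2 c u - u^2 <= c^2] with [c] the mean of [u]. *)
Lemma cube_mean_sqr n (u : 'rV[R]_n -> R) (C : R) : measurable_fun setT u ->
  (forall y, `|u y| <= C) -> cube_mean u ^+ 2 <= cube_mean (fun y => u y ^+ 2).
Proof.
move=> mu' uC; set c := cube_mean u.
have C0 : 0 <= C by apply: le_trans (uC 0).
have u2 y : `|u y ^+ 2| <= C ^+ 2 by rewrite normrX lerXn2r ?nnegrE.
have mu2 : measurable_fun setT (fun y => u y ^+ 2) by exact: measurable_funX.
have cC : `|c| <= C by exact: cube_mean_abs.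
have h : cube_mean (fun y => 2 * c * u y - u y ^+ 2) <= cube_mean (fun _ : 'rV[R]_n => c ^+ 2).
  apply: (@cube_mean_le _ _ _ (3 * C ^+ 2)) => //.
  - by apply: measurable_funB => //; exact: measurable_funM.
  - move=> y; apply: (le_trans (ler_normB _ _)); rewrite normrM [`|2 * c|]normrM.
    have : `|c| * `|u y| <= C * C by rewrite ler_pM.
    by have := u2 y; rewrite [`|2|]ger0_norm//; lra.
  - by move=> _; rewrite normrX; have : `|c| ^+ 2 <= C ^+ 2 by [rewrite lerXn2r ?nnegrE]; nra.
  - by move=> y _; rewrite -subr_ge0 (_ : _ - _ = (c - u y) ^+ 2) ?sqr_ge0//; ring.
rewrite cube_mean_cst (@cube_meanB _ _ _ (2 * C ^+ 2)) in h.
- rewrite (@cube_meanZ _ _ _ C)// -/c in h; lra.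
- exact: measurable_funM.
- exact: mu2.
- by move=> y; rewrite !normrM [`|2|]ger0_norm// -mulrA ler_wpM2l// expr2 ler_pM.
- by move=> y; apply: (le_trans (u2 y)); have := sqr_ge0 C; lra.
Qed.

(** Reduces a bound on the mean over the cube to bounds on segments parallel to axis [i], so that
    one-dimensional estimates for averages apply. *)
Lemma cube_mean_slice_le n (i : 'I_n) (P : 'rV[R]_n -> R) (c C : R) :
  measurable_fun setT P -> (forall y, `|P y| <= C) ->
  (forall v, \int[mu]_(t in `[0, 1]) P (row_upd v i t) <= c) ->
  cube_mean P <= c.
Proof.
move=> mP PC Pc.
have C0 : 0 <= C by apply: le_trans (PC 0).
have mPv v : measurable_fun setT (fun t : R => P (row_upd v i t)).
  by apply: (measurableT_comp mP); exact: (measurable_row_upd v i).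
have iPv v : mu.-integrable `[0, 1] (EFin \o (fun t : R => P (row_upd v i t))).
  by apply: (@bounded_integrable _ _ _ _ _ _ C) => //; [exact: itv_finite|apply: measurable_funTS; exact: mPv].
have icst e : mu.-integrable `[0, 1] (EFin \o (fun _ : R => e)).
  apply: (@bounded_integrable _ _ _ _ _ _ `|e|) => //.
  exact: itv_finite.
have cC : 0 <= c + C.
  have := Pc 0; have : - C <= \int[mu]_(t in `[0, 1]) P (row_upd 0 i t).
    rewrite [leLHS](_ : _ = \int[mu]_(t in `[0, 1]) (- C)).
      apply: le_Rintegral => //.
      by move=> t _; have := PC (row_upd 0 i t); rewrite ler_norml => /andP[].
    by rewrite Rintegral_itv_cst// subr0 mulr1.
  lra.
have mQ := @measurable_rV_box R n 0 1.
(* The shift by [C] makes both integrands nonnegative, as the comparison along slices requires. *)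
pose F y : \bar R := (\1_(cube n) y * (P y + C))%:E.
pose G (y : 'rV[R]_n) : \bar R := ((\1_(cube n) y : R) * (c + C))%:E.
have mF : measurable_fun setT F.
  apply/measurable_EFinP; apply: measurable_funM; first exact: measurable_indic.
  exact: measurable_funD.
have mG : measurable_fun setT G.
  by apply/measurable_EFinP; apply: measurable_funM => //; exact: measurable_indic.
have PC0 y : 0 <= P y + C.
  by have := PC y; rewrite ler_norml => /andP[]; lra.
have F0 y : (0 <= F y)%E by rewrite lee_fin mulr_ge0.
have G0 y : (0 <= G y)%E by rewrite lee_fin mulr_ge0.
have iP := cube_integrable mP PC.
have iC : (lam n).-integrable (cube n) (EFin \o (fun _ : 'rV[R]_n => C)).
  by apply: (@cube_integrable _ _ C) => // _; rewrite ger0_norm.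
have toR (u : 'rV[R]_n -> R) : (lam n).-integrable (cube n) (EFin \o u) ->
    (\int[lam n]_y (\1_(cube n) y * u y)%:E)%E = (cube_mean u)%:E.
  move=> iu; rewrite /cube_mean EFin_Rintegral// [RHS]integral_mkcond.
  by apply: eq_integral => y _; rewrite patchE indicE; case: ifPn => _ /=; rewrite ?mul1r ?mul0r.
have icC : (lam n).-integrable (cube n) (EFin \o (fun _ : 'rV[R]_n => c + C)).
  by apply: (@cube_integrable _ _ (c + C)) => // _; rewrite ger0_norm.
have iPC : (lam n).-integrable (cube n) (EFin \o (fun y => P y + C)).
  exact: (integrableD mQ iP iC).
have : (\int[lam n]_y F y <= \int[lam n]_y G y)%E.
  apply: (@slice_le_integral _ _ i F G) => // v.
  (* If another coordinate leaves [[0, 1]], the whole line misses the cube and both sides vanish. *)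
  have [vQ|vQ] := pselect (forall j, j != i -> 0 <= v ord0 j <= 1); last first.
    have out t : row_upd v i t \notin cube n.
      apply/negP => /set_mem h; apply: vQ => j ji.
      by have := h j; rewrite mxE (negbTE ji).
    apply: ge0_le_integral => //.
    - by apply: measurableT_comp => //; exact: measurable_row_upd.
    - by apply: measurableT_comp => //; exact: measurable_row_upd.
    - by move=> t _; rewrite /F /G indicE (negbTE (out t)) !mul0r.
  have inQ t : (row_upd v i t \in cube n) = (t \in `[0, 1]%classic).
    apply/idP/idP => /set_mem h; apply/mem_set.
      by have := h i; rewrite mxE eqxx /= in_itv.
    move=> j; rewrite mxE; case: ifPn => [_|/vQ//].
    by move: h; rewrite /= in_itv.
  have sl (u : 'rV[R]_n -> R) :
      (\int[mu]_t (\1_(cube n) (row_upd v i t) * u (row_upd v i t))%:E)%E =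
      (\int[mu]_(t in `[0%R, 1%R]) (u (row_upd v i t))%:E)%E.
    rewrite [RHS]integral_mkcond; apply: eq_integral => t _.
    by rewrite patchE indicE inQ; case: ifPn => _ /=; rewrite ?mul1r ?mul0r.
  rewrite /F /G (sl (fun y => P y + C)) (sl (fun _ => c + C)).
  rewrite -!EFin_Rintegral//; last exact: (integrableD _ (iPv v) (icst C)).
  rewrite lee_fin RintegralD// !Rintegral_itv_cst// subr0 !mulr1.
  by rewrite lerD2r.
rewrite /F /G (toR (fun y => P y + C))// (toR (fun _ => c + C))// lee_fin.
rewrite cube_mean_cst /cube_mean RintegralD// -/(cube_mean P) -/(cube_mean (fun _ => C)).
by rewrite cube_mean_cst lerD2r.
Qed.

End steklov.

Section steklov_average.
Variable R : realType.
Notation mu := (@lebesgue_measure R).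
Notation lam := (@lebesgue_rV R).
Notation cube n := (rV_box n 0 1).

(** Two bounds: [C] holds everywhere and secures integrability, [c] holds on the cube and enters the
    conclusion. *)
Lemma cube_mean_abs_in n (u : 'rV[R]_n -> R) (c C : R) : measurable_fun setT u ->
  (forall y, `|u y| <= C) -> (forall y, cube n y -> `|u y| <= c) -> 0 <= c ->
  `|cube_mean u| <= c.
Proof.
move=> mu' uC uc c0; have C0 : 0 <= C by apply: le_trans (uC 0).
have uM y : `|u y| <= C + c by apply: (le_trans (uC y)); rewrite lerDl.
have cM : `|c| <= C + c by rewrite ger0_norm// lerDr.
rewrite ler_norml; apply/andP; split.
  rewrite -[leLHS](cube_mean_cst n); apply: (@cube_mean_le _ _ _ _ (C + c)) => //.
    by move=> y; rewrite normrN.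
  by move=> y /uc; rewrite ler_norml => /andP[].
rewrite -[leRHS](cube_mean_cst n); apply: (@cube_mean_le _ _ _ _ (C + c)) => //.
by move=> y /uc; rewrite ler_norml => /andP[].
Qed.

Lemma cube_norm n (y : 'rV[R]_n) : cube n y -> `|y| <= 1.
Proof.
by move=> h; apply: rV_norm_le => // i; have /andP[? ?] := h i; rewrite ger0_norm.
Qed.

Lemma measurable_dilate n (d : R) (z : 'rV[R]_n) :
  measurable_fun setT (fun y : 'rV[R]_n => z + d *: y).
Proof.
apply: measurable_fun_rV => j.
apply: (eq_measurable_fun (fun y : 'rV[R]_n => z ord0 j + d * y ord0 j)).
  by move=> y _; rewrite !mxE.
by apply: measurable_funD => //; apply: measurable_funM => //; exact: measurable_coord_rV.
Qed.

Lemma measurable_dilate_upd n (d : R) i :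
  measurable_fun setT (fun p : 'rV[R]_n * 'rV[R]_n => p.1 + d *: row_upd p.2 i 0).
Proof.
apply: measurable_fun_rV => j.
apply: (eq_measurable_fun (fun p : 'rV[R]_n * 'rV[R]_n =>
  p.1 ord0 j + d * (if j == i then 0 else p.2 ord0 j))).
  by move=> y _; rewrite !mxE.
apply: measurable_funD.
  apply: (@measurableT_comp _ _ _ _ _ _ (fun v : 'rV[R]_n => v ord0 j : measurableTypeR R)).
    exact: measurable_coord_rV.
  exact: measurable_fst.
apply: measurable_funM => //; case: (j == i) => //.
apply: (@measurableT_comp _ _ _ _ _ _ (fun v : 'rV[R]_n => v ord0 j : measurableTypeR R)).
  exact: measurable_coord_rV.
exact: measurable_snd.
Qed.

Variables (n : nat) (F : 'rV[R]_n -> R) (L B d : R).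
Hypotheses (L0 : 0 <= L) (d0 : 0 < d).
Hypothesis Fl : forall x y, `|F x - F y| <= L * `|x - y|.
Hypothesis FB : forall x, `|F x| <= B.

(** The average is one-sided, over [z + [0, d]^n]: coordinates only grow, so a box is enlarged at
    its upper end alone and stays away from 0. *)
Definition steklov (z : 'rV[R]_n) : R := cube_mean (fun y => F (z + d *: y)).

(* Averaging over coordinate i turns the i-th derivative into a difference quotient,
   whose remaining argument no longer involves y_i. *)
Definition steklov_d (i : 'I_n) (z : 'rV[R]_n) : R :=
  cube_mean (fun y => diff_quot F i d (z + d *: row_upd y i 0)).

Let cF : continuous F. Proof. exact: lipschitz_continuous_rV Fl. Qed.
Let mF : measurable_fun setT F. Proof. exact: continuous_measurable_rV. Qed.
Let mFd z : measurable_fun setT (fun y : 'rV[R]_n => F (z + d *: y)).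
Proof. by apply: measurableT_comp => //; exact: measurable_dilate. Qed.
Let mq i : measurable_fun setT (diff_quot F i d).
Proof. by apply: continuous_measurable_rV; exact: continuous_diff_quot. Qed.
Let mqp i : measurable_fun setT
  (fun p : 'rV[R]_n * 'rV[R]_n => diff_quot F i d (p.1 + d *: row_upd p.2 i 0)).
Proof. by apply: (measurableT_comp (mq i)); exact: measurable_dilate_upd. Qed.
Let mqd i z : measurable_fun setT (fun y : 'rV[R]_n => diff_quot F i d (z + d *: row_upd y i 0)).
Proof. exact: (measurableT_comp (mqp i) (@pair1_measurable _ _ _ _ z)). Qed.
Let qL i z : `|diff_quot F i d z| <= L. Proof. exact: diff_quot_bound. Qed.

Lemma steklov_close z : `|steklov z - F z| <= L * d.
Proof.
have -> : steklov z - F z = cube_mean (fun y => F (z + d *: y) - F z).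
  by rewrite (@cube_meanB _ _ _ _ B) ?cube_mean_cst.
apply: (@cube_mean_abs_in _ _ _ (B + B)).
- exact: measurable_funB.
- by move=> y; apply: (le_trans (ler_normB _ _)); rewrite lerD.
- move=> y yQ; apply: (le_trans (Fl _ _)); rewrite ler_wpM2l// addrAC subrr add0r.
  rewrite normrZ gtr0_norm// ler_piMr//; [exact: ltW|exact: cube_norm].
- by rewrite mulr_ge0// ltW.
Qed.

Lemma steklov_bound z : `|steklov z| <= B.
Proof. exact: cube_mean_abs. Qed.

Lemma steklov_lip x z : `|steklov x - steklov z| <= L * `|x - z|.
Proof.
have -> : steklov x - steklov z = cube_mean (fun y => F (x + d *: y) - F (z + d *: y)).
  by rewrite (@cube_meanB _ _ _ _ B).
apply: cube_mean_abs; first exact: measurable_funB.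
move=> y; apply: (le_trans (Fl _ _)).
by rewrite opprD addrACA subrr addr0.
Qed.

Lemma steklov_d_bound i z : `|steklov_d i z| <= L.
Proof. exact: cube_mean_abs. Qed.

Lemma diff_quot_lip i x z : `|diff_quot F i d x - diff_quot F i d z| <= 2 * (L / d) * `|x - z|.
Proof.
rewrite /diff_quot -mulrBr normrM gtr0_norm ?invr_gt0//.
rewrite [leRHS](_ : _ = d^-1 * (L * `|x - z| + L * `|x - z|)); last by field; rewrite gt_eqF.
rewrite ler_wpM2l ?invr_ge0 ?(ltW d0)//.
rewrite (_ : _ - _ = (F (d *: delta_mx ord0 i + x) - F (d *: delta_mx ord0 i + z)) - (F x - F z)); last by ring.
apply: (le_trans (ler_normB _ _)); apply: lerD => //.
by apply: (le_trans (Fl _ _)); rewrite opprD addrACA subrr add0r.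
Qed.

Lemma steklov_d_lip i x z : `|steklov_d i x - steklov_d i z| <= 2 * (L / d) * `|x - z|.
Proof.
have -> : steklov_d i x - steklov_d i z = cube_mean (fun y =>
    diff_quot F i d (x + d *: row_upd y i 0) - diff_quot F i d (z + d *: row_upd y i 0)).
  by rewrite (@cube_meanB _ _ _ _ L).
apply: cube_mean_abs; first exact: measurable_funB.
move=> y; apply: (le_trans (diff_quot_lip _ _ _)).
by rewrite opprD addrACA subrr addr0.
Qed.

(** On each line in direction [i] this is the one-dimensional estimate with Lipschitz constant [L d]
    and shift [r / d], and [4 (L d) (r / d)^2 = 4 (L / d) r^2]. *)
Lemma steklov_step i (r : R) z :
  `|steklov (r *: delta_mx ord0 i + z) - steklov z - r * steklov_d i z| <= 4 * (L / d) * r ^+ 2.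
Proof.
set c := 4 * (L / d) * r ^+ 2.
pose P (y : 'rV[R]_n) := F (r *: delta_mx ord0 i + z + d *: y) - F (z + d *: y) -
  r * diff_quot F i d (z + d *: row_upd y i 0).
have mP : measurable_fun setT P.
  by apply: measurable_funB; [exact: measurable_funB|exact: measurable_funM].
have PC y : `|P y| <= B + B + `|r| * L.
  apply: (le_trans (ler_normB _ _)); apply: lerD.
    by apply: (le_trans (ler_normB _ _)); rewrite lerD.
  by rewrite normrM ler_wpM2l.
have -> : steklov (r *: delta_mx ord0 i + z) - steklov z - r * steklov_d i z = cube_mean P.
  rewrite (@cube_meanB _ _ _ _ (B + B + `|r| * L)).
  - by rewrite (@cube_meanB _ _ _ _ B)// (@cube_meanZ _ _ _ _ L).
  - exact: measurable_funB.
  - exact: measurable_funM.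
  - move=> y; apply: (@le_trans _ _ (B + B)).
      by apply: (le_trans (ler_normB _ _)); rewrite lerD.
    by rewrite lerDl mulr_ge0.
  - move=> y; rewrite normrM; apply: (@le_trans _ _ (`|r| * L)); first by rewrite ler_wpM2l.
    by rewrite lerDr addr_ge0// (le_trans _ (FB 0)).
have Pv v : `|\int[mu]_(t in `[0, 1]) P (row_upd v i t)| <= c.
  pose q t := F (z + d *: row_upd v i t).
  have ql x y : `|q x - q y| <= L * d * `|x - y|.
    apply: (le_trans (Fl _ _)); rewrite -mulrA ler_wpM2l// !row_updE.
    rewrite opprD addrACA subrr add0r -scalerBr opprD addrACA subrr addr0 -scalerBl.
    rewrite opprB addrA subrK normrZ gtr0_norm// ler_pM2l//.
    exact: norm_scale_delta.
  have qB t : `|q t| <= B by exact: FB.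
  have Ld0 : 0 <= L * d by rewrite mulr_ge0// ltW.
  have := steklov1 (r / d) Ld0 ql (fun t => FB _).
  rewrite (_ : 4 * (L * d) * _ = c); last by rewrite /c; field; rewrite gt_eqF.
  apply: le_trans.
  have mq' : measurable_fun setT (q : R -> R).
    by apply: continuous_measurable_fun; exact: lipschitz_continuous_real ql.
  have iB (u : R -> R) (D : R) : measurable_fun setT u -> (forall t, `|u t| <= D) ->
      mu.-integrable `[0, 1] (EFin \o u).
    move=> mu' uD; apply: (@bounded_integrable _ _ _ _ _ _ D) => //.
      exact: itv_finite.
    exact: measurable_funTS.
  have mqs : measurable_fun setT (fun t : R => q (t + r / d)).
    by apply: measurableT_comp => //; exact: measurable_funD.
  have -> : \int[mu]_(t in `[0, 1]) P (row_upd v i t) =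
      \int[mu]_(t in `[0, 1]) (q (t + r / d) - q t - (r / d) * (q 1 - q 0)).
    apply: eq_Rintegral => t _; rewrite /P /q; congr (F _ - _ - _).
      apply/rowP => j; rewrite !mxE ?eqxx; case: (j == i) => /=; last by ring.
      by field; rewrite gt_eqF.
    rewrite /diff_quot mulrA; congr (_ * (F _ - F _)).
      by apply/rowP => j; rewrite !mxE ?eqxx; case: (j == i) => /=; ring.
    by congr (_ + _ *: _); apply/rowP => j; rewrite !mxE; case: (j == i).
  rewrite RintegralB//.
  - rewrite RintegralB//; [|exact: (iB _ B)|exact: (iB _ B)].
    by rewrite Rintegral_itv_cst// subr0 mulr1.
  - apply: (iB _ (B + B)); first exact: measurable_funB.
    by move=> t; apply: (le_trans (ler_normB _ _)); rewrite lerD ?FB.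
  - exact: (iB _ `|(r / d) * (q 1 - q 0)|).
rewrite ler_norml; apply/andP; split; last first.
  by apply: (cube_mean_slice_le mP PC (i := i)) => v; have := Pv v; rewrite ler_norml => /andP[].
rewrite lerNl.
have <- : cube_mean (fun y => - P y) = - cube_mean P.
  rewrite -mulN1r -(cube_meanZ (-1) mP PC); congr cube_mean.
  by apply/funext => y; rewrite mulN1r.
apply: (@cube_mean_slice_le _ _ i _ _ (B + B + `|r| * L)).
- exact: measurable_funN.
- by move=> y; rewrite normrN.
- move=> v; have := Pv v; rewrite ler_norml => /andP[+ _].
  rewrite lerNl => h; apply: le_trans h.
  rewrite -mulN1r -RintegralZl//.
    by rewrite le_eqVlt; apply/orP; left; apply/eqP; apply: eq_Rintegral => t _; rewrite mulN1r.
  apply: (@bounded_integrable _ _ _ _ _ _ (B + B + `|r| * L)) => //.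
    exact: itv_finite.
  by apply: measurable_funTS; apply: (measurableT_comp mP); exact: (measurable_row_upd v i).
Qed.

(** Coordinates are changed one at a time. Each change costs [4 (L / d) h_i^2], and moving its slope
    back to [z] costs [2 (L / d) |h_i| sqrt S <= (L / d) (h_i^2 + S)], where [S] is the sum of the
    [h_i^2]. The total is [(5 + n) (L / d) S]. *)
Lemma steklov_taylor z h :
  `|steklov (z + h) - steklov z - \sum_i h ord0 i * steklov_d i z| <=
  (6 + 2 * n%:R) * (L / d) * \sum_i h ord0 i ^+ 2.
Proof.
pose S := \sum_i h ord0 i ^+ 2.
have Ld : 0 <= L / d by rewrite divr_ge0// ltW.
(* [D j] carries the first [j] coordinates of [h], so consecutive points differ in one
   coordinate. *)
pose D (j : nat) : 'rV[R]_n := \row_l (if (l < j)%N then h ord0 l else 0).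
have D0 : D 0%N = 0 by apply/rowP => l; rewrite !mxE.
have Dn : D n = h by apply/rowP => l; rewrite !mxE ltn_ord.
have DS (i : 'I_n) : D i.+1 = h ord0 i *: delta_mx ord0 i + D i.
  apply/rowP => l; rewrite !mxE eqxx/= ltnS leq_eqVlt val_eqE.
  case: eqVneq => [->|_]; first by rewrite ltnn mulr1 addr0.
  by rewrite mulr0 add0r.
have S0 : 0 <= S by apply: sumr_ge0 => i _; exact: sqr_ge0.
have hS i : h ord0 i ^+ 2 <= S.
  by rewrite /S (bigD1 i)//= lerDl sumr_ge0// => l _; exact: sqr_ge0.
have DN j : `|D j| <= Num.sqrt S.
  apply: rV_norm_le => [|l]; first exact: sqrtr_ge0.
  rewrite !mxE; case: ifP => _; last by rewrite normr0 sqrtr_ge0.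
  by rewrite -sqrtr_sqr ler_wsqrtr.
have -> : steklov (z + h) - steklov z = \sum_(i < n) (steklov (z + D i.+1) - steklov (z + D i)).
  rewrite -[in LHS]Dn -[in steklov z](addr0 z) -D0.
  rewrite -(telescope_sumr (fun j => steklov (z + D j)) (leq0n n)) big_mkord//.
rewrite -sumrB; apply: (le_trans (ler_norm_sum _ _ _)).
have step (i : 'I_n) : `|steklov (z + D i.+1) - steklov (z + D i) - h ord0 i * steklov_d i z| <=
    4 * (L / d) * h ord0 i ^+ 2 + (L / d) * (h ord0 i ^+ 2 + S).
  rewrite (_ : _ - _ = (steklov (z + D i.+1) - steklov (z + D i) - h ord0 i * steklov_d i (z + D i)) +
    h ord0 i * (steklov_d i (z + D i) - steklov_d i z)); last by ring.
  apply: (le_trans (ler_normD _ _)); apply: lerD.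
    by rewrite DS addrCA; exact: steklov_step.
  rewrite normrM; apply: (@le_trans _ _ (`|h ord0 i| * (2 * (L / d) * Num.sqrt S))).
    rewrite ler_wpM2l//; apply: (le_trans (steklov_d_lip _ _ _)).
    by rewrite addrAC subrr add0r ler_wpM2l// mulr_ge0.
  rewrite (_ : `|h ord0 i| * _ = (L / d) * (2 * `|h ord0 i| * Num.sqrt S)); last by ring.
  rewrite ler_wpM2l// -{2}(sqr_sqrtr S0) -subr_ge0 -(real_normK (num_real (h ord0 i))).
  by rewrite (_ : _ - _ = (`|h ord0 i| - Num.sqrt S) ^+ 2) ?sqr_ge0//; ring.
apply: (le_trans (ler_sum _ (fun i _ => step i))).
rewrite big_split/= -!mulr_sumr -/S big_split/= -/S sumr_const card_ord.
rewrite -[S *+ n]mulr_natl -subr_ge0.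
rewrite (_ : _ - _ = (1 + n%:R) * (L / d) * S); last by ring.
by rewrite !mulr_ge0 ?invr_ge0 ?addr_ge0 ?(ltW d0).
Qed.

(** Jensen for the mean that defines [steklov_d], then Tonelli, then [energy_diff_quot] for each
    point [y] of the cube, the shift being [d y] with its [i]-th coordinate set to 0. *)
Lemma steklov_energy i (a b eta A : R) (alpha : 'rV[R]_n -> R) :
  0 <= eta -> measurable_fun setT alpha -> (forall z, 0 <= alpha z) ->
  (forall z, rV_box n a (b + d) z -> alpha z <= A) ->
  (forall z c, rV_box n a b z -> rV_box n 0 d c -> alpha z <= (1 + eta) * alpha (z + c)) ->
  (\int[lam n]_(z in rV_box n a b) (alpha z * steklov_d i z ^+ 2)%:E <=
   (1 + eta)%:E * \int[lam n]_(z in rV_box n a (b + d)) (alpha z * partial_ae F i z ^+ 2)%:E)%E.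
Proof.
move=> eta0 malpha alpha0 alphaA osc.
set X := ((1 + eta)%:E * _)%E.
have X0 : (0 <= X)%E.
  rewrite mule_ge0 ?lee_fin ?addr_ge0//; apply: integral_ge0 => z _.
  by rewrite lee_fin mulr_ge0 ?sqr_ge0.
have mK := @measurable_rV_box R n a b.
have mQ := @measurable_rV_box R n 0 1.
pose f (p : 'rV[R]_n * 'rV[R]_n) : R := \1_(rV_box n a b) p.1 * (\1_(cube n) p.2 *
  (alpha p.1 * diff_quot F i d (p.1 + d *: row_upd p.2 i 0) ^+ 2)).
have f0 p : (0 <= (EFin \o f) p)%E by rewrite /= lee_fin /f; do 3 (apply: mulr_ge0 => //); exact: sqr_ge0.
have mf : measurable_fun setT (EFin \o f).
  apply/measurable_EFinP; apply: measurable_funM.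
    apply: (@measurableT_comp _ _ _ _ _ _ (\1_(rV_box n a b) : 'rV[R]_n -> R)) => //; exact: measurable_fst.
  apply: measurable_funM.
    apply: (@measurableT_comp _ _ _ _ _ _ (\1_(cube n) : 'rV[R]_n -> R)) => //; exact: measurable_snd.
  apply: measurable_funM; first by apply: (measurableT_comp malpha); exact: measurable_fst.
  by apply: measurable_funX; apply: mqp.
have msd : measurable_fun setT (steklov_d i).
  apply: continuous_measurable_rV; apply: lipschitz_continuous_rV; exact: steklov_d_lip.
have mq2 z : measurable_fun setT (fun y : 'rV[R]_n => diff_quot F i d (z + d *: row_upd y i 0) ^+ 2).
  exact: measurable_funX.
apply: (@le_trans _ _ (\int[lam n]_z \int[lam n]_y (EFin \o f) (z, y))%E).
  rewrite integral_mkcond; apply: ge0_le_integral => //.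
  - by move=> z _; rewrite patchE; case: ifPn => // _; rewrite lee_fin mulr_ge0 ?sqr_ge0.
  - apply/(measurable_restrictT _ _).1 => //; apply/measurable_EFinP/measurable_funTS.
    by apply: measurable_funM => //; exact: measurable_funX.
  - exact: measurable_fun_fubini_tonelli_F.
  - move=> z _; rewrite patchE; case: ifPn => [zK|_]; last exact: integral_ge0.
    have -> : (\int[lam n]_y (EFin \o f) (z, y) =
        (alpha z)%:E * \int[lam n]_(y in cube n) (diff_quot F i d (z + d *: row_upd y i 0) ^+ 2)%:E)%E.
      have hm : measurable_fun (cube n) (fun y => (diff_quot F i d (z + d *: row_upd y i 0) ^+ 2)%:E).
        by apply/measurable_EFinP; apply: measurable_funTS; exact: mq2.
      have h0 y : cube n y -> (0 <= (diff_quot F i d (z + d *: row_upd y i 0) ^+ 2)%:E)%E.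
        by rewrite lee_fin sqr_ge0.
      have a0 : (0 <= (alpha z)%:E)%E by rewrite lee_fin.
      rewrite -ge0_integralZl//.
      rewrite [RHS]integral_mkcond; apply: eq_integral => y _.
      by rewrite patchE /f /= !indicE zK mul1r; case: ifPn => _ /=; rewrite ?mul1r ?mul0r.
    rewrite EFinM lee_wpmul2l ?lee_fin//.
    have q2 y : `|diff_quot F i d (z + d *: row_upd y i 0) ^+ 2| <= L ^+ 2.
      by rewrite normrX lerXn2r ?nnegrE.
    rewrite -EFin_Rintegral//; last exact: (cube_integrable _ q2).
    rewrite lee_fin; exact: (cube_mean_sqr _ (fun y => qL i _)).
rewrite (@fubini_tonelli _ _ _ _ R (lam n) (lam n) _ mf f0).
apply: (@le_trans _ _ (\int[lam n]_y ((\1_(cube n) y)%:E * X))%E); last first.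
  rewrite ge0_integralZr//; last exact/measurable_EFinP.
  by rewrite integral_indic// setIT /= cube_measure mul1e.
apply: ge0_le_integral => //.
- by move=> y _; exact: integral_ge0.
- exact: measurable_fun_fubini_tonelli_G.
- by apply: emeasurable_funM => //; exact/measurable_EFinP.
move=> y _; rewrite indicE; have [yQ|yQ] := boolP (y \in cube n); last first.
  rewrite mul0e integral0_eq// => z _; by rewrite /f /= !indicE (negbTE yQ) /= mul0r mulr0.
rewrite mul1e.
have yQ' := set_mem yQ.
have -> : (\int[lam n]_z (EFin \o f) (z, y) =
    \int[lam n]_(z in rV_box n a b) (alpha z * diff_quot F i d (z + d *: row_upd y i 0) ^+ 2)%:E)%E.
  rewrite [RHS]integral_mkcond; apply: eq_integral => z _.
  by rewrite patchE /f /= !indicE yQ mul1r; case: ifPn => _ /=; rewrite ?mul1r ?mul0r.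
apply: (@energy_diff_quot _ _ _ _ L a b d eta A) => //.
  move=> j; rewrite !mxE; case: (j == i); first by rewrite mulr0 lexx ltW.
  have /andP[y0 y1] := yQ' j.
  by rewrite mulr_ge0 ?(ltW d0)//= ger_pMr.
by rewrite !mxE eqxx mulr0.
Qed.

End steklov_average.

(** * Scalar estimates *)

Section scalar_estimate.
Variable R : realType.

Lemma powR_continuous_pos (r x : R) : 0 < x -> {for x, continuous (fun x => x `^ r)}.
Proof.
move=> x0; apply/differentiable_continuous/derivable1_diffP.
by have [] := is_derive1_powR r x0.
Qed.

Lemma powR_mvt (r x y : R) : 0 < x -> x <= y ->
  exists2 t, x <= t <= y & y `^ r - x `^ r = r * t `^ (r - 1) * (y - x).
Proof.
move=> x0 xy.
have [||t txy ->] := @MVT_segment R (fun x => x `^ r) (fun t => r * t `^ (r - 1)) x y xy.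
- move=> t; rewrite in_itv/= => /andP[xt _]; apply: is_derive1_powR; exact: lt_trans xt.
- apply: continuous_in_subspaceT => t; rewrite inE/= in_itv/= => /andP[xt _].
  by apply: powR_continuous_pos; exact: lt_le_trans xt.
by exists t => //; move: txy; rewrite in_itv.
Qed.

Lemma powR_bounded_itv (r p q : R) : 0 < p -> p <= q ->
  exists2 T, 0 <= T & forall t, p <= t <= q -> t `^ r <= T.
Proof.
move=> p0 pq; have [|c _ cT] := @EVT_max R (fun x => x `^ r) p q pq.
  apply: continuous_in_subspaceT => t; rewrite inE/= in_itv/= => /andP[pt _].
  by apply: powR_continuous_pos; exact: lt_le_trans pt.
exists (c `^ r); first exact: powR_ge0.
by move=> t tpq; apply: cT; rewrite in_itv.
Qed.

(** With [z] the midpoint and [d] the half-difference, [x y / z^2 = 1 - (d / z)^2]; then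
    [ln (1 + t) <= t]. *)
Lemma ln_mid_le (x y : R) : 0 < x -> 0 < y ->
  ln x + ln y - 2 * ln ((x + y) / 2) <= - (((x - y) / 2) ^+ 2 / ((x + y) / 2) ^+ 2).
Proof.
move=> x0 y0; set z := (x + y) / 2.
have z0 : 0 < z by rewrite divr_gt0// addr_gt0.
have -> : ln x + ln y - 2 * ln z = ln (x * y / (z * z)).
  have xyp : 0 < x * y by rewrite mulr_gt0.
  have zzp : 0 < z * z by rewrite mulr_gt0.
  have e1 : ln (x * y) = ln x + ln y by apply: lnM.
  have e2 : ln (z * z) = ln z + ln z by apply: lnM.
  have -> : ln (x * y / (z * z)) = ln (x * y) - ln (z * z) by apply: ln_div.
  by rewrite e1 e2; ring.
have -> : x * y / (z * z) = 1 + (- (((x - y) / 2) ^+ 2 / z ^+ 2)).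
  by rewrite /z; field; rewrite gt_eqF// addr_gt0.
apply: le_ln1Dx.
have : 0 < x * y / (z * z) by rewrite divr_gt0// mulr_gt0.
rewrite (_ : x * y / (z * z) = 1 + (- (((x - y) / 2) ^+ 2 / z ^+ 2))); first lra.
by rewrite /z; field; rewrite gt_eqF// addr_gt0.
Qed.

(* The slack is w/c (e k z P g - (c/w) (d/z))^2. *)
Lemma weighted_amgm (c w z e k P d g : R) : 0 < c -> 0 < w -> 0 < z ->
  2 * e * k * P * d * g - c / w * (d ^+ 2 / z ^+ 2) <=
  e ^+ 2 * w * (k ^+ 2 / c * (z * P) ^+ 2 * g ^+ 2).
Proof.
move=> c0 w0 z0; rewrite -subr_ge0.
have cE : c != 0 by rewrite gt_eqF.
have wE : w != 0 by rewrite gt_eqF.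
have zE : z != 0 by rewrite gt_eqF.
have -> : e ^+ 2 * w * (k ^+ 2 / c * (z * P) ^+ 2 * g ^+ 2) -
    (2 * e * k * P * d * g - c / w * (d ^+ 2 / z ^+ 2)) =
    w / c * (e * k * (z * P) * g - c / w * (d / z)) ^+ 2.
  by field; apply/and3P.
by rewrite mulr_ge0 ?sqr_ge0// divr_ge0// ltW.
Qed.

(** By the mean value theorem [x^k - y^k = 2 k t^(k-1) d] for some [t] between [x] and [y].
    Replacing [t] by the midpoint and bounding the terms with [C] leaves an error [e N d^2]. A share
    [eta / (1 + eta)] of the logarithmic term absorbs it when [e] is small; the remaining share
    enters [weighted_amgm] with [w = 1 + eta]. *)
Lemma coord_estimate (k a b C L eta : R) : 1 < k -> 0 < a -> a < b ->
  0 <= C -> 0 <= L -> 0 < eta ->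
  exists2 e0, 0 < e0 & forall e, 0 < e <= e0 -> forall x y g, 0 < x -> 0 < y ->
    `|g| <= L -> a <= x `^ k <= b -> a <= y `^ k <= b ->
    e * ((x `^ k - y `^ k) * g + C * ((x `^ k - ((x + y) / 2) `^ k) ^+ 2 +
                                      (y `^ k - ((x + y) / 2) `^ k) ^+ 2)) +
    (k - 1) * (ln x + ln y - 2 * ln ((x + y) / 2)) <=
    e ^+ 2 * (1 + eta) * (k ^+ 2 / (k - 1) * (((x + y) / 2) `^ k) ^+ 2 * g ^+ 2).
Proof.
move=> k1 a0 ab C0 L0 eta0.
have k0 : 0 < k by exact: lt_trans k1.
have b0 := lt_trans a0 ab.
pose p := a `^ k^-1; pose q := b `^ k^-1.
have p0 : 0 < p by rewrite powR_gt0.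
have q0 : 0 < q by rewrite powR_gt0.
have pq : p <= q by rewrite ltW// ltr_powR_mono ?invr_gt0// ltW.
have [T1 T10 hT1] := powR_bounded_itv (k - 1) p0 pq.
have [T2 T20 hT2] := powR_bounded_itv (k - 1 - 1) p0 pq.
have km1 : 0 < k - 1 by rewrite subr_gt0.
(* The first summand pays for moving [t^(k-1)] to the midpoint, the second for the two squares
   multiplied by [C]. *)
pose N := 2 * k * (k - 1) * T2 * L + 2 * C * (k * T1) ^+ 2.
have N0 : 0 <= N by rewrite addr_ge0// !mulr_ge0// ?sqr_ge0// ltW.
have eta1 : 0 < 1 + eta by rewrite addr_gt0.
(* Chosen so that [e N q^2 <= (k - 1) eta / (1 + eta)] for [e <= e0]; [N + 1] keeps the denominator
   positive. *)
pose e0 := (k - 1) * eta / ((1 + eta) * (N + 1) * q ^+ 2).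
have e00 : 0 < e0.
  by rewrite divr_gt0 ?mulr_gt0 ?exprn_gt0// ltr_wpDl.
exists e0 => // e /andP[e_gt0 ee0] x y g x0 y0 gL xab yab.
(* Exchanging [x] and [y] while negating [g] leaves the inequality unchanged. *)
wlog yx : x y g x0 y0 gL xab yab / y <= x.
  move=> H; have [yx|/ltW xy] := leP y x; first exact: H.
  have := H y x (- g) y0 x0; rewrite normrN sqrrN [y + x]addrC => /(_ gL yab xab xy).
  by apply: le_trans; rewrite le_eqVlt; apply/orP; left; apply/eqP; ring.
have inpq t : 0 < t -> a <= t `^ k <= b -> p <= t <= q.
  move=> t0 /andP[at_ tb]; apply/andP; split.
    by rewrite /p ler_root// ltW.
  rewrite leNgt; apply/negP => qt; move: qt.
  rewrite -(ltr_powR_mono k0 (ltW q0) (ltW t0)).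
  by rewrite /q powRVK ?(ltW b0)// ltNge tb.
have /andP[px xq] := inpq _ x0 xab; have /andP[py yq] := inpq _ y0 yab.
set z := (x + y) / 2; set d := (x - y) / 2.
have d0 : 0 <= d by rewrite divr_ge0// subr_ge0.
have xE : x = z + d by rewrite /z /d; field.
have yE : y = z - d by rewrite /z /d; field.
have z0 : 0 < z by rewrite divr_gt0// addr_gt0.
have yz : y <= z by lra.
have zx : z <= x by lra.
have [t /andP[yt tx] xyt] := powR_mvt k y0 yx.
have [t1 /andP[zt1 t1x] xzt] := powR_mvt k z0 zx.
have [t2 /andP[yt2 t2z] zyt] := powR_mvt k y0 yz.
have tz : `|t `^ (k - 1) - z `^ (k - 1)| <= (k - 1) * T2 * d.
  have t0 : 0 < t by exact: lt_le_trans yt.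
  have [zt|/ltW tz] := leP z t.
    have [s /andP[zs st] ->] := powR_mvt (k - 1) z0 zt.
    rewrite ger0_norm; last by rewrite !mulr_ge0 ?powR_ge0 ?subr_ge0// ltW.
    apply: ler_pM; rewrite ?mulr_ge0 ?powR_ge0 ?(ltW km1) ?subr_ge0//; last first.
      by clear -tx xE; lra.
    by rewrite ler_pM2l// hT2//; apply/andP; split; clear -zs st tx xq py yz; lra.
  have [s /andP[ts sz] e1] := powR_mvt (k - 1) t0 tz.
  rewrite distrC e1.
  rewrite ger0_norm; last by rewrite !mulr_ge0 ?powR_ge0 ?subr_ge0// ltW.
  apply: ler_pM; rewrite ?mulr_ge0 ?powR_ge0 ?(ltW km1) ?subr_ge0//; last first.
    by clear -yt yE; lra.
  by rewrite ler_pM2l// hT2//; apply/andP; split; clear -ts sz yt py zx xq; lra.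
pose P := z `^ (k - 1).
have P0 : 0 <= P by exact: powR_ge0.
have zk : z `^ k = z * P by rewrite /P mulr_powRB1// ltW.
have sq t' c : 0 <= c <= d -> p <= t' <= q -> (k * t' `^ (k - 1) * c) ^+ 2 <= (k * T1) ^+ 2 * d ^+ 2.
  move=> /andP[c0 cd] /hT1 tT; rewrite -exprMn lerXn2r ?nnegrE//.
  - by rewrite !mulr_ge0 ?powR_ge0// ltW.
  - by rewrite mulr_ge0// mulr_ge0// ltW.
  - by rewrite ler_pM ?mulr_ge0 ?powR_ge0 ?(ltW k0)// ler_pM2l.
have h1 : (x `^ k - z `^ k) ^+ 2 <= (k * T1) ^+ 2 * d ^+ 2.
  rewrite xzt; apply: sq; apply/andP; split.
  - by clear -zx; lra.
  - by clear -xE; lra.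
  - by clear -zt1 py yz; lra.
  - by clear -t1x xq; lra.
have h2 : (y `^ k - z `^ k) ^+ 2 <= (k * T1) ^+ 2 * d ^+ 2.
  rewrite -sqrrN opprB zyt; apply: sq; apply/andP; split.
  - by clear -yz; lra.
  - by clear -yE; lra.
  - by clear -yt2 py; lra.
  - by clear -t2z zx xq; lra.
have h3 : (x `^ k - y `^ k) * g <= 2 * k * P * d * g + 2 * k * (k - 1) * T2 * L * d ^+ 2.
  have -> : (x `^ k - y `^ k) * g = 2 * k * P * d * g + 2 * k * d * ((t `^ (k - 1) - P) * g).
    have dE : x - y = 2 * d by rewrite /d; field.
    rewrite xyt dE /P.
    ring.
  rewrite lerD2l (_ : 2 * k * (k - 1) * T2 * L * d ^+ 2 = 2 * k * d * ((k - 1) * T2 * d * L)); last by ring.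
  have n2 : 0 <= 2 * k * d by apply: mulr_ge0 => //; apply: mulr_ge0 => //; exact: ltW.
  rewrite ler_wpM2l//.
  apply: (le_trans (ler_norm _)); rewrite normrM ler_pM//.
have h4 : (k - 1) * (ln x + ln y - 2 * ln z) <= - ((k - 1) * (d ^+ 2 / z ^+ 2)).
  by rewrite -[leRHS]mulrN; apply: ler_wpM2l; [exact: ltW | exact: ln_mid_le].
have h5 : e * N * d ^+ 2 <= (k - 1) * eta / (1 + eta) * (d ^+ 2 / z ^+ 2).
  have zq : z ^+ 2 <= q ^+ 2 by rewrite lerXn2r ?nnegrE ?(ltW z0) ?(ltW q0)//; clear -zx xq; lra.
  rewrite [leRHS]mulrA ler_pdivlMr ?exprn_gt0// [leLHS]mulrAC ler_wpM2r ?sqr_ge0//.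
  apply: (@le_trans _ _ (e0 * (N + 1) * q ^+ 2)).
    have eN : e * N <= e0 * (N + 1) by apply: ler_pM => //; [exact: ltW|rewrite lerDl].
    by apply: ler_pM; rewrite ?sqr_ge0// mulr_ge0// ltW.
  rewrite /e0 le_eqVlt; apply/orP; left; apply/eqP; field.
  by rewrite !gt_eqF// ltr_wpDl.
have h6 : 2 * e * k * P * d * g - (k - 1) / (1 + eta) * (d ^+ 2 / z ^+ 2) <=
    e ^+ 2 * (1 + eta) * (k ^+ 2 / (k - 1) * (z `^ k) ^+ 2 * g ^+ 2).
  by rewrite zk; exact: weighted_amgm.
have h7 : e * ((x `^ k - y `^ k) * g + C * ((x `^ k - z `^ k) ^+ 2 + (y `^ k - z `^ k) ^+ 2)) <=
    e * (2 * k * P * d * g + N * d ^+ 2).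
  rewrite ler_pM2l//.
  have : C * ((x `^ k - z `^ k) ^+ 2 + (y `^ k - z `^ k) ^+ 2) <=
      C * ((k * T1) ^+ 2 * d ^+ 2 + (k * T1) ^+ 2 * d ^+ 2) by rewrite ler_wpM2l// lerD.
  by move=> u; rewrite /N; clear -u h3; lra.
have h8 : (k - 1) * (d ^+ 2 / z ^+ 2) = (k - 1) * eta / (1 + eta) * (d ^+ 2 / z ^+ 2) +
    (k - 1) / (1 + eta) * (d ^+ 2 / z ^+ 2).
  by field; rewrite !gt_eqF.
clear -h4 h5 h6 h7 h8; lra.
Qed.

(** By a difference of squares, right minus left in the hypothesis equals [e^2 (e Rm - d)], with [d]
    the supposed gap and [Rm] bounded, so a small [e] makes it negative. The errors [e^3 D] and
    [e^4 D] are those of the exponentials on the two sides. *)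
Lemma quadratic_limit (M A S1 S2 D e0 : R) : 0 < M -> 0 <= D -> 0 < e0 ->
  (forall e, 0 < e <= e0 -> e <= 1 ->
    0 <= M + e * S1 + e ^+ 2 / 2 * S2 - e ^+ 3 * D ->
    0 <= M - e * S1 + e ^+ 2 / 2 * S2 - e ^+ 3 * D ->
    (M + e * S1 + e ^+ 2 / 2 * S2 - e ^+ 3 * D) *
    (M - e * S1 + e ^+ 2 / 2 * S2 - e ^+ 3 * D) <=
    (M + e ^+ 2 / 2 * A + e ^+ 4 * D) ^+ 2) ->
  M * S2 - S1 ^+ 2 <= M * A.
Proof.
move=> M0 D0 e00 H; rewrite leNgt; apply/negP => lt.
pose d := M * S2 - S1 ^+ 2 - M * A.
have d0 : 0 < d by rewrite subr_gt0.
pose U := `|A| + `|S2| + D.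
have U0 : 0 <= U by rewrite !addr_ge0.
pose N := 2 * D * (2 * M + U) + U * U + 1.
have N0 : 0 < N.
  by rewrite ltr_wpDl// addr_ge0// ?mulr_ge0// ?addr_ge0// mulr_ge0// ltW.
pose W := `|S1| + `|S2| + D + 1.
have W0 : 0 < W by rewrite ltr_wpDl// !addr_ge0.
(* [M / W] keeps both factors on the left nonnegative, and [d / (2 N)] forces [e Rm <= d / 2]. *)
pose e := Num.min (Num.min e0 1) (Num.min (d / (2 * N)) (M / W)).
have e_gt0 : 0 < e by rewrite !lt_min e00 ltr01/= !divr_gt0// mulr_gt0.
have ee0 : e <= e0 by rewrite /e !ge_min lexx.
have e1 : e <= 1 by rewrite /e !ge_min lexx orbT.
have ed : e * (2 * N) <= d by rewrite -ler_pdivlMr ?mulr_gt0// /e !ge_min lexx !orbT.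
have eM : e * W <= M by rewrite -ler_pdivlMr// /e !ge_min lexx !orbT.
have e2 : e ^+ 2 <= e by rewrite expr2 ger_pMr.
have e3 : e ^+ 3 <= e by rewrite exprS ger_pMr// exprn_ile1// ltW.
have e20 : 0 <= e ^+ 2 by exact: sqr_ge0.
have nS1 := ler_norm S1; have nS1' := ler_norm (- S1); rewrite normrN in nS1'.
have nS2 := ler_norm S2; have nS2' := ler_norm (- S2); rewrite normrN in nS2'.
have nA := ler_norm A; have nA' := ler_norm (- A); rewrite normrN in nA'.
have a1 : e * `|S1| + e * `|S2| + e * D <= M by move: eM; rewrite /W !mulrDr mulr1; lra.
have b1 : e ^+ 2 / 2 * S2 >= - (e * `|S2|).
  have : e ^+ 2 * `|S2| <= e * `|S2| by rewrite ler_wpM2r.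
  have : 0 <= e ^+ 2 * (S2 + `|S2|) by rewrite mulr_ge0//; lra.
  have : 0 <= e ^+ 2 * `|S2| by rewrite mulr_ge0.
  lra.
have b2 : e ^+ 3 * D <= e * D by rewrite ler_wpM2r.
have b3 : - (e * `|S1|) <= e * S1 by rewrite -mulrN ler_pM2l//; lra.
have b4 : e * S1 <= e * `|S1| by rewrite ler_pM2l.
have := H e; rewrite e_gt0 ee0 => /(_ isT e1).
have p1 : 0 <= M + e * S1 + e ^+ 2 / 2 * S2 - e ^+ 3 * D by lra.
have p2 : 0 <= M - e * S1 + e ^+ 2 / 2 * S2 - e ^+ 3 * D by lra.
move=> /(_ p1 p2).
pose Rm := D * (1 + e) * (2 * M + e ^+ 2 * (A + S2) / 2 + e ^+ 3 * D * (e - 1)) +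
  (A - S2) / 2 * (e * (A + S2) / 2 + e ^+ 2 * D * (e - 1)).
rewrite -subr_ge0 (_ : _ - _ = e ^+ 2 * (e * Rm - d)); last by rewrite /d /Rm; field.
rewrite pmulr_rge0 ?exprn_gt0// subr_ge0 => deR.
have RN : Rm <= N.
  have eD : - D <= e ^+ 2 * D * (e - 1) <= 0.
    have : e ^+ 2 * D <= 1 * D by rewrite ler_wpM2r// (le_trans e2).
    have : 0 <= e ^+ 2 * D by rewrite mulr_ge0.
    have : 0 <= e ^+ 2 * D * (1 - e) by apply: mulr_ge0; [exact: mulr_ge0|rewrite subr_ge0].
    have : 0 <= e ^+ 2 * D * e by apply: mulr_ge0; [exact: mulr_ge0|exact: ltW].
    by move=> u1 u2 u3 u4; apply/andP; split; clear -u1 u2 u3 u4; lra.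
  have eD3 : e ^+ 3 * D * (e - 1) <= 0.
    by rewrite mulr_ge0_le0 ?subr_le0// mulr_ge0// exprn_ge0// ltW.
  have AS : `|A + S2| <= `|A| + `|S2| by exact: ler_normD.
  have AS' : `|A - S2| <= `|A| + `|S2| by exact: ler_normB.
  have r1 : D * (1 + e) * (2 * M + e ^+ 2 * (A + S2) / 2 + e ^+ 3 * D * (e - 1)) <= 2 * D * (2 * M + U).
    apply: (@le_trans _ _ (D * (1 + e) * (2 * M + U))).
      rewrite ler_wpM2l ?mulr_ge0 ?addr_ge0 ?(ltW e_gt0)//.
      have : e ^+ 2 * (A + S2) / 2 <= `|A| + `|S2|.
        have : e ^+ 2 * (A + S2) <= 1 * (`|A| + `|S2|).
          apply: (@le_trans _ _ (e ^+ 2 * (`|A| + `|S2|))); first by rewrite ler_wpM2l// lerD.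
          by rewrite ler_wpM2r ?addr_ge0// (le_trans e2).
        have u1 := normr_ge0 A; have u2 := normr_ge0 S2; move=> u; clear -u u1 u2; lra.
      rewrite /U; clear -eD3 D0; lra.
    by rewrite [2 * D]mulrC ler_wpM2r ?addr_ge0 ?mulr_ge0 ?(ltW M0)// ler_wpM2l//; clear -e1; lra.
  have r2 : (A - S2) / 2 * (e * (A + S2) / 2 + e ^+ 2 * D * (e - 1)) <= U * U.
    apply: (le_trans (ler_norm _)); rewrite normrM ler_pM//.
      by rewrite normrM [`|2^-1|]ger0_norm// /U; have := normr_ge0 (A - S2); clear -AS' D0; lra.
    apply: (le_trans (ler_normD _ _)); rewrite /U; apply: lerD.
      rewrite !normrM [`|2^-1|]ger0_norm// (gtr0_norm e_gt0).
      have := normr_ge0 (A + S2).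
      have : e * `|A + S2| <= 1 * `|A + S2| by rewrite ler_wpM2r.
      clear -AS; lra.
    by rewrite ler_norml; case/andP: eD => -> /le_trans ->.
  by rewrite /Rm; apply: (le_trans (lerD r1 r2)); rewrite /N lerDl.
have : e * Rm <= e * N by rewrite ler_wpM2l// ltW.
clear -ed d0 deR; lra.
Qed.

End scalar_estimate.

(** * The inequality for functions with a quadratic Taylor remainder *)

Section exponential_expansion.
Variable R : realType.
Implicit Types t : R.

(** [1 - t <= expR (- t)] gives [expR t <= 1 / (1 - t)], which is below the quadratic as long as
    [t <= 1 / 2]. *)
Lemma expR_le_quadratic t : `|t| <= 2^-1 -> expR t <= 1 + t + 2 * t ^+ 2.
Proof.
move=> th; have t1 : t <= 2^-1 := le_trans (ler_norm t) th.
have t2 : 0 < 1 - t by lra.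
have e1 : expR t <= (1 - t)^-1.
  by rewrite -[expR t]invrK -expRN lef_pV2 ?posrE ?expR_gt0//; exact: expR_ge1Dx.
apply: (le_trans e1); rewrite -div1r ler_pdivrMr//.
have -> : (1 + t + 2 * t ^+ 2) * (1 - t) = 1 + t ^+ 2 * (1 - 2 * t) by ring.
by rewrite lerDl mulr_ge0 ?sqr_ge0//; lra.
Qed.

(** The derivative [expR s - (1 + s)] of the remainder is controlled by the quadratic bound, and the
    mean value theorem adds one power of [t]. *)
Lemma expR_taylor2 t : `|t| <= 2^-1 ->
  `|expR t - (1 + t + t ^+ 2 / 2)| <= 2 * `|t| ^+ 3.
Proof.
move=> th; pose f (s : R) := expR s - (1 + s + s ^+ 2 / 2).
have fd (s : R) : is_derive s (1 : R) f (expR s - (1 + s)).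
  rewrite /f; apply: is_derive_eq.
  rewrite -![_ *: _]/(_ * _) /= !mulr0 !mulr1; lra.
have f0 : f 0 = 0 by rewrite /f expR0; ring.
have main (c : R) : `|c| <= `|t| -> `|expR c - (1 + c)| <= 2 * `|t| ^+ 2.
  move=> ct; rewrite ger0_norm ?subr_ge0 ?expR_ge1Dx// lerBlDl.
  apply: (le_trans (expR_le_quadratic (le_trans ct th))).
  by rewrite lerD2l ler_wpM2l// -(real_normK (num_real c)) lerXn2r ?nnegrE.
have cf u v : {within `[u, v], continuous f}.
  apply: continuous_in_subspaceT => x _; apply/differentiable_continuous/derivable1_diffP.
  by have [] := fd x.
have [t0|t0] := leP 0 t.
  have [c] := @MVT_segment R f _ 0 t t0 (fun x _ => fd x) (cf _ _).
  rewrite in_itv/= => /andP[c0 ct]; rewrite f0 !subr0 => ft.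
  rewrite -/(f t) ft normrM exprS mulrCA mulrC ler_wpM2l//; apply: main.
  by rewrite !ger0_norm.
have [c] := @MVT_segment R f _ t 0 (ltW t0) (fun x _ => fd x) (cf _ _).
rewrite in_itv/= => /andP[tc c0]; rewrite f0 !sub0r => ft.
rewrite -/(f t) -normrN ft normrM normrN exprS mulrCA mulrC ler_wpM2l//; apply: main.
by rewrite !ler0_norm ?lerN2// ltW.
Qed.

End exponential_expansion.

(** * The variance inequality on a box *)

Section weighted_poincare.
Variable R : realType.
Local Notation lam n := (lebesgue_rV R n).
Variables (n : nat) (k : 'I_n -> R) (a b : R) (rho : 'rV[R]_n -> R).
Hypotheses (k1 : forall i, 1 < k i) (a0 : 0 < a) (ab : a < b).
Hypothesis hrho : box_fun a b rho.
Hypothesis rho_logconcave : forall x y, pos_orthant x -> pos_orthant y ->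
  rho (coord_pow k x) * rho (coord_pow k y) <=
  rho (coord_pow k (2^-1 *: (x + y))) ^+ 2.

(** Bounds are asked for on the box alone: coordinates and [G] may be unbounded outside it, where
    [rho] vanishes. *)
Let bounded_meas (u : 'rV[R]_n -> R) := measurable_fun setT u /\
  exists C, forall z, rV_box n a b z -> `|u z| <= C.

Let J (u : 'rV[R]_n -> R) := \int[lam n]_z (u z * rho z).

Let rho0 z : 0 <= rho z. Proof. by case: hrho. Qed.

Let rho_out z : ~ rV_box n a b z -> rho z = 0.
Proof. by case: hrho => _ _ _; exact. Qed.

Let bmD u v : bounded_meas u -> bounded_meas v -> bounded_meas (fun z => u z + v z).
Proof.
move=> [mu [C uC]] [mv [D vD]]; split; first exact: measurable_funD.
exists (C + D) => z zb; apply: (le_trans (ler_normD _ _)).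
by apply: lerD; [exact: uC|exact: vD].
Qed.

Let bmM u v : bounded_meas u -> bounded_meas v -> bounded_meas (fun z => u z * v z).
Proof.
move=> [mu [C uC]] [mv [D vD]]; split; first exact: measurable_funM.
exists (C * D) => z zb; rewrite normrM.
by apply: ler_pM => //; [exact: uC|exact: vD].
Qed.

Let bmc (c : R) : bounded_meas (fun=> c).
Proof. by split; [exact: measurable_cst|exists `|c|]. Qed.

Let bmexp u : bounded_meas u -> bounded_meas (fun z => expR (u z)).
Proof.
move=> [mu [C uC]]; split; first exact: measurableT_comp.
exists (expR C) => z /uC zC; rewrite ger0_norm ?expR_ge0// ler_expR.
exact: le_trans (ler_norm _) zC.
Qed.

Let bm_box u : bounded_meas u -> (forall z, 0 <= u z) -> box_fun a b (fun z => u z * rho z).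
Proof.
case: hrho => mr r0 [C rC] rout [mu [B uB]] u0; split.
- exact: measurable_funM.
- by move=> z; rewrite mulr_ge0.
- exists (`|B| * `|C|) => z; have [zb|zb] := pselect (rV_box n a b z); last first.
    by rewrite rho_out// mulr0 mulr_ge0.
  apply: ler_pM => //; apply: (le_trans (ler_norm _)).
    exact: le_trans (uB _ zb) (ler_norm _).
  by rewrite ger0_norm//; exact: le_trans (rC z) (ler_norm _).
- by move=> z zb; rewrite rho_out// mulr0.
Qed.

Let bm_int u : bounded_meas u -> (lam n).-integrable setT (EFin \o (fun z => u z * rho z)).
Proof.
case: hrho => mr r0 [C rC] rout [mu [B uB]].
have mb : measurable (rV_box n a b) by exact: measurable_rV_box.
rewrite (_ : _ \o _ = (EFin \o (fun z => u z * rho z)) \_ (rV_box n a b)); last first.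
  apply/funext => z; rewrite patchE; case: ifPn => // /negP zb /=.
  by rewrite rho_out ?mulr0// => /mem_set.
apply: (iffLR (integrable_mkcond _ mb)).
apply: (@bounded_integrable _ _ _ _ _ _ (B * `|C|)) => //.
- exact: rV_box_measure.
- exact/measurable_funTS/measurable_funM.
- move=> z zb; rewrite normrM ler_pM//; first exact: uB.
  by rewrite ger0_norm//; exact: le_trans (rC z) (ler_norm _).
Qed.

Let JD u v : bounded_meas u -> bounded_meas v -> J (fun z => u z + v z) = J u + J v.
Proof.
move=> hu hv; rewrite /J -RintegralD//; [|exact: bm_int|exact: bm_int].
by congr Rintegral; apply/funext => z; rewrite mulrDl.
Qed.

Let JZ (c : R) u : bounded_meas u -> J (fun z => c * u z) = c * J u.
Proof.
move=> hu; rewrite /J -RintegralZl//; last exact: bm_int.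
by congr Rintegral; apply/funext => z; rewrite mulrA.
Qed.

Let Jle u v : bounded_meas u -> bounded_meas v ->
  (forall z, rV_box n a b z -> u z <= v z) -> J u <= J v.
Proof.
move=> hu hv uv; apply: le_Rintegral => //; [exact: bm_int|exact: bm_int|].
move=> z _; have [zb|zb] := pselect (rV_box n a b z); last by rewrite rho_out// !mulr0.
by rewrite ler_wpM2r//; exact: uv.
Qed.

Let JE u : bounded_meas u -> (\int[lam n]_z (u z * rho z)%:E = (J u)%:E)%E.
Proof. by move=> hu; rewrite EFin_Rintegral//; exact: bm_int. Qed.

Let J0 u : (forall z, 0 <= u z) -> 0 <= J u.
Proof. by move=> u0; apply: Rintegral_ge0 => z _; rewrite mulr_ge0. Qed.

Variables (H : 'rV[R]_n -> R) (g : 'I_n -> 'rV[R]_n -> R) (B L C : R).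
Hypotheses (mH : measurable_fun setT H) (HB : forall z, `|H z| <= B).
Hypotheses (mg : forall i, measurable_fun setT (g i)) (gL : forall i z, `|g i z| <= L).
Hypothesis C0 : 0 <= C.
Hypothesis H_taylor : forall z h,
  `|H (z + h) - H z - \sum_i h ord0 i * g i z| <= C * \sum_i h ord0 i ^+ 2.

Let G (z : 'rV[R]_n) := \sum_i k i ^+ 2 / (k i - 1) * z ord0 i ^+ 2 * g i z ^+ 2.

Let G0 z : 0 <= G z.
Proof.
apply: sumr_ge0 => i _; apply: mulr_ge0; last exact: sqr_ge0.
apply: mulr_ge0; last exact: sqr_ge0.
by rewrite divr_ge0 ?sqr_ge0// subr_ge0 ltW.
Qed.

Let bmH : bounded_meas H.
Proof. by split => //; exists B. Qed.

Let bmg i : bounded_meas (g i).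
Proof. by split => //; exists L. Qed.

Let bmz (i : 'I_n) : bounded_meas (fun z => z ord0 i).
Proof.
split; first exact: measurable_coord_rV.
exists b => z /(_ i)/andP[az zb]; by rewrite ger0_norm// (le_trans (ltW a0) az).
Qed.

Let bm_sum (I : Type) (s : seq I) (F : I -> 'rV[R]_n -> R) :
  (forall i, bounded_meas (F i)) -> bounded_meas (fun z => \sum_(i <- s) F i z).
Proof.
move=> hF; elim: s => [|i s IH].
  by rewrite (_ : (fun _ => _) = fun=> 0); [exact: bmc|apply/funext => z; rewrite big_nil].
rewrite (_ : (fun _ => _) = fun z => F i z + \sum_(j <- s) F j z).
  exact: bmD.
by apply/funext => z; rewrite big_cons.
Qed.

Let bmG : bounded_meas G.
Proof.
apply: bm_sum => i.
by apply: bmM; [apply: bmM; [exact: bmc|exact: bmM]|exact: bmM].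
Qed.

(** Logarithms turn the product over coordinates into a sum, to which [coord_estimate] applies term
    by term. [H] is expanded at the image [Z] of the midpoint, so that [X] and [Y] share the slopes
    [g i Z] and the value [H Z] cancels. *)
Let pointwise_estimate (eta : R) : 0 < eta -> exists2 e0, 0 < e0 &
  forall e, 0 < e <= e0 -> forall x y, pos_orthant x -> pos_orthant y ->
  rV_box n a b (coord_pow k x) -> rV_box n a b (coord_pow k y) ->
  expR (e * H (coord_pow k x)) * expR ((- e) * H (coord_pow k y)) *
    \prod_i (x ord0 i * y ord0 i) `^ (k i - 1) <=
  (expR (e ^+ 2 / 2 * (1 + eta) * G (coord_pow k (2^-1 *: (x + y)))) *
   \prod_i ((x ord0 i + y ord0 i) / 2) `^ (k i - 1)) ^+ 2.
Proof.
move=> eta0.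
have /choice[e_ he] : forall i, exists e0, 0 < e0 /\ forall e, 0 < e <= e0 ->
    forall x y c, 0 < x -> 0 < y -> `|c| <= L -> a <= x `^ k i <= b -> a <= y `^ k i <= b ->
    e * ((x `^ k i - y `^ k i) * c + C * ((x `^ k i - ((x + y) / 2) `^ k i) ^+ 2 +
                                      (y `^ k i - ((x + y) / 2) `^ k i) ^+ 2)) +
    (k i - 1) * (ln x + ln y - 2 * ln ((x + y) / 2)) <=
    e ^+ 2 * (1 + eta) * (k i ^+ 2 / (k i - 1) * (((x + y) / 2) `^ k i) ^+ 2 * c ^+ 2).
  move=> i; have L0 : 0 <= L by exact: le_trans (normr_ge0 _) (gL i 0).
  by have [e0 e00 h] := coord_estimate (k1 i) a0 ab C0 L0 eta0; exists e0.
exists (\big[Num.min/1]_i e_ i).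
  by apply: lt_bigmin => // i _; case: (he i).
move=> e /andP[e0 ee] x y x0 y0 xb yb.
pose m i := (x ord0 i + y ord0 i) / 2.
have m0 i : 0 < m i by rewrite divr_gt0// addr_gt0//.
set X := coord_pow k x in xb *; set Y := coord_pow k y in yb *.
set Z := coord_pow k (2^-1 *: (x + y)).
have XE i : X ord0 i = x ord0 i `^ k i by rewrite mxE.
have YE i : Y ord0 i = y ord0 i `^ k i by rewrite mxE.
have ZE i : Z ord0 i = m i `^ k i by rewrite !mxE mulrC.
have prod_ln : \prod_i (x ord0 i * y ord0 i) `^ (k i - 1) =
    expR (\sum_i (k i - 1) * (ln (x ord0 i) + ln (y ord0 i))).
  rewrite expR_sum; apply: eq_bigr => i _.
  have xi := x0 i; have yi := y0 i.
  by rewrite /powR gt_eqF ?mulr_gt0// lnM.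
have prod_ln_mid : \prod_i m i `^ (k i - 1) = expR (\sum_i (k i - 1) * ln (m i)).
  by rewrite expR_sum; apply: eq_bigr => i _; rewrite /powR gt_eqF.
rewrite prod_ln -/m prod_ln_mid -!expRD -expRM_natl ler_expR.
have eHX := H_taylor Z (X - Z); rewrite [Z + _]addrC subrK in eHX.
have eHY := H_taylor Z (Y - Z); rewrite [Z + _]addrC subrK in eHY.
have hX := le_trans (ler_norm _) eHX.
have hY : - (H Y - H Z - \sum_i (Y - Z) ord0 i * g i Z) <= C * \sum_i (Y - Z) ord0 i ^+ 2.
  by apply: le_trans eHY; rewrite -normrN; exact: ler_norm.
have hs : \sum_i (e * ((X ord0 i - Y ord0 i) * g i Z +
       C * ((X ord0 i - Z ord0 i) ^+ 2 + (Y ord0 i - Z ord0 i) ^+ 2)) +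
      (k i - 1) * (ln (x ord0 i) + ln (y ord0 i) - 2 * ln (m i))) <=
    \sum_i e ^+ 2 * (1 + eta) * (k i ^+ 2 / (k i - 1) * (Z ord0 i) ^+ 2 * g i Z ^+ 2).
  apply: ler_sum => i _; rewrite XE YE ZE; case: (he i) => _; apply.
  - by rewrite e0/=; apply: (le_trans ee); exact: bigmin_le_cond.
  - exact: x0.
  - exact: y0.
  - exact: gL.
  - by have := xb i; rewrite XE.
  - by have := yb i; rewrite YE.
(* The left sum is regrouped to match the two Taylor bounds [hX] and [hY]. *)
have hsE : \sum_i (e * ((X ord0 i - Y ord0 i) * g i Z +
       C * ((X ord0 i - Z ord0 i) ^+ 2 + (Y ord0 i - Z ord0 i) ^+ 2)) +
      (k i - 1) * (ln (x ord0 i) + ln (y ord0 i) - 2 * ln (m i))) =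
    e * (\sum_i (X - Z) ord0 i * g i Z) + (- e) * (\sum_i (Y - Z) ord0 i * g i Z) +
    (e * C) * (\sum_i (X - Z) ord0 i ^+ 2) + (e * C) * (\sum_i (Y - Z) ord0 i ^+ 2) +
    \sum_i (k i - 1) * (ln (x ord0 i) + ln (y ord0 i)) +
    (- 2) * \sum_i (k i - 1) * ln (m i).
  rewrite !mulr_sumr -!big_split/=; apply: eq_bigr => i _.
  by rewrite !mxE; ring.
rewrite hsE -mulr_sumr -/(G Z) in hs.
have hX' := ler_wpM2l (ltW e0) hX; have hY' := ler_wpM2l (ltW e0) hY.
move: hs hX' hY'.
rewrite -/(G Z); lra.
Qed.

Lemma weighted_poincare (eta : R) : 0 < eta -> 0 < J (fun=> 1) ->
  J (fun=> 1) * J (fun z => H z ^+ 2) - J H ^+ 2 <= J (fun=> 1) * ((1 + eta) * J G).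
Proof.
move=> eta0 M0; have [e0 e00 key] := pointwise_estimate eta0.
have B0 : 0 <= B := le_trans (normr_ge0 _) (HB 0).
have [Gm Gm0 hGm] : exists2 Gm, 0 <= Gm & forall z, rV_box n a b z -> G z <= Gm.
  have [_ [Gm hGm]] := bmG; exists `|Gm| => // z /hGm zGm.
  exact: le_trans (ler_norm _) (le_trans zGm (ler_norm _)).
have w0 : 0 < 1 + eta by rewrite addr_gt0.
(* [2 B^3] serves the cubic remainder of the exponentials of [H], the other summand the quadratic
   remainder of the exponential of [G]. *)
pose D := 2 * B ^+ 3 + (1 + eta) ^+ 2 * Gm ^+ 2.
have D0 : 0 <= D.
  by apply: addr_ge0; apply: mulr_ge0 => //; rewrite ?sqr_ge0// exprn_ge0.
(* Keeps the exponents [e H] and [e^2 (1 + eta) G / 2] within [[-1/2, 1/2]], where the expansions of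
   the exponential hold. *)
pose e1 := Num.min e0 (Num.min (2 * (B + 1))^-1 ((1 + eta) * (Gm + 1))^-1).
have e10 : 0 < e1 by rewrite /e1 !lt_min e00/= !invr_gt0 !mulr_gt0// ltr_wpDl.
have bm1 : bounded_meas (fun=> 1) by exact: bmc.
have bmH2 : bounded_meas (fun z => H z ^+ 2) by exact: bmM.
apply: (@quadratic_limit _ _ _ _ _ (D * J (fun=> 1)) e1) => //.
  by rewrite mulr_ge0// ltW.
move=> e /andP[e_gt0 ee1] ele1.
have ee0 : e <= e0 by apply: (le_trans ee1); rewrite /e1 ge_min lexx.
have eB : e * B <= 2^-1.
  have : e <= (2 * (B + 1))^-1 by apply: (le_trans ee1); rewrite /e1 !ge_min lexx orbT.
  rewrite -[_^-1]mul1r ler_pdivlMr; last by rewrite mulr_gt0// ltr_wpDl.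
  by lra.
have eG : e * ((1 + eta) * Gm) <= 1.
  have : e <= ((1 + eta) * (Gm + 1))^-1 by apply: (le_trans ee1); rewrite /e1 !ge_min lexx !orbT.
  rewrite -[_^-1]mul1r ler_pdivlMr; last by rewrite mulr_gt0// ltr_wpDl.
  apply: le_trans; rewrite ler_pM2l// ler_pM2l// lerDl//.
have e2 : e ^+ 2 <= e by rewrite expr2 ger_pMr.
have bmE (c : R) u : bounded_meas u -> bounded_meas (fun z => expR (c * u z)).
  by move=> hu; apply: bmexp; exact: bmM.
(* The signs [s = 1] and [s = -1] give the two factors on the left. *)
have lower (s : R) : `|s| = 1 ->
    J (fun=> 1) + (s * e) * J H + e ^+ 2 / 2 * J (fun z => H z ^+ 2) - e ^+ 3 * (D * J (fun=> 1)) <=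
    J (fun z => expR ((s * e) * H z)).
  move=> s1; have s2 : s ^+ 2 = 1 by rewrite -(real_normK (num_real s)) s1 expr1n.
  have bml : bounded_meas (fun z => (1 - e ^+ 3 * D) * 1 + (s * e) * H z) by apply: bmD; exact: bmM.
  have bmq : bounded_meas (fun z => e ^+ 2 / 2 * H z ^+ 2) by exact: bmM.
  have := @Jle _ _ (bmD bml bmq) (bmE (s * e) _ bmH).
  rewrite (JD bml bmq) (@JD (fun=> (1 - e ^+ 3 * D) * 1) (fun z => (s * e) * H z)) ?(@JZ (1 - e ^+ 3 * D) (fun=> 1)) ?(JZ _ bmH) ?(JZ _ bmH2)//; last exact: bmM.
  move=> le; apply: (le_trans _ (le _)); first by rewrite le_eqVlt; apply/orP; left; apply/eqP; ring.
  move=> z _.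
  have seH : `|s * e * H z| <= e * B.
    by rewrite !normrM s1 mul1r (gtr0_norm e_gt0) ler_pM2l.
  have := expR_taylor2 (le_trans seH eB); rewrite ler_norml => /andP[+ _].
  have : 2 * `|s * e * H z| ^+ 3 <= 2 * (e * B) ^+ 3.
    by rewrite ler_pM2l// lerXn2r ?nnegrE// mulr_ge0// ltW.
  rewrite [(s * e * H z) ^+ 2]exprMn [(s * e) ^+ 2]exprMn s2 mul1r [(e * B) ^+ 3]exprMn.
  have : e ^+ 3 * (2 * B ^+ 3) <= e ^+ 3 * D.
    by rewrite ler_pM2l ?exprn_gt0// /D lerDl mulr_ge0 ?sqr_ge0.
  lra.
have upper : J (fun z => expR (e ^+ 2 / 2 * (1 + eta) * G z)) <=
    J (fun=> 1) + e ^+ 2 / 2 * ((1 + eta) * J G) + e ^+ 4 * (D * J (fun=> 1)).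
  have bm1' : bounded_meas (fun=> (1 + e ^+ 4 * D) * 1) by exact: bmM.
  have bmG' : bounded_meas (fun z => (e ^+ 2 / 2 * (1 + eta)) * G z) by exact: bmM.
  have := @Jle _ _ (bmE (e ^+ 2 / 2 * (1 + eta)) _ bmG) (bmD bm1' bmG').
  rewrite (JD bm1' bmG') (JZ _ bmG) (@JZ (1 + e ^+ 4 * D) (fun=> 1))//.
  move=> le; apply: (le_trans (le _)); last by rewrite le_eqVlt; apply/orP; left; apply/eqP; ring.
  move=> z zb; have Gz := G0 z; have Gzm := hGm z zb.
  pose s := e ^+ 2 / 2 * (1 + eta) * G z; rewrite -/s.
  have s0 : 0 <= s by rewrite /s !mulr_ge0 ?sqr_ge0// ltW.
  have wG : (1 + eta) * G z <= (1 + eta) * Gm by rewrite ler_pM2l.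
  have wG0 : 0 <= (1 + eta) * G z by rewrite mulr_ge0// ltW.
  have s12 : `|s| <= 2^-1.
    rewrite ger0_norm//.
    have : e ^+ 2 * ((1 + eta) * G z) <= e * ((1 + eta) * Gm) by apply: ler_pM => //; exact: sqr_ge0.
    by rewrite /s; lra.
  apply: (le_trans (expR_le_quadratic s12)).
  have : 2 * s ^+ 2 <= e ^+ 4 * D.
    rewrite (_ : 2 * s ^+ 2 = e ^+ 4 * (((1 + eta) * G z) ^+ 2 / 2)); last by rewrite /s; field.
    rewrite ler_pM2l ?exprn_gt0// /D -exprMn.
    have : ((1 + eta) * G z) ^+ 2 <= ((1 + eta) * Gm) ^+ 2 by rewrite lerXn2r ?nnegrE// (le_trans wG0).
    have : 0 <= B ^+ 3 by exact: exprn_ge0.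
    have : 0 <= ((1 + eta) * G z) ^+ 2 by exact: sqr_ge0.
    lra.
  rewrite -/s; lra.
have PL : J (fun z => expR (e * H z)) * J (fun z => expR ((- e) * H z)) <=
    J (fun z => expR (e ^+ 2 / 2 * (1 + eta) * G z)) ^+ 2.
  have b1 := bmE e _ bmH; have b2 := bmE (- e) _ bmH.
  have b3 := bmE (e ^+ 2 / 2 * (1 + eta)) _ bmG.
  have := prekopa_leindler_rV a0 ab k1 (bm_box b1 _) (bm_box b2 _) (bm_box b3 _).
  move=> /(_ (fun=> expR_ge0 _) (fun=> expR_ge0 _) (fun=> expR_ge0 _)).
  rewrite (JE b1) (JE b2) (JE b3).
  rewrite -!EFinM.
  rewrite lee_fin -expr2.
  apply => x y x0 y0.
  have [xb|xb] := pselect (rV_box n a b (coord_pow k x)); last first.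
    by rewrite (rho_out xb) mulr0 !mul0r sqr_ge0.
  have [yb|yb] := pselect (rV_box n a b (coord_pow k y)); last first.
    by rewrite (rho_out yb) !mulr0 !mul0r sqr_ge0.
  have := key e _ x y x0 y0 xb yb; rewrite e_gt0 ee0 => /(_ isT) K.
  (* Log-concavity of [rho] times the exponential estimate is the hypothesis of Prekopa-Leindler. *)
  have := ler_pM _ _ (rho_logconcave x0 y0) K.
  rewrite !mulr_ge0 ?expR_ge0 ?prodr_ge0// => [/(_ isT isT)|i _]; last exact: powR_ge0.
  move=> K2; apply: (le_trans _ (le_trans K2 _)); rewrite le_eqVlt; apply/orP; left; apply/eqP; ring.
have l1 := lower 1 (normr1 _); have l2 := lower (-1) (normrN1 _).
rewrite mul1r in l1; rewrite !mulN1r in l2.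
move=> p1 p2; apply: (@le_trans _ _ (J (fun z => expR (e * H z)) * J (fun z => expR ((- e) * H z)))).
  by rewrite mulNr in l2; exact: ler_pM p1 p2 l1 l2.
apply: (le_trans PL).
have J0w : 0 <= J (fun z => expR (e ^+ 2 / 2 * (1 + eta) * G z)) by apply: J0 => z; exact: expR_ge0.
by apply: lerXn2r; rewrite ?nnegrE; [exact: J0w|exact: le_trans J0w upper|exact: upper].
Qed.

(** Passing from [H] to [F] costs [2 B t M^2] in the second moment, after multiplication by [M], and
    [2 B t M^2] in the squared mean. The energy keeps the slopes of [H], and is split by coordinates
    so that each term can be bounded by [steklov_energy]. *)
Lemma weighted_poincare_near (F : 'rV[R]_n -> R) (t eta : R) : 0 < eta -> 0 < J (fun=> 1) ->
  measurable_fun setT F -> (forall z, `|F z| <= B) -> (forall z, `|H z - F z| <= t) ->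
  ((J (fun=> 1) * J (fun z => F z ^+ 2) - J F ^+ 2)%:E <=
   (J (fun=> 1))%:E * ((1 + eta)%:E *
      \sum_i \int[lam n]_z (k i ^+ 2 / (k i - 1) * z ord0 i ^+ 2 * g i z ^+ 2 * rho z)%:E) +
   (4 * B * t * J (fun=> 1) ^+ 2)%:E)%E.
Proof.
move=> eta0 M0 mF FB HF; set M := J _ in M0 *.
have B0 : 0 <= B := le_trans (normr_ge0 _) (HB 0).
have t0 : 0 <= t := le_trans (normr_ge0 _) (HF 0).
have bm1 : bounded_meas (fun=> 1) by exact: bmc.
have bmF : bounded_meas F by split => //; exists B.
have bmH2 : bounded_meas (fun z => H z ^+ 2) by exact: bmM.
have bmF2 : bounded_meas (fun z => F z ^+ 2) by exact: bmM.
have bm1c (c : R) : bounded_meas (fun=> c * 1) by exact: bmM.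
have near2 : J (fun z => F z ^+ 2) <= J (fun z => H z ^+ 2) + 2 * B * t * M.
  rewrite -(JZ (2 * B * t) bm1) -JD//; apply: Jle => //; first exact: bmD.
  move=> z _; rewrite mulr1 -lerBlDl.
  have -> : F z ^+ 2 - H z ^+ 2 = (F z - H z) * (F z + H z) by ring.
  apply: (le_trans (ler_norm _)); rewrite normrM [leRHS]mulrC distrC ler_pM//.
  by apply: (le_trans (ler_normD _ _)); have := FB z; have := HB z; lra.
have near1 : `|J H - J F| <= t * M.
  rewrite ler_norml lerBlDl lerBrDl; apply/andP; split.
    rewrite -mulNr -(JZ (- t) bm1) -JD//; apply: Jle => //; first exact: bmD.
    by move=> z _; have := HF z; rewrite ler_norml => /andP[]; lra.
  rewrite -(JZ t bm1) -JD//; apply: Jle => //; first exact: bmD.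
  by move=> z _; have := HF z; rewrite ler_norml => /andP[]; lra.
have JB u : bounded_meas u -> (forall z, `|u z| <= B) -> `|J u| <= B * M.
  move=> hu uB; rewrite ler_norml -mulNr -(JZ (- B) bm1) -(JZ B bm1); apply/andP; split; apply: Jle => //.
    by move=> z _; have := uB z; rewrite ler_norml => /andP[]; lra.
  by move=> z _; have := uB z; rewrite ler_norml => /andP[]; lra.
have near3 : J H ^+ 2 - J F ^+ 2 <= 2 * B * t * M ^+ 2.
  have -> : J H ^+ 2 - J F ^+ 2 = (J H - J F) * (J H + J F) by ring.
  apply: (le_trans (ler_norm _)); rewrite normrM.
  rewrite (_ : 2 * B * t * M ^+ 2 = (t * M) * (2 * B * M)); last by ring.
  rewrite ler_pM//; apply: (le_trans (ler_normD _ _)).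
  by have := JB _ bmH HB; have := JB _ bmF FB; lra.
have Gterm i : bounded_meas (fun z : 'rV[R]_n => k i ^+ 2 / (k i - 1) * z ord0 i ^+ 2 * g i z ^+ 2).
  by apply: bmM; [apply: bmM; [exact: bmc|exact: bmM]|exact: bmM].
have k0 i : 0 <= k i ^+ 2 / (k i - 1) by rewrite divr_ge0 ?sqr_ge0// subr_ge0 ltW.
have term0 i (z : 'rV[R]_n) : 0 <= k i ^+ 2 / (k i - 1) * z ord0 i ^+ 2 * g i z ^+ 2.
  by apply: mulr_ge0; [apply: mulr_ge0 => //|]; exact: sqr_ge0.
have -> : (\sum_i \int[lam n]_z (k i ^+ 2 / (k i - 1) * z ord0 i ^+ 2 * g i z ^+ 2 * rho z)%:E =
    (J G)%:E)%E.
  rewrite -(JE bmG) -ge0_integral_sum//; last 2 first.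
  - by move=> i; apply/measurable_EFinP; have [] := bm_box (Gterm i) (term0 i).
  - by move=> i z _; rewrite lee_fin mulr_ge0.
  by apply: eq_integral => z _; rewrite /G sumEFin mulr_suml.
rewrite -!EFinM -EFinD lee_fin.
have := weighted_poincare eta0 M0; rewrite -/M.
have := ler_wpM2l (ltW M0) near2.
move: near3; lra.
Qed.

End weighted_poincare.

(** * Functions on compact boxes *)

Section compact_boxes.
Variable R : realType.

Lemma rV_box_compact n (a b : R) : compact (rV_box n a b).
Proof.
rewrite (_ : rV_box n a b = [set v | forall i, `[a, b]%classic (v ord0 i)]).
  by apply: (@rV_compact _ n (fun=> `[a, b]%classic)) => i; exact: segment_compact.
by apply/seteqP; split => v /= h i; have := h i; rewrite in_itv.
Qed.

Lemma rV_ballP n (x y : 'rV[R]_n) (e : R) : 0 < e ->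
  ball x e y <-> forall i, `|x ord0 i - y ord0 i| < e.
Proof.
move=> e0; split=> [[_ h] i|h]; first exact: h.
by split=> // i j; rewrite (ord1 i); exact: h.
Qed.

Lemma open_pos_orthant n : open (@pos_orthant R n).
Proof.
rewrite openE => x x0.
have nx i : nbhs x [set v : 'rV[R]_n | 0 < v ord0 i].
  have cx : (fun v : 'rV[R]_n => v ord0 i) @ x --> x ord0 i by exact: coord_continuous.
  by apply: (cx [set t | 0 < t]); apply: lt_nbhsr; exact: x0.
exact: filter_forall nx.
Qed.

Lemma continuous_measurable_on n (D : set 'rV[R]_n) (u : 'rV[R]_n -> R) : open D ->
  (forall x, D x -> {for x, continuous u}) -> measurable_fun D u.
Proof.
move=> oD cu; apply: (measurability (@RGenOpens.G R)).
  exact: RGenOpens.measurableE.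
move=> _ [_ [a [b ->] <-]]; apply: open_measurable_rV.
suff : open (D `&` u @^-1` `]a, b[%classic) by [].
rewrite openE => x [Dx ux].
have nD : nbhs x D by exact: open_nbhs_nbhs.
have nu : nbhs x (u @^-1` `]a, b[%classic).
  have cux : u @ x --> u x := cu x Dx.
  by apply: cux; apply: open_nbhs_nbhs; split => //; exact: interval_open.
exact: filterI.
Qed.

Lemma box_bounded n (a b : R) (u : 'rV[R]_n -> R) :
  (forall x, rV_box n a b x -> {for x, continuous u}) ->
  exists2 C, 0 <= C & forall x, rV_box n a b x -> `|u x| <= C.
Proof.
move=> cu.
have cK := @rV_box_compact n a b.
have [M [Mr hM]] : \forall M \near +oo, rV_box n a b `<=` [set x | `|u x| <= M].
  move/compact_near_coveringP : cK.
  move=> /(_ R +oo (fun M x => `|u x| <= M)); apply => x xK.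
  have nx : nbhs x [set y | `|u y - u x| < 1].
    have cux : u @ x --> u x := cu x xK.
    have : nbhs x (u @^-1` ball (u x) 1) by apply: cux; exact: nbhsx_ballx.
    by apply: filterS => y; rewrite /preimage/ball/= distrC.
  exists ([set y | `|u y - u x| < 1], [set M | `|u x| + 1 < M]) => /=.
    by split => //; exists (`|u x| + 1); split; [exact: num_real|].
  move=> [y M] /= [yx xM].
  have : `|u y| <= `|u x| + `|u y - u x|.
    by rewrite -[X in `|X| <= _](subrK (u x)) addrC; exact: ler_normD.
  lra.
exists (`|M| + 1); first by rewrite addr_ge0.
apply: hM; have := ler_norm M; lra.
Qed.

(** The point [x + c] may leave the box, so uniform continuity on the box would not do. But [u] is
    continuous in the whole space at each point of the box, and compactness makes the radius
    uniform. *)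
Lemma box_uniform_continuous n (a b e : R) (u : 'rV[R]_n -> R) : 0 < e ->
  (forall x, rV_box n a b x -> {for x, continuous u}) ->
  exists2 d, 0 < d & forall x c, rV_box n a b x -> rV_box n 0 d c ->
    `|u (x + c) - u x| < e.
Proof.
move=> e0 cu.
have cK := @rV_box_compact n a b.
have : \forall d \near 0^'+, rV_box n a b `<=`
    [set x | forall c, rV_box n 0 d c -> `|u (x + c) - u x| < e].
  move/compact_near_coveringP : cK.
  move=> /(_ R 0^'+ (fun d x => forall c, rV_box n 0 d c -> `|u (x + c) - u x| < e)).
  apply => x xK.
  have : nbhs x [set y | `|u y - u x| < e / 2].
    have cux : u @ x --> u x := cu x xK.
    have : nbhs x (u @^-1` ball (u x) (e / 2)).
      by apply: cux; apply: nbhsx_ballx; rewrite divr_gt0.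
    by apply: filterS => y; rewrite /preimage/ball/= distrC.
  move=> /nbhs_ballP[r /= r0 xr].
  have r20 : 0 < r / 2 by rewrite divr_gt0.
  exists (ball x (r / 2), [set d | 0 < d < r / 2]) => /=.
    split; first exact: nbhsx_ballx.
    exists (r / 2) => //= d; rewrite /ball_/= sub0r normrN => dr d0.
    by rewrite d0/=; exact: le_lt_trans (ler_norm _) dr.
  move=> [y d] /= [xy /andP[d0 dr]] c cd.
  have /(rV_ballP _ _ r20) xyi := xy.
  have h1 : `|u y - u x| < e / 2.
    by apply: xr; apply: (le_ball _ xy); lra.
  have h2 : `|u (y + c) - u x| < e / 2.
    apply: xr; apply/rV_ballP => // i; rewrite mxE.
    have := xyi i; have /andP[c0 ci] := cd i.
    by rewrite !ltr_norml => /andP[? ?]; apply/andP; split; lra.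
  rewrite (_ : _ - _ = (u (y + c) - u x) - (u y - u x)); last by ring.
  by apply: (le_lt_trans (ler_normB _ _)); lra.
move=> [r /= r0 hr]; exists (r / 2); first by rewrite divr_gt0.
move=> x c xK; apply: (hr (r / 2)) => //=.
  by rewrite /ball_/= sub0r normrN gtr0_norm ?divr_gt0//; lra.
by rewrite divr_gt0.
Qed.

(** Around a point, close pairs use the local constant and pairs at distance at least [r / 2] use
    [2 B = (4 B / r) (r / 2)]; compactness makes the constant uniform. *)
Lemma box_lipschitz n (a b : R) (u : 'rV[R]_n -> R) :
  (forall x, rV_box n a b x -> {for x, continuous u}) ->
  (forall x, rV_box n a b x -> exists2 U, nbhs x U & [lipschitz u y | y in U]) ->
  exists2 L, 0 <= L & forall x y, rV_box n a b x -> rV_box n a b y ->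
    `|u x - u y| <= L * `|x - y|.
Proof.
move=> cu lu.
have [B B0 uB] := box_bounded cu.
have cK := @rV_box_compact n a b.
have [M [Mr hM]] : \forall M \near +oo, rV_box n a b `<=`
    [set x | forall y, rV_box n a b x -> rV_box n a b y -> `|u x - u y| <= M * `|x - y|].
  move/compact_near_coveringP : cK.
  move=> /(_ R +oo (fun M x => forall y, rV_box n a b x -> rV_box n a b y ->
    `|u x - u y| <= M * `|x - y|)).
  apply => x xK.
  have [U /nbhs_ballP[r /= r0 xrU] [l [lr hl]]] := lu x xK.
  have r20 : 0 < r / 2 by rewrite divr_gt0.
  exists (ball x (r / 2), [set M | `|l| + 1 + 4 * B / r < M]) => /=.
    split; first exact: nbhsx_ballx.
    by exists (`|l| + 1 + 4 * B / r); split; [exact: num_real|].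
  move=> [x' M] /= [xx' lM] y x'K yK.
  have Br : 0 <= 4 * B / r by rewrite divr_ge0 ?mulr_ge0// ltW.
  have [xy|xy] := pselect (ball x r y).
    have := hl (`|l| + 1); rewrite (le_lt_trans (ler_norm l)) ?ltrDl// => /(_ isT (x', y)) /= h.
    apply: (le_trans (h _)).
      by split; apply: xrU => //; apply: (le_ball _ xx'); lra.
    by rewrite ler_wpM2r//; lra.
  have rle : r / 2 <= `|x' - y|.
    rewrite leNgt; apply/negP => lt; apply: xy; apply/rV_ballP => // i.
    have /(rV_ballP _ _ r20)/(_ i) := xx'.
    have := le_lt_trans (coord_norm_le (x' - y) i) lt; rewrite !mxE !ltr_norml.
    by move=> /andP[? ?] /andP[? ?]; apply/andP; split; lra.
  apply: (@le_trans _ _ (4 * B / r * (r / 2))).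
    rewrite (_ : 4 * B / r * (r / 2) = B + B); last by field; rewrite gt_eqF.
    by apply: (le_trans (ler_normB _ _)); apply: lerD; exact: uB.
  apply: ler_pM => //; first exact: ltW.
  by have := normr_ge0 l; lra.
exists (`|M| + 1); first by rewrite addr_ge0.
move=> x y xK yK; apply: (hM (`|M| + 1)) => //.
by have := ler_norm M; lra.
Qed.

End compact_boxes.

(** * The inequality for Lipschitz functions on a box *)

Section poincare_lipschitz.
Variable R : realType.
Local Notation lam n := (lebesgue_rV R n).
Variables (n : nat) (k : 'I_n -> R) (phi : 'rV[R]_n -> R).
Hypothesis k1 : forall i, 1 < k i.
Hypothesis phi_continuous : forall x, pos_orthant x -> {for x, continuous phi}.
Hypothesis phi_midconvex : forall x y, pos_orthant x -> pos_orthant y ->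
  2 * phi (coord_pow k (2^-1 *: (x + y))) <= phi (coord_pow k x) + phi (coord_pow k y).

(** Nothing is known about [phi] off the orthant; extension by 0 makes the density measurable on the
    whole space. *)
Let W : 'rV[R]_n -> R := (fun z => expR (- phi z)) \_ pos_orthant.

Let WE z : pos_orthant z -> W z = expR (- phi z).
Proof. by move=> z0; rewrite /W patchE mem_set. Qed.

Let W_ge0 z : 0 <= W z.
Proof. by rewrite /W patchE; case: ifP => // _; exact: expR_ge0. Qed.

Let W_continuous z : pos_orthant z -> {for z, continuous (fun z => expR (- phi z))}.
Proof.
move=> z0; apply: (@continuous_comp _ _ _ (fun z => - phi z) (@expR R)); last exact: continuous_expR.
by apply: continuousN; exact: phi_continuous.
Qed.

Let mW : measurable_fun setT W.
Proof.
have mpos := open_measurable_rV (@open_pos_orthant R n).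
apply/(measurable_restrictT _ mpos).
apply: (@continuous_measurable_on R n pos_orthant _ (@open_pos_orthant R n)).
by move=> x; exact: W_continuous.
Qed.

Let box_pos (a b : R) (z : 'rV[R]_n) : 0 < a -> rV_box n a b z -> pos_orthant z.
Proof. by move=> a0 zb i; have /andP[az _] := zb i; exact: lt_le_trans az. Qed.

Let W_bounded a b : 0 < a -> exists2 C, 0 <= C & forall z, rV_box n a b z -> W z <= C.
Proof.
move=> a0; have [|C C0 WC] := @box_bounded R n a b (fun z => expR (- phi z)).
  by move=> x /(box_pos a0); exact: W_continuous.
exists C => // z zb; rewrite WE; last exact: box_pos zb.
exact: le_trans (ler_norm _) (WC _ zb).
Qed.

Let box_fun_W a b : 0 < a -> box_fun a b (W \_ (rV_box n a b)).
Proof.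
move=> a0; have [C C0 WC] := W_bounded b a0.
have mb : measurable (rV_box n a b) by exact: measurable_rV_box.
split.
- by apply/(measurable_restrictT _ mb); exact: (measurable_funTS mW).
- by move=> z; rewrite patchE; case: ifP.
- by exists C => z; rewrite patchE; case: ifPn => // /set_mem; exact: WC.
- by move=> z zb; rewrite patchE memNset.
Qed.

(** Powers are monotone, so the cube in the variables [x^k] is a product of intervals in [x], hence
    convex. Cutting the density down to it therefore preserves log-concavity. *)
Let mid_box a b x y : pos_orthant x -> pos_orthant y ->
  rV_box n a b (coord_pow k x) -> rV_box n a b (coord_pow k y) ->
  rV_box n a b (coord_pow k (2^-1 *: (x + y))).
Proof.
move=> x0 y0 xb yb i; rewrite !mxE mulrC.
have xi := x0 i; have yi := y0 i.
have /andP[x1 x2] := xb i; have /andP[y1 y2] := yb i.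
rewrite !mxE in x1 x2 y1 y2.
have m0 : 0 <= (x ord0 i + y ord0 i) / 2 by rewrite divr_ge0// addr_ge0// ltW.
have k0 : 0 <= k i by rewrite ltW// (lt_trans _ (k1 i)).
have mono s t : 0 <= s -> s <= t -> s `^ k i <= t `^ k i.
  by move=> s0 st; apply: ge0_ler_powR => //; rewrite nnegrE// (le_trans s0).
have [xy|/ltW yx] := leP (x ord0 i) (y ord0 i).
  apply/andP; split; first by apply: (le_trans x1); apply: mono; lra.
  by apply: (le_trans _ y2); apply: mono => //; lra.
apply/andP; split; first by apply: (le_trans y1); apply: mono; lra.
by apply: (le_trans _ x2); apply: mono => //; lra.
Qed.

Let W_logconcave a b x y : 0 < a -> pos_orthant x -> pos_orthant y ->
  (W \_ (rV_box n a b)) (coord_pow k x) * (W \_ (rV_box n a b)) (coord_pow k y) <=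
  (W \_ (rV_box n a b)) (coord_pow k (2^-1 *: (x + y))) ^+ 2.
Proof.
move=> a0 x0 y0; have out z : ~ rV_box n a b z -> (W \_ (rV_box n a b)) z = 0 by move=> zb; rewrite patchE memNset.
have [xb|xb] := pselect (rV_box n a b (coord_pow k x)); last first.
  by rewrite (out _ xb) mul0r sqr_ge0.
have [yb|yb] := pselect (rV_box n a b (coord_pow k y)); last first.
  by rewrite (out _ yb) mulr0 sqr_ge0.
have zb := mid_box x0 y0 xb yb.
rewrite !patchE !mem_set// (WE (box_pos a0 xb)) (WE (box_pos a0 yb)) (WE (box_pos a0 zb)).
rewrite -expRD -expRM_natl ler_expR.
have := phi_midconvex x0 y0; lra.
Qed.

Let alpha i (z : 'rV[R]_n) := k i ^+ 2 / (k i - 1) * z ord0 i ^+ 2 * W z.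

Let k_ge0 i : 0 <= k i ^+ 2 / (k i - 1).
Proof. by rewrite divr_ge0 ?sqr_ge0// subr_ge0 ltW. Qed.

Let alpha_ge0 i z : 0 <= alpha i z.
Proof. by apply: mulr_ge0 => //; apply: mulr_ge0 => //; exact: sqr_ge0. Qed.

Let malpha i : measurable_fun setT (alpha i).
Proof.
apply: measurable_funM => //; apply: measurable_funM => //.
by apply: measurable_funX; exact: measurable_coord_rV.
Qed.

Let alpha_bounded a b i : 0 < a -> exists A, forall z, rV_box n a b z -> alpha i z <= A.
Proof.
move=> a0; have [C C0 WC] := W_bounded b a0.
exists (k i ^+ 2 / (k i - 1) * b ^+ 2 * C) => z zb; apply: ler_pM => //; last exact: WC.
  by apply: mulr_ge0 => //; exact: sqr_ge0.
have /andP[az bz] := zb i; have z0 := lt_le_trans a0 az.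
by rewrite ler_wpM2l// lerXn2r ?nnegrE ?(ltW z0)// (le_trans (ltW z0)).
Qed.

(** Shifts have nonnegative coordinates, so [z_i^2] only grows; for small shifts [phi] changes by
    less than [ln (1 + eta)], which costs the density a factor of at most [1 + eta]. *)
Let alpha_osc a b eta : 0 < a -> 0 < eta ->
  exists2 d, 0 < d & forall d', 0 < d' <= d -> forall i z c, rV_box n a b z -> rV_box n 0 d' c ->
    alpha i z <= (1 + eta) * alpha i (z + c).
Proof.
move=> a0 eta0; have w1 : 1 < 1 + eta by rewrite ltrDl.
have [|d d0 hd] := @box_uniform_continuous R n a b (ln (1 + eta)) phi (ln_gt0 w1).
  by move=> x /(box_pos a0); exact: phi_continuous.
exists d => // d' /andP[d'0 d'd] i z c zb cb.
have cd : rV_box n 0 d c by move=> j; have /andP[-> cj] := cb j; exact: le_trans d'd.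
have zpos := box_pos a0 zb.
have zcpos : pos_orthant (z + c).
  by move=> j; rewrite mxE; have /andP[cj _] := cb j; rewrite ltr_wpDr//; exact: zpos.
have := hd z c zb cd; rewrite ltr_norml => /andP[_ h].
have hW : W z <= (1 + eta) * W (z + c).
  rewrite !WE// -[1 + eta]lnK ?posrE; last by exact: lt_trans w1.
  by rewrite -expRD ler_expR; lra.
rewrite /alpha [leRHS]mulrCA; apply: ler_pM => //.
  by apply: mulr_ge0 => //; exact: sqr_ge0.
have zi := zpos i; have /andP[ci _] := cb i.
rewrite ler_wpM2l// mxE lerXn2r ?nnegrE ?lerDl//; first exact: ltW.
by rewrite addr_ge0// ltW.
Qed.

Variables (F : 'rV[R]_n -> R) (L B : R).
Hypotheses (L0 : 0 <= L) (F_lip : forall x y, `|F x - F y| <= L * `|x - y|).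
Hypothesis FB : forall x, `|F x| <= B.

Let box_integral a b (u : 'rV[R]_n -> R) :
  (\int[lam n]_z (u z * (W \_ (rV_box n a b)) z)%:E = \int[lam n]_(z in rV_box n a b) (u z * W z)%:E)%E.
Proof.
rewrite [RHS]integral_mkcond; apply: eq_integral => z _.
by rewrite !patchE; case: ifP; rewrite ?mulr0.
Qed.

Let box_Rintegral a b (u : 'rV[R]_n -> R) :
  \int[lam n]_z (u z * (W \_ (rV_box n a b)) z) = \int[lam n]_(z in rV_box n a b) (u z * W z).
Proof. by rewrite /Rintegral box_integral. Qed.

(** Use [weighted_poincare_near] for a Steklov average with step at most [eta]. One factor [1 + eta]
    comes from there and one from [steklov_energy]; for [eta <= 1] the total error is linear in
    [eta], which tends to 0 while the outer box stays fixed. *)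
Lemma poincare_lipschitz (a b d0 : R) : 0 < a -> a < b -> 0 < d0 ->
  ((\int[lam n]_(z in rV_box n a b) (1 * W z) * \int[lam n]_(z in rV_box n a b) (F z ^+ 2 * W z) -
    (\int[lam n]_(z in rV_box n a b) (F z * W z)) ^+ 2)%:E <=
   (\int[lam n]_(z in rV_box n a b) (1 * W z))%:E *
     \sum_i \int[lam n]_(z in rV_box n a (b + d0))
       (k i ^+ 2 / (k i - 1) * z ord0 i ^+ 2 * W z * partial_ae F i z ^+ 2)%:E)%E.
Proof.
move=> a0 ab d00; set K := rV_box n a b; set M := Rintegral _ _ _.
set S2 := Rintegral _ _ _; set S1 := Rintegral _ _ _.
set Q := (\sum_i _)%E.
have M0 : 0 <= M by apply: Rintegral_ge0 => z _; rewrite mul1r.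
have Q0 : (0 <= Q)%E.
  apply: sume_ge0 => i _; apply: integral_ge0 => z _.
  by rewrite lee_fin mulr_ge0 ?sqr_ge0//; exact: alpha_ge0.
have hrho := box_fun_W b a0.
have hlog x y := @W_logconcave a b x y a0.
have B0 : 0 <= B := le_trans (normr_ge0 _) (FB 0).
have mF : measurable_fun setT F.
  by apply: continuous_measurable_rV; exact: lipschitz_continuous_rV F_lip.

(* Zero mass leaves [- S1^2] on the left and 0 on the right. *)
have [->|Mn0] := eqVneq M 0.
  by rewrite mul0r mul0e lee_fin sub0r oppr_le0 sqr_ge0.
have Mgt0 : 0 < M by rewrite lt_def Mn0.
have [Qoo|] := eqVneq Q +oo%E.
  by rewrite Qoo gt0_muley ?lte_fin// leey.
rewrite -ltey => Qfin.
have QE : Q = (fine Q)%:E by rewrite fineK// ge0_fin_numE.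
have q0 : 0 <= fine Q by exact: fine_ge0.
rewrite QE -EFinM lee_fin.
(* The 3 comes from [(1 + eta)^2 <= 1 + 3 eta], and [4 B L eta M^2] is the cost of passing from the
   average to [F]. *)
suff main (eta : R) : 0 < eta <= 1 ->
    M * S2 - S1 ^+ 2 <= M * fine Q + eta * (3 * (M * fine Q) + 4 * B * L * M ^+ 2).
  pose T := 3 * (M * fine Q) + 4 * B * L * M ^+ 2.
  have T0 : 0 <= T by rewrite addr_ge0 ?mulr_ge0 ?sqr_ge0.
  apply/ler_addgt0Pr => e e0.
  pose eta := Num.min 1 (e / (T + 1)).
  have T1 : 0 < T + 1 by rewrite ltr_wpDl.
  have eta0 : 0 < eta by rewrite /eta lt_min ltr01 divr_gt0.
  apply: (le_trans (main eta _)); first by rewrite eta0 /eta ge_min lexx.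
  rewrite lerD2l -/T; apply: (@le_trans _ _ (eta * (T + 1))); first by rewrite ler_pM2l// lerDl.
  by rewrite -ler_pdivlMr// /eta ge_min lexx orbT.
move=> /andP[eta0 eta1].
have [d1 d10 osc] := alpha_osc b a0 eta0.
(* [d0] keeps the averages inside the outer box, [d1] controls the oscillation of [alpha], and [eta]
   brings the average close to [F]. *)
pose d := Num.min (Num.min d0 d1) eta.
have d_gt0 : 0 < d by rewrite !lt_min d00 d10.
have dd0 : d <= d0 by rewrite /d !ge_min lexx.
have dd1 : 0 < d <= d1 by rewrite d_gt0 /d !ge_min lexx orbT.
have deta : d <= eta by rewrite /d !ge_min lexx orbT.
have energy i : (\int[lam n]_(z in K) (alpha i z * steklov_d F d i z ^+ 2)%:E <=
    (1 + eta)%:E * \int[lam n]_(z in rV_box n a (b + d0)) (alpha i z * partial_ae F i z ^+ 2)%:E)%E.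
  have [A hA] := alpha_bounded (b + d) i a0.
  have := steklov_energy L0 d_gt0 F_lip i (ltW eta0) (malpha i) (alpha_ge0 i) hA (osc d dd1 i).
  move/le_trans; apply; rewrite lee_pmul2l ?lte_fin ?addr_gt0//.
  apply: ge0_subset_integral.
  - exact: measurable_rV_box.
  - exact: measurable_rV_box.
  - apply/measurable_EFinP; apply: measurable_funTS; apply: measurable_funM; first exact: malpha.
    apply: measurable_funX; apply: measurable_partial_ae; exact: lipschitz_continuous_rV F_lip.
  - by move=> z _; rewrite lee_fin mulr_ge0 ?sqr_ge0//; exact: alpha_ge0.
  - move=> z zb i'; have /andP[-> zi] := zb i'; apply: (le_trans zi); by rewrite lerD2l.
have mH : measurable_fun setT (steklov F d).
  apply: continuous_measurable_rV; apply: lipschitz_continuous_rV => x y.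
  exact: steklov_lip F_lip FB x y.
have mg i : measurable_fun setT (steklov_d F d i).
  apply: continuous_measurable_rV; apply: lipschitz_continuous_rV => x y.
  exact: steklov_d_lip F_lip i x y.
have C0 : 0 <= (6 + 2 * n%:R) * (L / d) by rewrite mulr_ge0 ?addr_ge0 ?mulr_ge0// invr_ge0 ltW.
have := @weighted_poincare_near R n k a b (W \_ K) k1 a0 ab hrho hlog
  (steklov F d) (fun i => steklov_d F d i) B L _ mH (steklov_bound d F_lip FB) mg
  (steklov_d_bound d L0 F_lip) C0 (steklov_taylor L0 d_gt0 F_lip FB) F (L * d) eta eta0.
rewrite !box_Rintegral -/M -/S1 -/S2 => /(_ Mgt0 mF FB (steklov_close L0 d_gt0 F_lip FB)) hw.
have sumQ : (\sum_i \int[lam n]_z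
    (k i ^+ 2 / (k i - 1) * z ord0 i ^+ 2 * steklov_d F d i z ^+ 2 * (W \_ K) z)%:E <=
    (1 + eta)%:E * (fine Q)%:E)%E.
  rewrite -QE /Q ge0_sume_distrr; last first.
    move=> i _; apply: integral_ge0 => z _.
    by rewrite lee_fin mulr_ge0 ?sqr_ge0//; exact: alpha_ge0.
  apply: lee_sum => i _; apply: le_trans (energy i); rewrite box_integral.
  rewrite le_eqVlt; apply/orP; left; apply/eqP; apply: eq_integral => z _.
  by congr (_%:E); rewrite /alpha; ring.
have hw2 : (M%:E * ((1 + eta)%:E * \sum_i \int[lam n]_z
    (k i ^+ 2 / (k i - 1) * z ord0 i ^+ 2 * steklov_d F d i z ^+ 2 * (W \_ K) z)%:E) <=
    (M * ((1 + eta) * ((1 + eta) * fine Q)))%:E)%E.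
  rewrite 3!EFinM; apply: lee_wpmul2l; first by rewrite lee_fin.
  apply: lee_wpmul2l; first by rewrite lee_fin addr_ge0// ltW.
  exact: sumQ.
have := le_trans hw (leeD hw2 (lexx _)); rewrite -EFinD lee_fin => h.
apply: (le_trans h).
have Mq0 : 0 <= M * fine Q by rewrite mulr_ge0.
have h1 : eta ^+ 2 * (M * fine Q) <= eta * (M * fine Q).
  by rewrite ler_wpM2r// expr2 ger_pMr.
have h2 : 4 * B * (L * d) * M ^+ 2 <= 4 * B * (L * eta) * M ^+ 2.
  by rewrite ler_wpM2r ?sqr_ge0// ler_wpM2l ?mulr_ge0// ler_wpM2l.
rewrite (_ : M * ((1 + eta) * ((1 + eta) * fine Q)) =
  M * fine Q + 2 * (eta * (M * fine Q)) + eta ^+ 2 * (M * fine Q)); last by ring.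
rewrite (_ : eta * (3 * (M * fine Q) + 4 * B * L * M ^+ 2) = 3 * (eta * (M * fine Q)) + 4 * B * (L * eta) * M ^+ 2); last by ring.
by move: h1 h2; lra.
Qed.

End poincare_lipschitz.

(** * From boxes to the orthant *)

Section integral_comparison.
Context d (T : measurableType d) (R : realType).
Implicit Types (m : {measure set T -> \bar R}) (D : set T).

(* Nonnegative integrals are suprema over simple minorants, so no measurability is required here. *)
Lemma ge0_le_integral_subset m D (D' : set T) (u v : T -> \bar R) : D `<=` D' ->
  (forall x, D x -> 0 <= u x)%E -> (forall x, D' x -> 0 <= v x)%E ->
  (forall x, D x -> u x <= v x)%E ->
  (\int[m]_(x in D) u x <= \int[m]_(x in D') v x)%E.
Proof.
move=> DD' u0 v0 uv; rewrite !ge0_integralE//; apply: ereal_sup_le => _ [h hu <-].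
exists h => // x; apply: (le_trans (hu x)); rewrite !patchE.
case: ifPn => [/set_mem Dx|_]; first by rewrite mem_set; [exact: uv|exact: DD'].
by case: ifPn => // /set_mem; exact: v0.
Qed.

Lemma integral_density (lam m : {measure set T -> \bar R}) D (rho u : T -> R) :
  measurable D -> measurable_fun D rho -> (forall x, D x -> 0 <= rho x) ->
  (forall A, measurable A -> A `<=` D -> m A = \int[lam]_(x in A) (rho x)%:E)%E ->
  measurable_fun D u ->
  (\int[m]_(x in D) (u x)%:E = \int[lam]_(x in D) (u x * rho x)%:E)%E.
Proof.
move=> mD mrho rho0 hm mu; have mu' : measurable_fun D (EFin \o u) by exact/measurable_EFinP.
rewrite integralE [RHS]integralE; congr (_ - _)%E.
  rewrite (ge0_integral_density mD mrho rho0 hm)//; last exact: measurable_funepos.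
  apply: eq_integral => x /set_mem Dx; rewrite !funeposE -!EFin_max -EFinM.
  by rewrite maxr_pMl ?mul0r// rho0.
rewrite (ge0_integral_density mD mrho rho0 hm)//; last exact: measurable_funeneg.
apply: eq_integral => x /set_mem Dx; rewrite !funenegE -!EFinN -!EFin_max -EFinM.
by rewrite maxr_pMl ?mul0r ?mulNr// rho0.
Qed.

End integral_comparison.

(** * Retraction onto a cube *)

Section clamp.
Variable R : realType.

(** A retraction onto the cube, 1-Lipschitz for the sup norm; composition with it extends a function
    that is Lipschitz on the cube to a bounded, globally Lipschitz one. *)
Definition clamp n (a b : R) (v : 'rV[R]_n) : 'rV[R]_n :=
  \row_i Num.max a (Num.min b (v ord0 i)).

Lemma clamp_box n a b (v : 'rV[R]_n) : a <= b -> rV_box n a b (clamp a b v).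
Proof. by move=> ab i; rewrite mxE le_max lexx/= ge_max ab ge_min lexx. Qed.

Lemma clamp_id n a b (v : 'rV[R]_n) : rV_box n a b v -> clamp a b v = v.
Proof.
move=> vb; apply/rowP => i; rewrite mxE; have /andP[av bv] := vb i.
by rewrite (min_idPr bv) (max_idPr av).
Qed.

Lemma clamp_lipschitz n a b (v w : 'rV[R]_n) : a <= b ->
  `|clamp a b v - clamp a b w| <= `|v - w|.
Proof.
move=> ab; apply: rV_norm_le => // i; apply: le_trans (coord_norm_le (v - w) i).
rewrite !mxE; move: (v ord0 i) (w ord0 i) => s t.
rewrite ler_norml; have := ler_norm (s - t); have := ler_norm (- (s - t)); rewrite normrN.
move=> h1 h2; case: (leP b s) => ?; case: (leP b t) => ?; rewrite ?(max_idPr ab);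
  case: (leP a s) => ?; case: (leP a t) => ?; apply/andP; split; lra.
Qed.

End clamp.

Section local_to_global.
Variable R : realType.
Local Notation lam n := (lebesgue_rV R n).
Variables (n : nat) (k : 'I_n -> R) (phi f : 'rV[R]_n -> R).
Variable mu : {measure set 'rV[R]_n -> \bar R}.
Hypothesis k1 : forall i, 1 < k i.
Hypothesis phi_continuous : forall x, pos_orthant x -> {for x, continuous phi}.
Hypothesis phi_midconvex : forall x y, pos_orthant x -> pos_orthant y ->
  2 * phi (coord_pow k (2^-1 *: (x + y))) <= phi (coord_pow k x) + phi (coord_pow k y).
Hypothesis mu_density : has_density_on pos_orthant mu (fun x => expR (- phi x)).
Hypothesis f_lip : locally_lipschitz_on pos_orthant f.

Let energy (x : 'rV[R]_n) :=
  \sum_(i < n) k i ^+ 2 / (k i - 1) * x ord0 i ^+ 2 * `|partial i f x| ^+ 2.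

Let box_pos (a b : R) : 0 < a -> rV_box n a b `<=` pos_orthant.
Proof. by move=> a0 z zb i; have /andP[az _] := zb i; exact: lt_le_trans az. Qed.

Let k_ge0 i : 0 <= k i ^+ 2 / (k i - 1).
Proof. by rewrite divr_ge0 ?sqr_ge0// subr_ge0 ltW. Qed.

Lemma locally_lipschitz_continuous x : pos_orthant x -> {for x, continuous f}.
Proof.
move=> x0; have [U xU [l [_ hl]]] := f_lip x0.
have nx : nbhs x (U `&` pos_orthant).
  by apply: filterI => //; apply: open_nbhs_nbhs; split => //; exact: open_pos_orthant.
have FF : Filter (nbhs x) := nbhs_filter (x : 'rV[R]_n).
apply/cvgrPdist_lt => e e0.
pose M := `|l| + 1.
have M0 : 0 < M by rewrite ltr_wpDl.
have {hl} := hl M; rewrite (le_lt_trans (ler_norm l)) ?ltrDl// => /(_ isT) hl.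
have ne : nbhs x (ball x (e / M)) by apply: nbhsx_ballx; rewrite divr_gt0.
apply: filterS2 (nx) ne => y Uy xy.
have /= h := hl (x, y) (conj (nbhs_singleton nx) Uy).
apply: (le_lt_trans h); rewrite -ltr_pdivlMl// mulrC.
by move: xy; rewrite -ball_normE.
Qed.

Let mf (a b : R) : 0 < a -> measurable_fun (rV_box n a b) f.
Proof.
move=> a0; apply: (@measurable_funS _ _ _ _ pos_orthant).
- exact: open_measurable_rV (@open_pos_orthant R n).
- exact: box_pos.
- exact: (@continuous_measurable_on R n pos_orthant _ (@open_pos_orthant R n) locally_lipschitz_continuous).
Qed.

Let rho x := expR (- phi x).

Let rho_continuous z : pos_orthant z -> {for z, continuous rho}.
Proof.
move=> z0; apply: (@continuous_comp _ _ _ (fun z => - phi z) (@expR R)); last exact: continuous_expR.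
by apply: continuousN; exact: phi_continuous.
Qed.

Let mrho (a b : R) : 0 < a -> measurable_fun (rV_box n a b) rho.
Proof.
move=> a0; apply: (@measurable_funS _ _ _ _ pos_orthant).
- exact: open_measurable_rV (@open_pos_orthant R n).
- exact: box_pos.
- exact: (@continuous_measurable_on R n pos_orthant _ (@open_pos_orthant R n) rho_continuous).
Qed.

Let box_density (a b : R) : 0 < a -> forall A, measurable A -> A `<=` rV_box n a b ->
  mu A = (\int[lam n]_(x in A) (rho x)%:E)%E.
Proof. by move=> a0 A mA AK; apply: mu_density => // x /AK; exact: box_pos. Qed.

Let box_int (a b C : R) (u : 'rV[R]_n -> R) : 0 < a -> measurable_fun (rV_box n a b) u ->
  (forall x, rV_box n a b x -> `|u x| <= C) ->
  (\int[mu]_(x in rV_box n a b) (u x)%:E = (\int[lam n]_(x in rV_box n a b) (u x * rho x))%:E)%E.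
Proof.
move=> a0 mu' uC; have mb : measurable (rV_box n a b) by exact: measurable_rV_box.
rewrite (@integral_density _ _ _ (lam n) mu _ rho)//; [|exact: mrho|by move=> ? _; exact: expR_ge0|exact: box_density].
rewrite EFin_Rintegral//.
have [|D D0 hD] := @box_bounded R n a b rho.
  by move=> x xb; apply: rho_continuous; exact: box_pos xb.
apply: (@bounded_integrable _ _ _ _ _ _ (C * D)) => //.
- exact: rV_box_measure.
- by apply: measurable_funM => //; exact: mrho.
- by move=> x xb; rewrite normrM; apply: ler_pM => //; [exact: uC|exact: hD].
Qed.

(** [f] composed with the clamp onto a larger box is globally Lipschitz and agrees with [f] near
    [[a, b + 1]^n], so the partial derivatives coincide there. The moments are real numbers, so that
    different boxes can be compared by real arithmetic, and the energy is enlarged to the orthant,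
    which makes it independent of the box. *)
Lemma box_poincare (a b : R) : 0 < a -> a < b -> exists M S1 S2 : R,
  [/\ mu (rV_box n a b) = M%:E,
      (\int[mu]_(x in rV_box n a b) (f x)%:E = S1%:E)%E,
      (\int[mu]_(x in rV_box n a b) (f x ^+ 2)%:E = S2%:E)%E &
      ((M * S2 - S1 ^+ 2)%:E <= M%:E * \int[mu]_(x in pos_orthant) (energy x)%:E)%E].
Proof.
move=> a0 ab; set K := rV_box n a b.
(* Margins that leave a neighbourhood of [[a, b + 1]^n] inside the larger box. *)
pose lo := a / 2; pose hi := b + 2.
have lo0 : 0 < lo by rewrite divr_gt0.
have lohi : lo <= hi by rewrite /lo /hi; lra.
have cf x : rV_box n lo hi x -> {for x, continuous f}.
  by move=> xb; apply: locally_lipschitz_continuous; exact: box_pos xb.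
have [B B0 fB] := box_bounded cf.
have [|L L0 fL] := box_lipschitz cf.
  move=> x /(box_pos lo0) x0; have [U xU hU] := f_lip x0.
  exists (U `&` pos_orthant) => //.
  by apply: filterI => //; apply: open_nbhs_nbhs; split => //; exact: open_pos_orthant.
pose F := f \o clamp lo hi.
have FL x y : `|F x - F y| <= L * `|x - y|.
  apply: (le_trans (fL _ _ (clamp_box _ lohi) (clamp_box _ lohi))).
  by rewrite ler_wpM2l// clamp_lipschitz.
have FB x : `|F x| <= B by apply: fB; exact: clamp_box.
have sub a' b' : lo <= a' -> b' <= hi -> rV_box n a' b' `<=` rV_box n lo hi.
  by move=> h1 h2 z zb i; have /andP[h3 h4] := zb i; rewrite (le_trans h1)//= (le_trans h4).
have Ksub : K `<=` rV_box n lo hi by apply: sub; rewrite /lo /hi; lra.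
have FE x : K x -> F x = f x by move=> Kx; rewrite /F/= clamp_id//; exact: Ksub.
(* Only an inequality: where the derivative does not exist, [partial_ae] is 0 while [partial] has a
   default value. *)
have partialE i x : rV_box n a (b + 1) x -> `|partial_ae F i x| <= `|partial i f x|.
  move=> xb; rewrite /partial_ae normrM.
  rewrite (_ : 'D_(delta_mx ord0 i) F x = partial i f x); last first.
    apply: near_eq_derive.
    have l1 : 0 < Num.min lo 1 by rewrite lt_min lo0/=.
    have : nbhs x (ball x (Num.min lo 1)) by exact: nbhsx_ballx.
    apply: filterS => y /(rV_ballP _ _ l1) xy; rewrite /F/= clamp_id// => j.
    have := xy j; rewrite lt_min => /andP[]; rewrite !ltr_norml => /andP[h1 h2] /andP[h3 h4].
    have /andP[h5 h6] := xb j; rewrite /hi; apply/andP; split; last lra.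
    by move: h1 h2; rewrite /lo; lra.
  rewrite ler_piMl// indicE; case: (_ \in _); rewrite ?normr1 ?normr0//.
pose M := \int[lam n]_(z in K) (1 * rho z).
exists M, (\int[lam n]_(z in K) (f z * rho z)), (\int[lam n]_(z in K) (f z ^+ 2 * rho z)).
have mK : measurable K by exact: measurable_rV_box.
split.
- rewrite -(@box_int a b 1 (fun=> 1))//; last by move=> x _; rewrite normr1.
  by rewrite integral_cst// mul1e.
- apply: (@box_int a b B) => //; first exact: mf.
  by move=> x Kx; apply: fB; exact: Ksub.
- apply: (@box_int a b (B ^+ 2)) => //; first by apply: measurable_funX; exact: mf.
  by move=> x Kx; rewrite normrX lerXn2r ?nnegrE//; apply: fB; exact: Ksub.
have := poincare_lipschitz k1 phi_continuous phi_midconvex L0 FL FB a0 ab (ltr01 : 0 < (1 : R)).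
have WE x : pos_orthant x -> ((fun z => expR (- phi z)) \_ pos_orthant) x = rho x.
  by move=> x0; rewrite patchE mem_set.
have RE (u v : 'rV[R]_n -> R) : (forall x, K x -> u x = v x) ->
    \int[lam n]_(z in K) (u z * ((fun z => expR (- phi z)) \_ pos_orthant) z) =
    \int[lam n]_(z in K) (v z * rho z).
  move=> uv; apply: eq_Rintegral => x /set_mem Kx.
  by rewrite uv// WE//; exact: box_pos Kx.
rewrite (RE (fun=> 1) (fun=> 1))// (RE F f)// (RE (fun z => F z ^+ 2) (fun z => f z ^+ 2)); last first.
  by move=> x Kx; rewrite FE.
move=> h; apply: (le_trans h); apply: lee_wpmul2l.
  by rewrite lee_fin; apply: Rintegral_ge0 => z _; rewrite mul1r expR_ge0.
have mK1 : measurable (rV_box n a (b + 1)) by exact: measurable_rV_box.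
pose g i (z : 'rV[R]_n) := k i ^+ 2 / (k i - 1) * z ord0 i ^+ 2 * partial_ae F i z ^+ 2.
have g0 i z : 0 <= g i z.
  by apply: mulr_ge0; [apply: mulr_ge0 => //|]; exact: sqr_ge0.
have mg i : measurable_fun setT (g i).
  apply: measurable_funM; last first.
    apply: measurable_funX; apply: measurable_partial_ae; exact: lipschitz_continuous_rV FL.
  by apply: measurable_funM => //; apply: measurable_funX; exact: measurable_coord_rV.
have gE i : (\int[lam n]_(z in rV_box n a (b + 1)) (k i ^+ 2 / (k i - 1) * z ord0 i ^+ 2 *
     ((fun z => expR (- phi z)) \_ pos_orthant) z * partial_ae F i z ^+ 2)%:E =
    \int[mu]_(z in rV_box n a (b + 1)) (g i z)%:E)%E.
  rewrite (@integral_density _ _ _ (lam n) mu _ rho)//.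
  - apply: eq_integral => z /set_mem zb; rewrite WE; last exact: box_pos zb.
    by congr (_%:E); rewrite /g; ring.
  - exact: mrho.
  - by move=> x _; exact: expR_ge0.
  - exact: box_density.
  - exact: measurable_funTS.
under eq_bigr do rewrite gE.
rewrite -ge0_integral_sum//; last 2 first.
- by move=> i; apply/measurable_EFinP; exact: measurable_funTS.
- by move=> i z _; rewrite lee_fin.
have e0 i (z : 'rV[R]_n) : 0 <= k i ^+ 2 / (k i - 1) * z ord0 i ^+ 2 * `|partial i f z| ^+ 2.
  by apply: mulr_ge0; [apply: mulr_ge0 => //|]; exact: sqr_ge0.
apply: ge0_le_integral_subset.
- exact: box_pos.
- by move=> x _; rewrite sumEFin lee_fin sumr_ge0.
- by move=> x _; rewrite lee_fin sumr_ge0.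
move=> x xb; rewrite sumEFin lee_fin; apply: ler_sum => i _.
rewrite /g ler_wpM2l//; first by apply: mulr_ge0 => //; exact: sqr_ge0.
by rewrite -[leLHS]real_normK ?num_real// lerXn2r ?nnegrE//; exact: partialE.
Qed.

End local_to_global.

(** [m + 2] keeps the lower bound strictly below the upper one already for [m = 0]. *)
Lemma bigcup_rV_box (R : realType) n :
  \bigcup_m rV_box n (m.+2%:R^-1 : R) m.+2%:R = pos_orthant.
Proof.
apply/seteqP; split => [x [m _ xm] i|x x0].
  by have /andP[+ _] := xm i; apply: lt_le_trans; rewrite invr_gt0.
(* A single number above every coordinate and every inverse of a coordinate. *)
pose C : R := \sum_i (x ord0 i + (x ord0 i)^-1).
have xC i : x ord0 i + (x ord0 i)^-1 <= C.
  rewrite /C (bigD1 i)//= lerDl; apply: sumr_ge0 => j _.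
  by have xj := x0 j; rewrite addr_ge0 ?invr_ge0// ltW.
have C0 : 0 <= C.
  by apply: sumr_ge0 => j _; have xj := x0 j; rewrite addr_ge0 ?invr_ge0// ltW.
pose m := Num.bound C.
have Cm : C < m.+2%:R.
  by apply: (lt_trans (archi_boundP C0)); rewrite ltr_nat -/m ltnS leqW.
exists m => // i; have xi := x0 i; have xiV : 0 < (x ord0 i)^-1 by rewrite invr_gt0.
have xCi := xC i; apply/andP; split; last by lra.
by rewrite invf_ple ?posrE ?ltr0n//; lra.
Qed.

Lemma rV_box_nondecreasing (R : realType) n :
  nondecreasing_seq (fun m => rV_box n (m.+2%:R^-1 : R) m.+2%:R).
Proof.
move=> p q pq; apply/subsetPset => x xp i; have /andP[h1 h2] := xp i.
apply/andP; split; last by apply: (le_trans h2); rewrite ler_nat.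
by apply: le_trans h1; rewrite lef_pV2 ?posrE ?ltr0n// ler_nat.
Qed.

(** For [p >= m] the box inequality reads [M' S2' <= M' Q + S1'^2], where [S1'] tends to 0 and [M']
    is at least the mass of the smaller box [K m]. Hence every truncated second moment is at most
    [Q], whether or not the total mass is finite, and monotone convergence concludes. *)
Theorem theorem6p1 (R : realType) (n : nat) (hn : (1 <= n)%N)
    (k : 'I_n -> R) (hk : forall i, 1 < k i)
    (mu : {measure set 'rV[R]_n -> \bar R})
    (phi : 'rV[R]_n -> R)
    (hphi : smooth_on pos_orthant phi)
    (hmu : has_density_on pos_orthant mu (fun x => expR (- phi x)))
    (hconv : convex_function pos_orthant (fun x => phi (coord_pow k x)))
    (f : 'rV[R]_n -> R)
    (hfint : mu.-integrable pos_orthant (EFin \o f))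
    (hflip : locally_lipschitz_on pos_orthant f)
    (hf0 : (\int[mu]_(x in pos_orthant) (f x)%:E = 0)%E) :
  (\int[mu]_(x in pos_orthant) (f x ^+ 2)%:E <=
   \int[mu]_(x in pos_orthant)
     (\sum_(i < n) k i ^+ 2 / (k i - 1) * x ord0 i ^+ 2
                   * `|partial i f x| ^+ 2)%:E)%E.
Proof.
have phic x : pos_orthant x -> {for x, continuous phi}.
  by move=> x0; have [] := hphi [::] x x0.
have phi_mid x y : pos_orthant x -> pos_orthant y ->
    2 * phi (coord_pow k (2^-1 *: (x + y))) <= phi (coord_pow k x) + phi (coord_pow k y).
  move=> x0 y0; have h0 : 0 <= 2^-1 :> R by [].
  have h1 : 2^-1 <= 1 :> R by lra.
  have := hconv (Itv01 h0 h1) x y (mem_set x0) (mem_set y0).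
  rewrite [X in _ <= X -> _]convRE/= /conv/=.
  rewrite (_ : unstable.onem 2^-1 = 2^-1 :> R); last by rewrite /unstable.onem; field.
  by rewrite -scalerDr; lra.
set Q := (X in (_ <= X)%E).
have Q0 : (0 <= Q)%E.
  apply: integral_ge0 => x _; rewrite lee_fin; apply: sumr_ge0 => i _.
  apply: mulr_ge0; last exact: sqr_ge0.
  by rewrite mulr_ge0 ?sqr_ge0// divr_ge0 ?sqr_ge0// subr_ge0 ltW.
have [->|] := eqVneq Q +oo%E; first exact: leey.
rewrite -ltey => Qoo.
have QE : Q = (fine Q)%:E by rewrite fineK// ge0_fin_numE.
pose K m := rV_box n (m.+2%:R^-1 : R) m.+2%:R.
have mpos : measurable (@pos_orthant R n) := open_measurable_rV (@open_pos_orthant R n).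
have mK m : measurable (K m) by exact: measurable_rV_box.
have ndK : nondecreasing_seq K := @rV_box_nondecreasing R n.
have UK : \bigcup_m K m = pos_orthant := bigcup_rV_box R n.
have Kpos m : K m `<=` pos_orthant by rewrite -UK; exact: bigcup_sup.
have mf : measurable_fun pos_orthant f.
  by apply/measurable_EFinP; exact: (measurable_int _ hfint).
have mf2 m : measurable_fun (K m) (fun x => (f x ^+ 2)%:E).
  apply/measurable_EFinP; apply: measurable_funX; exact: measurable_funS mf.
have f20 m x : K m x -> (0 <= (f x ^+ 2)%:E)%E by move=> _; rewrite lee_fin sqr_ge0.
(* Dominated convergence with majorant [|f|]: each point of the orthant lies in all boxes from some
   index on. *)
have S1_cvg : ((\int[mu]_(x in K m) (f x)%:E)%E @[m --> \oo] --> (0 : \bar R))%E.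
  rewrite -hf0 (_ : (fun m => _) =
    fun m => (\int[mu]_(x in pos_orthant) ((EFin \o f) \_ (K m)) x)%E); last first.
    apply/funext => m; rewrite integral_mkcond [RHS]integral_mkcond.
    apply: eq_integral => x _; rewrite !patchE; case: ifPn => [/set_mem Kx|_].
      by rewrite mem_set//; exact: Kpos Kx.
    by case: ifP.
  apply: (@dominated_cvg _ _ _ mu _ mpos _ _ (abse \o (EFin \o f))) => //.
  - move=> m; apply: measurable_funTS; apply/(measurable_restrictT _ (mK m)).
    by apply/measurable_EFinP; exact: measurable_funS mf.
  - move=> x; rewrite -{1}UK => -[p _ Kx].
    apply: cvg_near_cst; near=> m.
    rewrite patchE mem_set//.
    have pm : (p <= m)%N by near: m; exists p.
    by move/subsetPset : (ndK _ _ pm); apply.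
  - exact: integrable_abse.
  - by move=> m x _; rewrite patchE; case: ifP => //= _; rewrite normr0 lee_fin.
have box_le m : (\int[mu]_(x in K m) (f x ^+ 2)%:E <= Q)%E.
  have a0 p : 0 < p.+2%:R^-1 :> R by rewrite invr_gt0.
  have ab p : p.+2%:R^-1 < p.+2%:R :> R.
    by apply: (@lt_trans _ _ 1); [rewrite invf_lt1 ?ltr1n|rewrite ltr1n].
  have bp p := box_poincare hk phic phi_mid hmu hflip (a0 p) (ab p).
  have [M [S1 [S2 [ME S1E S2E le]]]] := bp m.
  have M0 : 0 <= M by rewrite -lee_fin -ME.
  (* A null box has zero second moment; otherwise its mass bounds those of the larger boxes away
     from 0. *)
  have [MM|Mn0] := eqVneq M 0.
    by rewrite null_set_integral ?ME ?MM//; exact: mf2.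
  have Mgt0 : 0 < M by rewrite lt_def Mn0.
  rewrite S2E QE lee_fin; apply/ler_addgt0Pr => e e0.
  (* Then [|S1'| < d <= 1] gives [S1'^2 <= d <= e M <= e M']. *)
  pose d := Num.min 1 (e * M).
  have d0 : 0 < d by rewrite lt_min ltr01 mulr_gt0.
  have [N _ hN] : \forall p \near \oo, (`|\int[mu]_(x in K p) (f x)%:E| < d%:E)%E.
    move/cvg_abse : S1_cvg; rewrite abse0 => /(_ [set t | (t < d%:E)%E]); apply.
    by apply: open_nbhs_nbhs; split; [exact: open_ereal_lt_ereal|rewrite /= lte_fin].
  pose p := maxn m N.
  have [M' [S1' [S2' [ME' S1E' S2E' le']]]] := bp p.
  have S1d : `|S1'| < d by have := hN p (leq_maxr _ _); rewrite /= S1E' lte_fin.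
  have Kmp : K m `<=` K p by apply/subsetPset; exact: ndK (leq_maxl _ _).
  have MM' : M <= M' by rewrite -lee_fin -ME -ME'; apply: le_measure; rewrite ?inE; [exact: mK|exact: mK|].
  have SS' : S2 <= S2'.
    rewrite -lee_fin -S2E -S2E'; apply: ge0_subset_integral.
    - exact: mK.
    - exact: mK.
    - exact: (mf2 p).
    - exact: (f20 p).
    - exact: Kmp.
  have M'0 : 0 < M' by exact: lt_le_trans MM'.
  move: le'; rewrite -/Q QE -EFinM lee_fin => le'.
  have S1e : S1' ^+ 2 <= e * M'.
    apply: (@le_trans _ _ d).
      rewrite -(real_normK (num_real S1')) expr2 -[d]mulr1; apply: ler_pM => //; first exact: ltW.
      by rewrite (le_trans (ltW S1d))// /d ge_min lexx.
    by rewrite /d (@le_trans _ _ (e * M)) ?ge_min ?lexx ?orbT// ler_pM2l.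
  apply: (le_trans SS'); rewrite -(ler_pM2l M'0) mulrDr.
  by move: le' S1e; lra.
have := @ge0_nondecreasing_set_cvg_integral _ _ R K (fun x => (f x ^+ 2)%:E) mu ndK mK mf2 f20.
rewrite UK => cv; rewrite -(cvg_lim _ cv)//; apply: lime_le; first by apply/cvg_ex; eexists; exact: cv.
by apply: nearW => m; exact: box_le.
Unshelve. all: by end_near. Qed.
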